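(* Let $p\in[1,\infty)$, $q\in(1,\infty)$, $\beta\in(0,1]$ with $\frac{\beta}{p}+\frac1q\le 1$. Let $\alpha\in L^q(0,1)$ be a spectral function and let $c:\boldsymbol{\mathcal X}\to\mathbb R$ be $\beta$-Hölder continuous. Let $u_N$ be some upper bound on the $W_p$-optimal $N$-point uniform quantization error of some fixed minimizer $\gamma^*$ of $\mathcal F$, i.e. $e_{p,N}(\gamma^* )\le u_N$. Then, letting $\lambda_N=u_N^{-(p-\beta)}$ in the definition of $\mathcal F_N$, we have, as $N\to\infty$, $$|\min\mathcal F_N-\min\mathcal F|=O(u_N^\beta).$$ Moreover, for any sequence of minimizers $\delta_{Y_N^*}\in\operatorname{argmin}\mathcal F_N$, $N\in\mathbb N$, every (weak) limit point is a minimizer of $\mathcal F$, and for every $j\in\{1,\dots,D\}$ we have $$W_p(\rho_j,\pi^j_\#\delta_{Y_N^*})=O(u_N).$$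
   Context: Setting: for $j=1,\dots,D$, $\mathcal X_j\subseteq\mathbb R^{d_j}$ is a convex subset of a Euclidean space, $\boldsymbol{\mathcal X}=\mathcal X_1\times\dots\times\mathcal X_D$ carries the Euclidean norm of $\mathbb R^{d_1}\times\dots\times\mathbb R^{d_D}$, $\pi^j:\boldsymbol{\mathcal X}\to\mathcal X_j$ is the projection, and $\rho_j$ is a probability measure on $\mathcal X_j$ with finite $p$-moment. $\Gamma(\rho_1,\dots,\rho_D)$ is the set of probability measures $\gamma$ on $\boldsymbol{\mathcal X}$ with $\pi^j_\#\gamma=\rho_j$ for all $j$. $W_p$ is the $p$-Wasserstein distance. A spectral function is a nonnegative, nondecreasing function $\alpha:(0,1)\to[0,+\infty)$ with $\int_0^1\alpha=1$; the associated spectral risk measure is $\mathcal R_\alpha(\mu)=\int_0^1F_\mu^{-1}(t)\alpha(t)\,dt$, where $F_\mu^{-1}$ is the quantile function of the probability measure $\mu$ on $\mathbb R$. For $Y=(y_1,\dots,y_N)\in\boldsymbol{\mathcal X}^N$ let $\delta_Y=\frac1N\sum_{i=1}^N\delta_{y_i}$, and $\mathcal D_N=\{\delta_Y:Y\in\boldsymbol{\mathcal X}^N\}$. The $N$-point uniform quantization error of a probability measure $\nu$ on $\boldsymbol{\mathcal X}$ with finite $p$-moment is $e_{p,N}(\nu)=\inf_{Y\in\boldsymbol{\mathcal X}^N}W_p(\nu,\delta_Y)$. For a penalty parameter $\lambda_N>0$, define functionals with values in $\mathbb R\cup\{+\infty\}$: $\mathcal F(\gamma)=-\mathcal R_\alpha(c_\#\gamma)$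 if $\gamma\in\Gamma(\rho_1,\dots,\rho_D)$, $+\infty$ otherwise; $\mathcal F_N(\gamma)=-\mathcal R_\alpha(c_\#\gamma)+\lambda_N\sum_{j=1}^DW_p(\rho_j,\pi^j_\#\gamma)^p$ if $\gamma\in\mathcal D_N$, $+\infty$ otherwise. $\min\mathcal F$ and $\min\mathcal F_N$ denote their minimal values.
   Formalization: The claim that every weak limit point of minimizers is a minimizer of F is stated under the additional assumption that u_N tends to 0, without which it is false (e.g. D=1, X=[0,1], ρ=δ_0, p=q=2, β=1, α=1, c(x)=2x, u_N=1). *)

(* Defs.v *)
From HB Require Import structures.
From mathcomp Require Import all_boot all_order all_algebra.
From mathcomp Require Import all_classical all_reals all_analysis.
Set Implicit Arguments.
Unset Strict Implicit.
Unset Printing Implicit Defensive.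
Import Order.TTheory GRing.Theory Num.Theory.
Import numFieldNormedType.Exports.

Local Open Scope classical_set_scope.
Local Open Scope ring_scope.

Section euclidean.
Context {R : realType}.

(* The library's norm on ['rV[R]_n] is the sup norm; this is the l2 norm. *)
Definition l2norm n (x : 'rV[R]_n) : R := Num.sqrt (\sum_i x ord0 i ^+ 2).

(* A nonempty subset of R^n as a space of its own, with the subspace topology.
   Measurable types of the library are pointed, hence the nonemptiness proof. *)
Definition subset_space n (A : set 'rV[R]_n) (A0 : A !=set0) : Type :=
  set_type A.

Definition subset_point n (A : set 'rV[R]_n) (A0 : A !=set0) :
  subset_space A0 := exist _ (projT1 (cid A0)) (mem_set (projT2 (cid A0))).

HB.instance Definition _ n (A : set 'rV[R]_n) (A0 : A !=set0) :=
  Topological.copy (subset_space A0) (set_type A).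
HB.instance Definition _ n (A : set 'rV[R]_n) (A0 : A !=set0) :=
  isPointed.Build (subset_space A0) (subset_point A0).

Definition l2dist n (A : set 'rV[R]_n) (A0 : A !=set0)
    (x y : subset_space A0) : R := l2norm (val x - val y).

Section product.
Context (D : nat) (d : 'I_D -> nat) (X : forall j, set 'rV[R]_(d j))
  (X0 : forall j, X j !=set0).

Definition prod_space : Type :=
  prod_topology (fun j => subset_space (X0 j) : topologicalType).

HB.instance Definition _ := Topological.copy prod_space
  (prod_topology (fun j => subset_space (X0 j) : topologicalType)).
HB.instance Definition _ :=
  isPointed.Build prod_space (fun=> point).

Definition prod_coord (j : 'I_D) (x : prod_space) : subset_space (X0 j) := x j.

Definition prod_l2dist (x y : prod_space) : R :=
  Num.sqrt (\sum_(j < D) l2dist (prod_coord j x) (prod_coord j y) ^+ 2).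

End product.
End euclidean.

Definition borel (T : ptopologicalType) := g_sigma_algebraType (@open T).

Definition finite_moment (R : realType) n (A : set 'rV[R]_n) (A0 : A !=set0)
    (p : R) (mu : set (borel (subset_space A0)) -> \bar R) :=
  (\int[mu]_x (l2norm (val (x : subset_space A0)) `^ p)%:E < +oo)%E.

Section empirical.
Context d (T : measurableType d) (R : realType).

(* For [n = 0] this is the zero measure; it is a probability for [n > 0]. *)
Definition empirical n (Y : 'I_n -> T) : set T -> \bar R :=
  fun A => ((n%:R^-1)%:E * \sum_(i < n) \d_(Y i) A)%E.

Section measure.
Context n (Y : 'I_n -> T).

Let empirical0 : empirical Y set0 = 0%E.
Proof. by rewrite /empirical big1 ?mule0// => i _; rewrite measure0. Qed.

Let empirical_ge0 A : (0 <= empirical Y A)%E.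
Proof. by rewrite /empirical mule_ge0 ?lee_fin// sume_ge0. Qed.

Let empirical_sigma_additive : semi_sigma_additive (empirical Y).
Proof.
pose m k : {measure set T -> \bar R} :=
  if insub k is Some i then \d_(Y i) else mzero.
have n0 : 0 <= n%:R^-1 :> R by [].
have -> : empirical Y = mscale (NngNum n0) (msum m n).
  apply/funext => A; rewrite /mscale /msum /empirical/=; congr (_ * _)%E.
  by apply: eq_bigr => i _; rewrite /m valK.
exact: measure_semi_sigma_additive.
Qed.

HB.instance Definition _ := isMeasure.Build _ _ _ (empirical Y)
  empirical0 empirical_ge0 empirical_sigma_additive.

End measure.

Section probability.
Context n (Y : 'I_n.+1 -> T).

Let empirical_setT : empirical Y setT = 1%E.
Proof.
rewrite /empirical; under eq_bigr do rewrite diracT.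
rewrite sumEFin sumr_const card_ord -EFinM.
by rewrite -[1 *+ _]/(n.+1%:R) mulVf.
Qed.

HB.instance Definition _ :=
  Measure_isProbability.Build _ _ _ (empirical Y) empirical_setT.

End probability.
End empirical.

(* weak (narrow) convergence: test functions are bounded and continuous *)
Definition weak_cvg (T : ptopologicalType) (R : realType)
    (mu : nat -> probability (borel T) R) (nu : probability (borel T) R) :=
  forall f : T -> R, continuous f -> (exists M, forall x, `|f x| <= M) ->
  (\int[mu n]_x (f x)%:E @[n --> \oo] --> \int[nu]_x (f x)%:E)%E.

Definition weak_limit_point (T : ptopologicalType) (R : realType)
    (mu : nat -> probability (borel T) R) (nu : probability (borel T) R) :=
  exists2 phi : nat -> nat,
    {homo phi : m n / (m < n)%N} & weak_cvg (mu \o phi) nu.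

Section wasserstein.
Context (T : ptopologicalType) (R : realType) (dist : T -> T -> R) (p : R).
Local Open Scope ereal_scope.

Definition couplings (mu nu : set (borel T) -> \bar R) :
    set (probability (borel T * borel T)%type R) :=
  [set pi | forall A, measurable A ->
    pushforward pi fst A = mu A /\ pushforward pi snd A = nu A].

Definition wasserstein (mu nu : set (borel T) -> \bar R) : \bar R :=
  ereal_inf [set \int[pi]_z ((dist z.1 z.2) `^ p)%:E | pi in couplings mu nu]
    `^ p^-1.

Definition quantization_error (N : nat) (nu : set (borel T) -> \bar R) : \bar R :=
  ereal_inf [set wasserstein nu (empirical R Y) | Y in [set: 'I_N -> borel T]].

End wasserstein.

Section spectral.
Context {R : realType}.
Local Notation mu := (@lebesgue_measure R).

(* Only the values of [alpha] on the open interval ]0, 1[ matter; monotonicity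
   makes [alpha] measurable there. *)
Definition spectral_function (alpha : R -> R) :=
  [/\ forall t, 0 < t < 1 -> 0 <= alpha t,
      forall s t, 0 < s -> s <= t -> t < 1 -> alpha s <= alpha t &
      (\int[mu]_(t in `]0%R, 1%R[) (alpha t)%:E = 1)%E].

Definition in_Lq (q : R) (alpha : R -> R) :=
  (\int[mu]_(t in `]0%R, 1%R[) (`|alpha t| `^ q)%:E < +oo)%E.

Definition quantile (nu : set R -> \bar R) (t : R) : R :=
  inf [set x | (t%:E <= nu `]-oo, x]%classic)%E].

Definition spectral_risk (alpha : R -> R) (nu : set R -> \bar R) : \bar R :=
  (\int[mu]_(t in `]0%R, 1%R[) (quantile nu t * alpha t)%:E)%E.

End spectral.

Definition hoelder_continuous (T : Type) (R : realType) (dist : T -> T -> R) (beta : R)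
    (c : T -> R) :=
  exists C, forall x y, `|c x - c y| <= C * dist x y `^ beta.

Section functionals.
Context {R : realType} {D : nat} {d : 'I_D -> nat}
  {X : forall j, set 'rV[R]_(d j)} {X0 : forall j, X j !=set0}.
Context (p : R) (rho : forall j, probability (borel (subset_space (X0 j))) R)
  (alpha : R -> R) (c : prod_space X0 -> R).
Local Open Scope ereal_scope.

Local Notation PX := (probability (borel (prod_space X0)) R).

Definition marginal (gamma : set (borel (prod_space X0)) -> \bar R) (j : 'I_D) :
    set (borel (subset_space (X0 j))) -> \bar R :=
  pushforward gamma
    (prod_coord j : borel (prod_space X0) -> borel (subset_space (X0 j))).
Arguments marginal gamma j _ : clear implicits.

Definition plans : set PX :=
  [set gamma | forall j A, measurable A -> marginal gamma j A = rho j A].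

Definition uniform_points (N : nat) : set PX :=
  [set gamma | exists Y : 'I_N -> borel (prod_space X0),
    forall A, measurable A -> gamma A = empirical R Y A].

Definition Ffun (gamma : PX) : \bar R :=
  if `[< plans gamma >] then - spectral_risk alpha (pushforward gamma c)
  else +oo.

Definition FNfun (lambda : R) (N : nat) (gamma : PX) : \bar R :=
  if `[< uniform_points N gamma >] then
    - spectral_risk alpha (pushforward gamma c)
    + lambda%:E * \sum_(j < D)
      wasserstein (@l2dist R _ _ (X0 j)) p (rho j) (marginal gamma j) `^ p
  else +oo.

End functionals.
Arguments marginal {R D d X X0} gamma j _.

(* The infimum: it is the minimal value whenever a minimizer exists. *)
Definition minval (T : Type) (R : realType) (F : T -> \bar R) : \bar R :=
  ereal_inf (range F).

Definition minimizer (T : Type) (R : realType) (F : T -> \bar R) (x : T) :=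
  forall y, (F x <= F y)%E.

(* [f = O(g)]; in particular [f] is eventually finite. *)
Definition bigO_seq (R : realType) (f : nat -> \bar R) (g : nat -> R) :=
  exists C : R, \forall n \near \oo, (`|f n| <= (C * `|g n|)%:E)%E.

(* Main.v *)
Require Import Defs.
From HB Require Import structures.
From mathcomp Require Import all_boot all_order all_algebra.
From mathcomp Require Import all_classical all_reals all_analysis.
From mathcomp Require Import measurable_realfun ring lra.
Set Implicit Arguments.
Unset Strict Implicit.
Unset Printing Implicit Defensive.
Import Order.TTheory GRing.Theory Num.Theory.
Import numFieldNormedType.Exports.
Local Open Scope classical_set_scope.
Local Open Scope ring_scope.

(* A bound on the spectral risk of c in terms of the transport cost drives everything.
   For real random variables X, Y with quantile functions F, G and a >= 0, the set
   {t | G t + a <= s < F t} has length at most P (Y + a <= s < X); integrating over s,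
   the excess of F - G over a has integral at most E (X - Y - a)_+. Since x^r is
   comparable, for r > 1, to a nonnegative combination of the functions (x - 2^k)_+
   plus a constant, this controls the r-th moment of F - G, and Young's inequality
   turns it into |R(X) - R(Y)| <= K k as soon as E (|X - Y| / k)^r <= 2, where 1/r + 1/q = 1.
   With X = c(x), Y = c(y) under a coupling of cost at most s^p, k is a multiple of s^beta
   because beta r <= p.
   Upper bound: a nearly optimal N-point quantizer of gamma^* costs O(u_N^beta).
   Lower bound: couplings of the rho_j with the marginals of an empirical measure glue to a
   coupling of some plan in Gamma with that measure, so the empirical measure can gain at
   most a multiple of V^(beta/p), V being the sum of the marginal costs; as beta/p < 1 this
   is absorbed by half of the penalty lambda_N V, up to O(u_N^beta). The remaining half
   bounds the penalty of minimizers.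
   Limit points: the glued plans have fixed marginals, hence uniformly small tails of
   c, which reduces the upper semicontinuity of the risk to bounded integrands. *)

(** * Quantile functions *)

(** With r = q / (q - 1), the hypothesis beta / p + 1 / q <= 1 says exactly beta r <= p; as 1 / q >
    0, it also gives the strict beta / p < 1 on which the absorption rests. The moment bound on F -
    G would classically follow from optimality of the monotone coupling on the line for the cost |x
    - y|^r. The functions (x - a)_+ replace that theorem: for them, comparing the two sides is a
    comparison of measures of level sets. The penalty weight is dictated by scaling: for V = s^p v,
    both V^(beta/p) and s^(beta - p) V are s^beta times a function of v alone. Infima over couplings
    and over configurations of points need not be attained, which explains slack such as 2 s in
    place of s, or an added s^p; constants absorb it. For limit points, weak convergence tests
    bounded functions only, while uniform tails are available for plans. Hence the detour: from the
    empirical measure to its glued plan, truncation of c there, then back to the empirical measure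
    and to the limit. *)

Lemma nondecreasing_in_measurable (R : realType) (D : interval R) (f : R -> R) :
  {in D &, nondecreasing f} -> measurable_fun [set` D] f.
Proof.
move=> ndf; apply: (measurability (@RGenCInfty.G R)) => [|/= _ [_] [r] -> <-].
  exact: RGenCInfty.measurableE.
apply: is_interval_measurable => s t /= [Ds fs] [Dt ft] u /andP[su ut].
have Du : u \in D.
  by apply: (@interval_is_interval _ D s t) => //; rewrite su ut.
split => //; move: fs ft; rewrite /= !in_itv/= !andbT => fs ft.
by rewrite (le_trans fs)// ndf.
Qed.

Section quantile.
Context d (T : measurableType d) (R : realType) (P : probability T R).
Variables (X : T -> R) (mX : measurable_fun setT X).

Let rvX : {RV P >-> R} := mfun_Sub (mem_set mX).

Let cdfE x : cdf rvX x = P (X @^-1` `]-oo, x]). Proof. by []. Qed.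

(** Galois connection between quantile and distribution function, from which the later facts on
    quantiles derive. The infimum is attained by right continuity of the cdf; t < 1 makes the set
    nonempty and 0 < t bounds it below, so that [inf] is a genuine infimum. *)
Lemma quantile_le t x : 0 < t < 1 ->
  (quantile (pushforward P X) t <= x) = (t%:E <= P (X @^-1` `]-oo, x]))%E.
Proof.
move=> /andP[t0 t1]; rewrite -cdfE /quantile.
set S := [set y | _].
have SE y : S y <-> (t%:E <= cdf rvX y)%E by [].
have cdf_fin y : cdf rvX y = (fine (cdf rvX y))%:E.
  by rewrite fineK// fin_num_measure.
have S0 : S !=set0.
  have /fine_cvgP[_ cf] := @cvg_cdfy1 _ _ _ P rvX.
  have [M tM] := filter_ex (cvgr_ge _ cf _ t1).
  by exists M; apply/SE; rewrite cdf_fin lee_fin.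
have Sup y z : S y -> y <= z -> S z.
  by move=> /SE Sy yz; apply/SE/(le_trans Sy); exact: cdf_nondecreasing.
have lbS : has_lbound S.
  have /fine_cvgP[_ cf] := @cvg_cdfNy0 _ _ _ P rvX.
  have [M tM] := filter_ex (cvgr_lt _ cf _ t0).
  exists M => y Sy; rewrite leNgt; apply/negP => /ltW /(Sup _ _ Sy)/SE.
  by rewrite cdf_fin lee_fin leNgt tM.
have Sinf : S (inf S).
  apply/SE.
  apply: (cvge_ge _ (@cdf_right_continuous _ _ _ P rvX (inf S))).
  near=> z.
  have [y Sy yz] : exists2 y, S y & y < z.
    by apply: inf_lt => //; near: z; exact: nbhs_right_gt.
  by apply/SE/(Sup _ _ Sy)/ltW.
apply/idP/idP; last by move=> /SE; exact: ge_inf.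
by move=> /(Sup _ _ Sinf)/SE.
Unshelve. all: by end_near. Qed.

Lemma quantile_gt t x : 0 < t < 1 ->
  (x < quantile (pushforward P X) t) = (P (X @^-1` `]-oo, x]) < t%:E)%E.
Proof. by move=> t01; rewrite ltNge quantile_le// -ltNge. Qed.

Lemma quantile_nd :
  {in `]0, 1[ &, nondecreasing (quantile (pushforward P X))}.
Proof.
move=> s t s01 t01 st.
rewrite quantile_le//; rewrite (@le_trans _ _ t%:E) ?lee_fin//.
by rewrite -quantile_le.
Qed.

Lemma measurable_quantile :
  measurable_fun (`]0%R, 1%R[%classic : set R) (quantile (pushforward P X)).
Proof. apply: nondecreasing_in_measurable; exact: quantile_nd. Qed.

End quantile.

(** Comparing with the constant 0 turns bounds on differences of quantiles into bounds on a single
    quantile. *)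
Lemma quantile_cst d (T : measurableType d) (R : realType)
    (P : probability T R) (a t : R) : 0 < t < 1 ->
  quantile (pushforward P (fun=> a)) t = a.
Proof.
move=> t01; have /andP[t0 t1] := t01; apply/eqP; rewrite eq_le; apply/andP; split.
  rewrite quantile_le// (_ : _ @^-1` _ = setT) ?probability_setT ?lee_fin ?ltW//.
  by apply/seteqP; split => // x _ /=; rewrite in_itv/=.
rewrite leNgt; apply/negP => qa.
have [/ltW + za] := midf_lt qa.
rewrite quantile_le// (_ : _ @^-1` _ = set0) ?measure0.
  by rewrite lee_fin leNgt t0.
apply/seteqP; split => // x /=; rewrite in_itv/= => ax.
by have := lt_le_trans za ax; rewrite ltxx.
Qed.

Section excess.
Context (R : realType).
Notation leb := (@lebesgue_measure R).

Let between d (T : measurableType d) (f g : T -> R) : set (T * R) :=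
  [set z | g z.1 <= z.2 < f z.1].

Let measurable_between d (T : measurableType d) (f g : T -> R) :
  measurable_fun setT f -> measurable_fun setT g -> measurable (between f g).
Proof.
move=> mf mg.
have mf1 : measurable_fun setT (fun z : T * R => f z.1).
  exact: measurableT_comp mf measurable_fst.
have mg1 : measurable_fun setT (fun z : T * R => g z.1).
  exact: measurableT_comp mg measurable_fst.
rewrite -[between f g]setTI.
have -> : [set: T * R] `&` between f g =
    [set: T * R] `&` (fun z => (g z.1 <= z.2) && (z.2 < f z.1)) @^-1` [set true].
  by apply/seteqP; split.
apply: (@measurable_and _ _ _ (fun z => g z.1 <= z.2) (fun z => z.2 < f z.1)) => //.
- by apply: measurable_fun_ler => //; exact: measurable_snd.
- by apply: measurable_fun_ltr => //; exact: measurable_snd.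
Qed.

(** Layer cake: the positive part of f w - g w is the length of [g w, f w[, and Tonelli exchanges w
    with the level s. *)
Let excess_tonelli d (T : measurableType d)
    (m : {sigma_finite_measure set T -> \bar R}) (f g : T -> R) :
  measurable_fun setT f -> measurable_fun setT g ->
  (\int[m]_w (Num.max (f w - g w) 0)%:E =
   \int[leb]_s m (ysection (between f g) s))%E.
Proof.
move=> mf mg; have mB := measurable_between mf mg.
transitivity (\int[m]_w leb (xsection (between f g) w))%E.
  apply: eq_integral => w _.
  have -> : xsection (between f g) w = `[g w, f w[%classic.
    by apply/seteqP; split => s /=; rewrite in_itv /xsection/= inE.
  rewrite lebesgue_measure_itv/= lte_fin.
  case: ltP => gf; first by rewrite -EFinB max_l// subr_ge0 ltW.
  by rewrite max_r// subr_le0.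
have mI : measurable_fun setT (EFin \o \1_(between f g) : T * R -> \bar R).
  exact/measurable_EFinP/measurable_indic.
have I0 z : (0 <= (EFin \o \1_(between f g) : T * R -> \bar R) z)%E.
  by rewrite lee_fin.
have := @fubini_tonelli _ _ _ _ _ m leb _ mI I0.
set L := (X in X = _ -> _); set L' := (X in _ = X -> _).
have -> : L = (\int[m]_w leb (xsection (between f g) w))%E.
  apply: eq_integral => w _.
  rewrite -[X in leb X]setIT -integral_indic//; last exact: measurable_xsection.
  apply: eq_integral => s _ /=; congr EFin; rewrite !indicE.
  by congr ((nat_of_bool _)%:R); apply/idP/idP; rewrite /xsection !inE/= ?inE.
have -> : L' = (\int[leb]_s m (ysection (between f g) s))%E.
  apply: eq_integral => s _.
  rewrite -[X in m X]setIT -integral_indic//; last exact: measurable_ysection.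
  apply: eq_integral => w _ /=; congr EFin; rewrite !indicE.
  by congr ((nat_of_bool _)%:R); apply/idP/idP; rewrite /ysection !inE/= ?inE.
by [].
Qed.

(** The two pairs may live on different spaces, since only measures of level sets are compared; this
    allows Lebesgue measure on ]0, 1[ on one side and P on the other. *)
Lemma le_excess d1 d2 (T1 : measurableType d1) (T2 : measurableType d2)
    (m1 : {sigma_finite_measure set T1 -> \bar R})
    (m2 : {sigma_finite_measure set T2 -> \bar R})
    (f1 g1 : T1 -> R) (f2 g2 : T2 -> R) :
  measurable_fun setT f1 -> measurable_fun setT g1 ->
  measurable_fun setT f2 -> measurable_fun setT g2 ->
  (forall s, m1 [set w | (g1 w <= s < f1 w)%R] <= m2 [set w | (g2 w <= s < f2 w)%R])%E ->
  (\int[m1]_w (Num.max (f1 w - g1 w) 0)%:E <=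
   \int[m2]_w (Num.max (f2 w - g2 w) 0)%:E)%E.
Proof.
move=> mf1 mg1 mf2 mg2 le12; rewrite !excess_tonelli//.
apply: ge0_le_integral => //.
- by apply: measurable_fun_ysection; exact: measurable_between.
- by apply: measurable_fun_ysection; exact: measurable_between.
move=> s _; have := le12 s.
suff E d (T : measurableType d) (f g : T -> R) :
    ysection (between f g) s = [set w | g w <= s < f w] by rewrite !E.
by apply/seteqP; split => w; rewrite /ysection/= inE.
Qed.

Lemma quantile_excess d (T : measurableType d) (P : probability T R)
    (X Y : T -> R) (a : R) :
  measurable_fun setT X -> measurable_fun setT Y -> 0 <= a ->
  (\int[leb]_(t in `]0%R, 1%R[)
     (Num.max (quantile (pushforward P X) t - quantile (pushforward P Y) t - a) 0)%:E
   <= \int[P]_w (Num.max (X w - Y w - a) 0)%:E)%E.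
Proof.
move=> mX mY a0; set D := [set` `]0, 1[].
set qX := quantile (pushforward P X); set qY := quantile (pushforward P Y).
have mD : measurable D by exact: measurable_itv.
have mq Z : measurable_fun setT Z ->
    measurable_fun setT (quantile (pushforward P Z) \_ D).
  by move=> mZ; apply: (iffLR (measurable_restrictT _ mD)); exact: measurable_quantile.
rewrite integral_mkcond.
(* Both quantiles are extended by 0 outside ]0, 1[; the excess there is max(0 - a, 0), which
   vanishes as a >= 0. *)
rewrite [leLHS](_ : _ =
    \int[leb]_t (Num.max ((qX \_ D) t - ((qY \_ D) t + a)) 0)%:E)%E; last first.
  apply: eq_integral => t _; rewrite /patch; case: ifPn => _.
    by rewrite opprD addrA.
  change (0%E = (Num.max (0 - (0 + a)) 0)%:E :> \bar R).
  by rewrite !add0r max_r// oppr_le0.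
rewrite [leRHS](_ : _ = \int[P]_w (Num.max (X w - (Y w + a)) 0)%:E)%E; last first.
  by apply: eq_integral => w _; rewrite opprD addrA.
apply: le_excess => //.
- exact: mq.
- by apply: measurable_funD => //; exact: mq.
- exact: measurable_funD.
move=> s; set u := P (X @^-1` `]-oo, s]); set v := P (Y @^-1` `]-oo, s - a]).
have mXs : measurable (X @^-1` `]-oo, s]) by rewrite -[X in measurable X]setTI; exact: mX.
have mYs : measurable (Y @^-1` `]-oo, s - a]) by rewrite -[X in measurable X]setTI; exact: mY.
set E := [set w | _]; set E' := [set w | _].
have mE' : measurable E'.
  have -> : E' = Y @^-1` `]-oo, s - a] `\` X @^-1` `]-oo, s].
    apply/seteqP; split => w /=; rewrite !in_itv/= lerBrDr.
      by move=> /andP[Yw]; rewrite ltNge => /negP.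
    by move=> [Yw /negP]; rewrite -ltNge => Xw; apply/andP.
  exact: measurableD.
have ufin : u = (fine u)%:E by rewrite fineK// fin_num_measure.
have vfin : v = (fine v)%:E by rewrite fineK// fin_num_measure.
(* By the Galois connection, s < qX t means u < t, and qY t <= s - a means t <= v. *)
have Esub : E `<=` `]fine u, fine v]%classic.
  move=> t; rewrite /E /= /patch; case: ifPn => [|_ /andP[]]; last first.
    change (0 + a <= s -> s < 0 -> (`]fine u, fine v]%classic : set R) t).
    by rewrite add0r => /le_lt_trans/[apply] /(le_lt_trans a0); rewrite ltxx.
  rewrite inE /D/= in_itv/= => t01 /andP[].
  rewrite -lerBrDr quantile_le// quantile_gt//.
  by rewrite in_itv/= -/u -/v ufin vfin lte_fin lee_fin => -> ->.
have mE : measurable E.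
  have -> : E = D `&` `]fine u, fine v]%classic.
    apply/seteqP; split => [t Et|t [Dt]].
      split; last exact: Esub.
      move: Et; rewrite /E/= /patch; case: ifPn => [|_ /andP[]]; first by rewrite inE.
      change (0 + a <= s -> s < 0 -> D t).
      by rewrite add0r => /le_lt_trans/[apply] /(le_lt_trans a0); rewrite ltxx.
    rewrite /E /= /patch mem_set// -lerBrDr quantile_le// quantile_gt//.
    by rewrite in_itv/= -/u -/v ufin vfin lte_fin lee_fin andbC.
  by apply: measurableI => //; exact: measurable_itv.
rewrite (@le_trans _ _ (leb `]fine u, fine v]%classic))//.
  by apply: le_measure => //; rewrite ?inE//; exact: measurable_itv.
rewrite lebesgue_measure_itv/= lte_fin; case: ltP => // uv.
(* Where Y <= s - a, either X <= s, an event of probability u, or s < X, which is E'. *)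
rewrite -EFinB; suff : (v <= P E' + u)%E.
  by rewrite ufin vfin EFinB leeBlDr.
have : Y @^-1` `]-oo, s - a] `<=` E' `|` X @^-1` `]-oo, s].
  move=> w /=; rewrite /E'/= !in_itv/= lerBrDr => ->; rewrite andTb.
  by case: (ltP s (X w)) => h; [left|right].
move=> sub; rewrite (@le_trans _ _ (P (E' `|` X @^-1` `]-oo, s])))//.
  by apply: le_measure => //; rewrite inE//; exact: measurableU.
exact: measureU2.
Qed.

End excess.

(** * Moments of differences of quantiles *)

Section dyadic.
Context (R : realType) (r : R) (r_gt1 : 1 < r).

(** Up to a constant, x^r is the integral over a > 0 of a^(r-2) (x - a)_+. On the dyadic interval at
    2^k, of length 2^k, the weight is of order (2^k)^(r-1) = theta^k. *)
Let theta : R := 2 `^ (r - 1).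

Let theta_gt1 : 1 < theta.
Proof.
rewrite /theta -[X in X < _](powRr0 2); rewrite /powR pnatr_eq0/= ltr_expR.
by rewrite ltr_pM2r ?subr_gt0// ln_gt0// ltr1n.
Qed.

Let thetaX k : theta ^+ k = (2 ^+ k) `^ (r - 1).
Proof.
by rewrite -powR_mulrn ?powR_ge0// -powRrM mulrC powRrM powR_mulrn.
Qed.

Let r_gt0 : 0 < r. Proof. exact: lt_trans r_gt1. Qed.
Let r1_ge0 : 0 <= r - 1. Proof. by rewrite subr_ge0 ltW. Qed.

(* Up to constants, x^r lies below [1 + dyadic_excess x] and above [dyadic_excess x]. *)
Definition dyadic_excess (x : R) : \bar R :=
  (\sum_(k <oo) (theta ^+ k * Num.max (x - 2 ^+ k) 0)%:E)%E.

Let term_ge0 (x : R) k : 0 <= theta ^+ k * Num.max (x - 2 ^+ k) 0.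
Proof.
by rewrite mulr_ge0 ?exprn_ge0 ?powR_ge0// le_max lexx orbT.
Qed.

Lemma dyadic_excess_ge0 x : (0 <= dyadic_excess x)%E.
Proof. by apply: nneseries_ge0 => k _ _; rewrite lee_fin. Qed.

(** One term suffices when x > 2: for 2^(m+1) < x <= 2^(m+2), both 2^m and x - 2^m are at least x /
    4, which is the origin of the factor 4^r. The summand 1 takes care of x <= 2. *)
Lemma powR_le_dyadic_excess (x : R) :
  ((Num.max x 0 `^ r)%:E <= (4 `^ r)%:E * (1 + dyadic_excess x))%E.
Proof.
have pos4 : 0 < 4 `^ r :> R by rewrite powR_gt0.
have [x2|x2] := leP x 2.
  rewrite (@le_trans _ _ ((4 `^ r)%:E * 1)%E)//.
    rewrite mule1 lee_fin ge0_ler_powR ?nnegrE ?le_max ?lexx ?orbT ?(ltW r_gt0)//.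
    by rewrite ge_max; apply/andP; split => //; rewrite (le_trans x2)// ler_nat.
  by rewrite lee_pmul2l ?lte_fin// leeDl// dyadic_excess_ge0.
have x0 : 0 < x by rewrite (lt_trans _ x2).
rewrite max_l ?(ltW x0)//.
have [m /andP[mx xm]] : exists m, 2 ^+ m.+1 < x <= 2 ^+ m.+2.
  have ex : exists n, x <= 2 ^+ n.
    exists (Num.truncn x).+1; rewrite (le_trans (ltW (truncnS_gt x)))//.
    by rewrite -natrX ler_nat ltnW// ltn_expl.
  have := ex_minnP ex; case=> -[|[|n]] xn nmin.
  - by move: xn; rewrite expr0 leNgt (lt_trans _ x2)// ltr1n.
  - by move: xn; rewrite expr1 leNgt x2.
  exists n; rewrite xn andbT ltNge; apply/negP => /nmin.
  by rewrite ltnn.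
rewrite (@le_trans _ _ ((4 `^ r)%:E * (theta ^+ m * Num.max (x - 2 ^+ m) 0)%:E)%E)//.
  have x4 : x / 4 <= 2 ^+ m.
    by rewrite ler_pdivrMr//; move: xm; rewrite !exprS; lra.
  have xx : x / 4 <= Num.max (x - 2 ^+ m) 0.
    rewrite le_max; apply/orP; left; move: mx; rewrite exprS.
    have : 0 < 2 ^+ m :> R by rewrite exprn_gt0.
    lra.
  have -> : x `^ r = 4 `^ r * (x / 4) `^ r.
    by rewrite -powRM ?divr_ge0 ?(ltW x0)// mulrC divfK.
  rewrite -EFinM lee_fin ler_pM2l//.
  rewrite -(@mulr_powRB1 _ (x / 4) r) ?divr_ge0 ?(ltW x0)// mulrC.
  rewrite ler_pM ?powR_ge0 ?divr_ge0 ?(ltW x0)//.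
  by rewrite thetaX ge0_ler_powR ?nnegrE ?divr_ge0 ?(ltW x0)// exprn_ge0.
rewrite lee_pmul2l ?lte_fin//.
rewrite (@le_trans _ _ (dyadic_excess x))//; last by rewrite leeDr.
have := @nneseries_lim_ge R (fun k => (theta ^+ k * Num.max (x - 2 ^+ k) 0)%:E)
  xpredT 0 m.+1 (fun k _ _ => term_ge0 x k).
apply: le_trans; rewrite big_nat_recr//= leeDr//.
by apply: sume_ge0 => k _; rewrite lee_fin.
Qed.

(** Terms with 2^k >= x vanish and the others are at most theta^k x. Their geometric sum is governed
    by its last term, where theta^n = (2^n)^(r-1) <= x^(r-1); it is here that r > 1 enters, through
    theta > 1. *)
Lemma dyadic_excess_le (x : R) :
  (dyadic_excess x <= (theta / (theta - 1) * Num.max x 0 `^ r)%:E)%E.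
Proof.
have th1 : 0 < theta - 1 by rewrite subr_gt0.
have th0 : 0 < theta by rewrite (lt_trans _ theta_gt1).
apply: lime_le; first by apply: is_cvg_nneseries => k _ _; rewrite lee_fin.
apply: nearW => n; rewrite sumEFin lee_fin.
have [x0|x0] := leP x 0.
  rewrite powR0 ?gt_eqF// mulr0 big1// => k _.
  rewrite max_r ?mulr0// subr_le0 (le_trans x0)// exprn_ge0//.
rewrite -mulr_powRB1 ?(ltW x0)// mulrCA.
pose b k : R := if 2 ^+ k < x then theta ^+ k else 0.
rewrite (@le_trans _ _ (\sum_(0 <= k < n) x * b k))//.
  apply: ler_sum => k _; rewrite /b; case: ltP => kx.
    rewrite mulrC ler_pM2r ?exprn_gt0// max_l ?subr_ge0 ?(ltW kx)//.
    by rewrite lerBlDr lerDl exprn_ge0.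
  by rewrite mulr0 max_r ?mulr0// subr_le0.
rewrite -big_distrr/= ler_pM2l//.
have base : 0 <= theta / (theta - 1) * x `^ (r - 1).
  by rewrite mulr_ge0 ?divr_ge0 ?powR_ge0// ltW.
elim: n => [|n IH]; first by rewrite big_nil.
rewrite big_nat_recr//= /b; case: ltP => nx; last by rewrite addr0.
rewrite (@le_trans _ _ (\sum_(0 <= k < n.+1) theta ^+ k))//.
  rewrite big_nat_recr//= lerD2r ler_sum// => k _; rewrite /b; case: ltP => // _.
  by rewrite exprn_ge0// ltW.
have -> : \sum_(0 <= k < n.+1) theta ^+ k = (theta ^+ n.+1 - 1) / (theta - 1).
  rewrite subrX1 big_mkord mulrC mulKf//; exact: lt0r_neq0.
rewrite mulrAC ler_pM2r ?invr_gt0//.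
rewrite (@le_trans _ _ (theta ^+ n.+1)) ?lerBlDr ?lerDl// exprS ler_pM2l//.
by rewrite thetaX ge0_ler_powR ?nnegrE ?exprn_ge0// ltW.
Qed.

End dyadic.

Section moment.
Context (R : realType) (r : R) (r_gt1 : 1 < r).
Notation leb := (@lebesgue_measure R).

Let th : R := 2 `^ (r - 1).

(** The power is replaced by its dyadic sum on the left and recovered from it on the right; in
    between, [quantile_excess] is applied term by term. The constants depend on r alone. *)
Lemma quantile_moment d (T : measurableType d) (P : probability T R)
    (X Y : T -> R) (k : R) :
  measurable_fun setT X -> measurable_fun setT Y -> 0 < k ->
  (\int[leb]_(t in `]0%R, 1%R[)
     (Num.max ((quantile (pushforward P X) t - quantile (pushforward P Y) t) / k) 0
        `^ r)%:E
   <= (4 `^ r)%:E * (1 + (th / (th - 1))%:E *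
      \int[P]_w (Num.max ((X w - Y w) / k) 0 `^ r)%:E))%E.
Proof.
move=> mX mY k0; set D := [set` `]0, 1[].
set Q := fun t => (quantile (pushforward P X) t - quantile (pushforward P Y) t) / k.
set W := fun w => (X w - Y w) / k.
have mD : measurable D by exact: measurable_itv.
have mQ : measurable_fun D Q.
  by apply: measurable_funM => //; apply: measurable_funB;
    exact: measurable_quantile.
have mW : measurable_fun setT W.
  by apply: measurable_funM => //; exact: measurable_funB.
have mex d' (T' : measurableType d') (E : set T') (f : T' -> R) (a : R) :
    measurable_fun E f -> measurable_fun E (fun x => Num.max (f x - a) 0).
  move=> mf; apply: measurable_maxr => //.
  by apply: measurable_funB.
have mterm d' (T' : measurableType d') (E : set T') (f : T' -> R) n :
    measurable_fun E f ->
    measurable_fun E (fun x => (th ^+ n * Num.max (f x - 2 ^+ n) 0)%:E).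
  by move=> mf; apply/measurable_EFinP/measurable_funM => //; exact: mex.
have term0 (x : R) n : (0 <= (th ^+ n * Num.max (x - 2 ^+ n) 0)%:E)%E.
  by rewrite lee_fin mulr_ge0 ?exprn_ge0 ?powR_ge0// le_max lexx orbT.
have mS d' (T' : measurableType d') (E : set T') (f : T' -> R) :
    measurable_fun E f -> measurable_fun E (fun x => dyadic_excess r (f x)).
  move=> mf; apply: (ge0_emeasurable_sum (P := xpredT)) => // n _.
  exact: mterm.
have mP d' (T' : measurableType d') (E : set T') (f : T' -> R) :
    measurable_fun E f -> measurable_fun E (fun x => (Num.max (f x) 0 `^ r)%:E).
  move=> mf; apply/measurable_EFinP.
  apply: (measurableT_comp (measurable_powR r)).
  exact: measurable_maxr.
have leb01 : leb D = 1%E by rewrite /D lebesgue_measure_itv/= lte_fin ltr01 -EFinB subr0.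
rewrite (@le_trans _ _ (\int[leb]_(t in D) ((4 `^ r)%:E * (1 + dyadic_excess r (Q t))))%E)//.
  apply: ge0_le_integral => //.
  - by move=> t _; rewrite lee_fin powR_ge0.
  - exact: mP.
  - by apply/measurable_funeM/emeasurable_funD => //; exact: mS.
  - by move=> t _; exact: powR_le_dyadic_excess.
rewrite ge0_integralZl//; first last.
- by move=> t _; rewrite adde_ge0// dyadic_excess_ge0.
- by apply: emeasurable_funD => //; exact: mS.
rewrite lee_pmul2l ?lte_fin ?powR_gt0//.
rewrite ge0_integralD//; first last.
- exact: mS.
- by move=> t _; exact: dyadic_excess_ge0.
have -> : (\int[leb]_(t in D) 1 = 1)%E.
  by rewrite (integral_cst leb mD 1) mul1e; exact: leb01.
rewrite leeD2l//.
have -> : (\int[leb]_(t in D) dyadic_excess r (Q t) = \sum_(n <oo)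
    (\int[leb]_(t in D) (th ^+ n * Num.max (Q t - 2 ^+ n) 0)%:E))%E.
  by rewrite -integral_nneseries// => n; exact: mterm.
apply: (@le_trans _ _ (\sum_(n <oo)
    (\int[P]_w (th ^+ n * Num.max (W w - 2 ^+ n) 0)%:E))%E).
  apply: lee_nneseries => [n _ _|n _]; first exact: integral_ge0.
  (* Homogeneity: dividing by k turns the threshold 2^n for f / k into the threshold k 2^n for f. *)
  have E d' (T' : measurableType d') (m : {measure set T' -> \bar R})
      (E : set T') (f : T' -> R) : measurable E -> measurable_fun E f ->
      (\int[m]_(x in E) (th ^+ n * Num.max (f x / k - 2 ^+ n) 0)%:E =
      (th ^+ n / k)%:E * \int[m]_(x in E) (Num.max (f x - k * 2 ^+ n) 0)%:E)%E.
    move=> mE mf; rewrite -ge0_integralZl//; first last.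
    - by rewrite lee_fin divr_ge0 ?exprn_ge0 ?powR_ge0// ltW.
    - by move=> x _; rewrite lee_fin le_max lexx orbT.
    - by apply/measurable_EFinP; exact: mex.
    apply: eq_integral => x _; rewrite -EFinM -mulrA; congr (_ * _)%:E.
    rewrite maxr_pMr ?invr_ge0 ?(ltW k0)// mulr0 mulrBr; congr (Num.max (_ - _) _).
      by rewrite mulrC.
    by rewrite mulKf// gt_eqF.
  rewrite E//; last by apply: measurable_funB; exact: measurable_quantile.
  rewrite E//; last exact: measurable_funB.
  rewrite lee_pmul2l ?lte_fin ?divr_gt0 ?exprn_gt0 ?powR_gt0//.
  by apply: quantile_excess => //; rewrite mulr_ge0 ?exprn_ge0 ?(ltW k0).
rewrite -integral_nneseries//; last by move=> n; exact: mterm.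
have c0 : 0 <= th / (th - 1).
  rewrite divr_ge0 ?powR_ge0// subr_ge0 /th -[leLHS](powRr0 2).
  by rewrite ler_powR ?ler1n// subr_ge0 ltW.
rewrite -ge0_integralZl//; first last.
- by move=> w _; rewrite lee_fin powR_ge0.
- exact: mP.
apply: ge0_le_integral => //.
- by move=> w _; exact: dyadic_excess_ge0.
- exact: mS.
- by apply: measurable_funeM; exact: mP.
- by move=> w _; exact: dyadic_excess_le.
Qed.

End moment.

(** * Stability of the spectral risk under small r-th moments *)

Section risk_bound.
Context (R : realType) (r q : R) (r_gt1 : 1 < r) (q_gt1 : 1 < q)
  (rq : r^-1 + q^-1 = 1) (alpha : R -> R)
  (alpha_spectral : spectral_function alpha) (alpha_Lq : in_Lq q alpha).
Notation leb := (@lebesgue_measure R).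
Let D : set R := `]0%R, 1%R[%classic.

Lemma measurable_spectral : measurable_fun D alpha.
Proof.
case: alpha_spectral => _ nd _; apply: nondecreasing_in_measurable => s t.
by rewrite !in_itv/= => /andP[s0 _] /andP[_ t1] st; exact: nd.
Qed.

Let alpha_ge0 t : D t -> 0 <= alpha t.
Proof. by case: alpha_spectral => + _ _ => /(_ t); rewrite /D/= in_itv/=. Qed.

Let r_gt0 : 0 < r. Proof. exact: lt_trans r_gt1. Qed.
Let q_gt0 : 0 < q. Proof. exact: lt_trans q_gt1. Qed.

Let mD : measurable D. Proof. exact: measurable_itv. Qed.

Let young (z w : R) : 0 <= z -> 0 <= w -> z * w <= z `^ r + w `^ q.
Proof.
move=> z0 w0; rewrite (le_trans (conjugate_powR z0 w0 r_gt0 q_gt0 rq))//.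
by rewrite lerD// ler_pdivrMr// ler_peMr ?powR_ge0// ltW.
Qed.

(** Young's inequality is applied to the difference divided by k; multiplying back by k gives a
    bound linear in k. K is quantified before the probability space because one constant must serve
    all couplings. Its first summand is [quantile_moment] with moment at most 2, its second the q-th
    moment of alpha. *)
Let positive_part_bound :
  exists2 K : R, 0 <= K & forall d (T : measurableType d) (P : probability T R)
    (X Y : T -> R) (k : R),
  measurable_fun setT X -> measurable_fun setT Y -> 0 < k ->
  (\int[P]_w ((`|X w - Y w| / k) `^ r)%:E <= 2%:E)%E ->
  (\int[leb]_(t in D) (Num.max
     (quantile (pushforward P X) t - quantile (pushforward P Y) t) 0 * alpha t)%:E
   <= (k * K)%:E)%E.
Proof.
set c : R := 2 `^ (r - 1) / (2 `^ (r - 1) - 1).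
have c0 : 0 <= c.
  rewrite divr_ge0 ?powR_ge0// subr_ge0 -[leLHS](powRr0 2).
  by rewrite ler_powR ?ler1n// subr_ge0 ltW.
set A := (\int[leb]_(t in D) (`|alpha t| `^ q)%:E)%E.
have A0 : (0 <= A)%E by apply: integral_ge0 => t _; rewrite lee_fin powR_ge0.
have Afin : A = (fine A)%:E by rewrite fineK// ge0_fin_numE//; exact: alpha_Lq.
exists (4 `^ r * (1 + c * 2) + fine A).
  by rewrite addr_ge0 ?fine_ge0// mulr_ge0 ?powR_ge0// addr_ge0// mulr_ge0.
move=> d T P X Y k mX mY k0 XY.
set Q := fun t => quantile (pushforward P X) t - quantile (pushforward P Y) t.
have mQ : measurable_fun D Q by apply: measurable_funB; exact: measurable_quantile.
have mQk : measurable_fun D (fun t => Q t / k) by exact: measurable_funM.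
have mQp : measurable_fun D (fun t => (Num.max (Q t / k) 0 `^ r)%:E).
  apply/measurable_EFinP; apply: (measurableT_comp (measurable_powR r)).
  exact: measurable_maxr.
have maq : measurable_fun D (fun t => (`|alpha t| `^ q)%:E).
  apply/measurable_EFinP; apply: (measurableT_comp (measurable_powR q)).
  exact: measurableT_comp measurable_spectral.
have mprod : measurable_fun D (fun t => (Num.max (Q t / k) 0 * alpha t)%:E).
  apply/measurable_EFinP/measurable_funM; last exact: measurable_spectral.
  exact: measurable_maxr.
rewrite (_ : (fun t => _) =
    fun t => (k%:E * (Num.max (Q t / k) 0 * alpha t)%:E)%E); last first.
  apply/funext => t; rewrite -EFinM mulrA; congr (_ * _)%:E.
  by rewrite maxr_pMr ?(ltW k0)// mulr0 mulrCA mulfV ?mulr1// gt_eqF.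
rewrite ge0_integralZl//; first last.
- by rewrite lee_fin ltW.
- move=> t Dt; rewrite lee_fin mulr_ge0 ?alpha_ge0//.
  by rewrite le_max lexx orbT.
rewrite EFinM lee_pmul2l// ?lte_fin//.
apply: (@le_trans _ _ (\int[leb]_(t in D)
    ((Num.max (Q t / k) 0 `^ r)%:E + (`|alpha t| `^ q)%:E))%E).
  apply: ge0_le_integral => //.
  - move=> t Dt; rewrite lee_fin mulr_ge0 ?alpha_ge0//.
    by rewrite le_max lexx orbT.
  - exact: emeasurable_funD.
  - move=> t Dt; rewrite -EFinD lee_fin.
    rewrite (ger0_norm (alpha_ge0 Dt)) young ?alpha_ge0//.
    by rewrite le_max lexx orbT.
rewrite ge0_integralD//; [|by move=> t _; rewrite lee_fin powR_ge0..].
rewrite EFinD -/A -Afin leeD2r//.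
apply: (le_trans (quantile_moment r_gt1 P mX mY k0)).
rewrite -/c [leRHS]EFinM lee_pmul2l ?lte_fin ?powR_gt0// EFinD leeD2l//.
rewrite (EFinM c 2); apply: lee_wpmul2l; first by rewrite lee_fin.
apply: le_trans XY; apply: ge0_le_integral => //.
- by move=> w _; rewrite lee_fin powR_ge0.
- apply/measurable_EFinP; apply: (measurableT_comp (measurable_powR r)).
  by apply: measurable_maxr => //; apply: measurable_funM => //; exact: measurable_funB.
- apply/measurable_EFinP; apply: (measurableT_comp (measurable_powR r)).
  apply: measurable_funM => //; apply: measurableT_comp => //.
  exact: measurable_funB.
- move=> w _; rewrite lee_fin ge0_ler_powR ?nnegrE ?(ltW r_gt0)//.
  + by rewrite le_max lexx orbT.
  + by rewrite divr_ge0// ltW.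
  + rewrite ge_max divr_ge0 ?(ltW k0)// andbT.
    by rewrite ler_pM2r ?invr_gt0// ler_norm.
Qed.

Lemma quantile_spectral_bound :
  exists2 K : R, 0 < K & forall d (T : measurableType d) (P : probability T R)
    (X Y : T -> R) (k : R),
  measurable_fun setT X -> measurable_fun setT Y -> 0 < k ->
  (\int[P]_w ((`|X w - Y w| / k) `^ r)%:E <= 2%:E)%E ->
  (\int[leb]_(t in D) (`|quantile (pushforward P X) t
      - quantile (pushforward P Y) t| * alpha t)%:E <= (K * k)%:E)%E.
Proof.
have [K K0 H] := positive_part_bound.
(* One K for each sign of the difference; the 1 makes the constant positive even if K = 0. *)
exists (K + K + 1); first by rewrite ltr_wpDl// addr_ge0.
move=> d T P X Y k mX mY k0 XY.
set qX := quantile _; set qY := quantile _.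
have mp (f g : R -> R) : measurable_fun D f -> measurable_fun D g ->
    measurable_fun D (fun t => (Num.max (f t - g t) 0 * alpha t)%:E).
  move=> mf mg; apply/measurable_EFinP/measurable_funM; last exact: measurable_spectral.
  by apply: measurable_maxr => //; exact: measurable_funB.
have mqX : measurable_fun D qX by exact: measurable_quantile.
have mqY : measurable_fun D qY by exact: measurable_quantile.
have p0 (f g : R -> R) t : D t -> (0 <= (Num.max (f t - g t) 0 * alpha t)%:E)%E.
  by move=> Dt; rewrite lee_fin mulr_ge0 ?alpha_ge0// le_max lexx orbT.
rewrite (_ : (fun t => _) = fun t => ((Num.max (qX t - qY t) 0 * alpha t)%:E
    + (Num.max (qY t - qX t) 0 * alpha t)%:E)%E); last first.
  apply/funext => t; rewrite -EFinD -mulrDl; congr (_ * _)%:E.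
  case: (ltP (qX t - qY t) 0) => h.
    by rewrite ltr0_norm// max_l ?add0r ?opprB// -opprB oppr_ge0 ltW.
  by rewrite ger0_norm// max_r ?addr0// -opprB oppr_le0.
rewrite ge0_integralD//; [|by move=> t; exact: p0|exact: mp|by move=> t; exact: p0|exact: mp].
rewrite (@le_trans _ _ ((k * K)%:E + (k * K)%:E)%E)//.
  apply: leeD; first exact: (H _ T P X Y k mX mY k0 XY).
  apply: (H _ T P Y X k mY mX k0); apply: le_trans XY.
  by under eq_integral do rewrite distrC.
by rewrite -EFinD lee_fin mulrC; nra.
Qed.

End risk_bound.

Section spectral_risk_theory.
Context (R : realType) (r q : R) (r_gt1 : 1 < r) (q_gt1 : 1 < q)
  (rq : r^-1 + q^-1 = 1) (alpha : R -> R)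
  (alpha_spectral : spectral_function alpha) (alpha_Lq : in_Lq q alpha).
Notation leb := (@lebesgue_measure R).
Let D : set R := `]0%R, 1%R[%classic.
Let mD : measurable D. Proof. exact: measurable_itv. Qed.

Let alpha_ge0 t : D t -> 0 <= alpha t.
Proof. by case: alpha_spectral => + _ _ => /(_ t); rewrite /D/= in_itv/=. Qed.

(** This is the comparison of X with the constant 0, whose quantile vanishes on ]0, 1[. *)
Lemma integrable_quantile_spectral d (T : measurableType d) (P : probability T R)
    (X : T -> R) : measurable_fun setT X ->
  (\int[P]_w (`|X w| `^ r)%:E < +oo)%E ->
  leb.-integrable D (fun t => (quantile (pushforward P X) t * alpha t)%:E).
Proof.
move=> mX Xr; have [K K0 H] := quantile_spectral_bound r_gt1 q_gt1 rq alpha_spectral alpha_Lq.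
have r0 : 0 < r by exact: lt_trans r_gt1.
set I := (\int[P]_w _)%E in Xr.
have I0 : (0 <= I)%E by apply: integral_ge0 => w _; rewrite lee_fin powR_ge0.
have If : I = (fine I)%:E by rewrite fineK// ge0_fin_numE.
(* With k^r = I + 1 the normalized moment is I / (I + 1) <= 2, and the 1 keeps k positive when I =
   0. *)
pose k := (fine I + 1) `^ r^-1.
have fI0 : 0 <= fine I by exact: fine_ge0.
have k0 : 0 < k by rewrite powR_gt0// ltr_wpDl.
have kr : k `^ r = fine I + 1.
  by rewrite -powRrM mulVf ?gt_eqF// powRr1// addr_ge0.
have mXr : measurable_fun setT (fun w => (`|X w| `^ r)%:E).
  apply/measurable_EFinP; apply: (measurableT_comp (measurable_powR r)).
  exact: measurableT_comp.
apply/integrableP; split.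
  apply/measurable_EFinP/measurable_funM; first exact: measurable_quantile.
  exact: measurable_spectral.
have := H _ T P X (fun=> 0) k mX (measurable_cst _) k0.
have -> : (\int[P]_w ((`|X w - 0| / k) `^ r)%:E = ((fine I + 1)^-1)%:E * I)%E.
  rewrite /I -ge0_integralZl//; first last.
  - by rewrite lee_fin invr_ge0 addr_ge0.
  - apply: eq_integral => w _; rewrite subr0 -EFinM powRM ?invr_ge0 ?(ltW k0)//.
    by rewrite mulrC -kr -powR_inv1 ?(ltW k0)// powRAC powR_inv1// powR_ge0.
have -> : ((fine I + 1)^-1%:E * I <= 2%:E)%E.
  rewrite If/= -EFinM lee_fin mulrC ler_pdivrMr ?ltr_wpDl//.
  by rewrite mulrDr mulr1; lra.
move=> /(_ isT); rewrite -/D => h; apply: (le_lt_trans _ (ltry (K * k))).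
rewrite (le_trans _ h)// le_eqVlt; apply/orP; left; apply/eqP.
apply: eq_integral => t /[!inE] Dt /=.
rewrite quantile_cst ?subr0; last by move: Dt; rewrite /D/= in_itv.
by rewrite normrM (ger0_norm (alpha_ge0 Dt)).
Qed.

(** The moments make both risks finite, so that the difference of the two integrals is the integral
    of the difference. Exchanging X and Y gives the reverse inequality. *)
Lemma spectral_risk_le :
  exists2 K : R, 0 < K & forall d (T : measurableType d) (P : probability T R)
    (X Y : T -> R) (k : R),
  measurable_fun setT X -> measurable_fun setT Y -> 0 < k ->
  (\int[P]_w (`|X w| `^ r)%:E < +oo)%E ->
  (\int[P]_w (`|Y w| `^ r)%:E < +oo)%E ->
  (\int[P]_w ((`|X w - Y w| / k) `^ r)%:E <= 2%:E)%E ->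
  (spectral_risk alpha (pushforward P X) <=
     spectral_risk alpha (pushforward P Y) + (K * k)%:E)%E.
Proof.
have [K K0 H] := quantile_spectral_bound r_gt1 q_gt1 rq alpha_spectral alpha_Lq.
exists K => // d T P X Y k mX mY k0 Xr Yr XY.
have iX := integrable_quantile_spectral mX Xr.
have iY := integrable_quantile_spectral mY Yr.
have := H _ T P X Y k mX mY k0 XY; rewrite -/D => h.
have iYf : (\int[leb]_(t in D) (quantile (pushforward P Y) t * alpha t)%:E)%E
    \is a fin_num by apply: integrable_fin_num iY.
rewrite -leeBlDl// /spectral_risk -/D -integralB//.
apply: le_trans h.
rewrite (le_trans (lee_abs _))// (le_trans (le_abse_integral _ _ _))//.
  by apply: (measurable_int leb); exact: integrableB.
rewrite le_eqVlt; apply/orP; left; apply/eqP.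
apply: eq_integral => t /[!inE] Dt /=.
by rewrite -mulrBl normrM (ger0_norm (alpha_ge0 Dt)).
Qed.

Lemma spectral_risk_fin_num d (T : measurableType d) (P : probability T R)
    (X : T -> R) : measurable_fun setT X ->
  (\int[P]_w (`|X w| `^ r)%:E < +oo)%E ->
  spectral_risk alpha (pushforward P X) \is a fin_num.
Proof.
move=> mX Xr; have iX := integrable_quantile_spectral mX Xr.
by apply: integrable_fin_num iX.
Qed.

End spectral_risk_theory.

(** * Upper semicontinuity of the risk for bounded integrands *)

Section right_continuity_points.
Context (R : realType).
Notation leb := (@lebesgue_measure R).

(* Each jump contains a rational, and the jumps are disjoint. *)
Lemma countable_right_jumps (D : set R) (f : R -> R) :
  {in D &, nondecreasing f} ->
  countable [set t | D t /\ exists2 e, 0 < e &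
                     forall t', D t' -> t < t' -> f t + e < f t'].
Proof.
move=> ndf; set N := [set t | _].
have jump t : exists c : rat, N t ->
    f t < ratr c /\ forall t', D t' -> t < t' -> ratr c < f t'.
  have [[Dt [e e0 je]]|Nt] := pselect (N t); last by exists 0.
  have [c] : exists c : rat, ratr c \in `](f t), (f t + e)[.
    by apply: rat_in_itvoo; rewrite ltrDl.
  rewrite in_itv/= => /andP[fc cf]; exists c => _; split => // t' Dt' tt'.
  exact: lt_trans (je _ Dt' tt').
have [g gN] := choice jump.
apply/countable_injP; exists (pickle \o g) => s t /set_mem Ns /set_mem Nt /=.
move=> /(pcan_inj pickleK) gst; apply/eqP; rewrite eq_le; apply/andP; split.
- rewrite leNgt; apply/negP => ts; have [_ /(_ s Ns.1 ts)] := gN t Nt.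
  by rewrite -gst; have [+ _] := gN s Ns => /lt_trans/[apply]; rewrite ltxx.
- rewrite leNgt; apply/negP => st; have [_ /(_ t Nt.1 st)] := gN s Ns.
  by rewrite gst; have [+ _] := gN t Nt => /lt_trans/[apply]; rewrite ltxx.
Qed.

End right_continuity_points.

Section usc.
Context (R : realType) (alpha : R -> R) (alpha_spectral : spectral_function alpha).
Notation leb := (@lebesgue_measure R).
Let D : set R := `]0%R, 1%R[%classic.

Let mD : measurable D. Proof. exact: measurable_itv. Qed.

Let alpha_ge0 t : D t -> 0 <= alpha t.
Proof. by case: alpha_spectral => + _ _ => /(_ t); rewrite /D/= in_itv/=. Qed.

Lemma integrable_spectral : leb.-integrable D (EFin \o alpha).
Proof.
case: (alpha_spectral) => _ _ a1; apply/integrableP; split.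
  by apply/measurable_EFinP; exact: measurable_spectral.
rewrite (_ : (\int[leb]_(t in D) _)%E = 1%E) ?ltry// -a1.
by apply: eq_integral => t /[!inE] Dt; rewrite /= ger0_norm// alpha_ge0.
Qed.

Lemma quantile_bounded d (T : measurableType d) (P : probability T R)
    (X : T -> R) (M t : R) : measurable_fun setT X ->
  (forall w, `|X w| <= M) -> 0 < t < 1 -> `|quantile (pushforward P X) t| <= M.
Proof.
move=> mX XM t01; have /andP[t0 t1] := t01; rewrite ler_norml; apply/andP; split.
  rewrite leNgt; apply/negP => qM.
  have := lexx (quantile (pushforward P X) t); rewrite {1}quantile_le//.
  rewrite (_ : _ @^-1` _ = set0) ?measure0 ?lee_fin ?leNgt ?t0//.
  apply/seteqP; split => // w /=; rewrite in_itv/= => Xq.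
  have := XM w; rewrite ler_norml => /andP[+ _].
  by move=> /le_lt_trans /(_ (le_lt_trans Xq qM)); rewrite ltxx.
rewrite quantile_le// (_ : _ @^-1` _ = setT) ?probability_setT ?lee_fin ?ltW//.
apply/seteqP; split => // w _ /=; rewrite in_itv/=.
by have := XM w; rewrite ler_norml => /andP[].
Qed.

(** The hypothesis on P_ is the half of weak convergence that bounds quantiles from above: Q n t is
    eventually at most q t + eta wherever q has no jump to the right of t, that is, outside a
    countable set. The positive part of Q n - q thus tends to 0 almost everywhere, and 2 M alpha
    dominates its product with alpha. *)
Lemma spectral_risk_usc d (T : measurableType d) (P_ : nat -> probability T R)
    (P : probability T R) (X : T -> R) (M : R) :
  measurable_fun setT X -> (forall w, `|X w| <= M) ->
  (forall s s' e, s < s' -> 0 < e -> \forall n \near \oo,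
    (P (X @^-1` `]-oo, s]) <= P_ n (X @^-1` `]-oo, s']) + e%:E)%E) ->
  forall e, 0 < e -> \forall n \near \oo,
    (spectral_risk alpha (pushforward (P_ n) X) <=
     spectral_risk alpha (pushforward P X) + e%:E)%E.
Proof.
move=> mX XM PP e e0.
pose Q n := quantile (pushforward (P_ n) X); pose q := quantile (pushforward P X).
have DE t : D t -> 0 < t < 1 by rewrite /D/= in_itv.
have mQ n : measurable_fun D (Q n) by exact: measurable_quantile.
have mq : measurable_fun D q by exact: measurable_quantile.
have Qb n t : D t -> `|Q n t| <= M by move=> /DE; exact: quantile_bounded.
have qb t : D t -> `|q t| <= M by move=> /DE; exact: quantile_bounded.
have ia := integrable_spectral; have ma := measurable_spectral alpha_spectral.
have bdint (f : R -> R) : measurable_fun D f -> (forall t, D t -> `|f t| <= M) ->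
    leb.-integrable D (fun t => (f t * alpha t)%:E).
  move=> mf fM; apply: (@le_integrable _ _ _ leb D mD _ (fun t => (M%:E * (alpha t)%:E)%E)).
  - exact/measurable_EFinP/measurable_funM.
  - move=> t Dt; rewrite /= lee_fin 2!normrM (ger0_norm (alpha_ge0 Dt)).
    by rewrite ler_wpM2r ?alpha_ge0// (le_trans (fM _ Dt))// ler_norm.
  - exact: integrableZl.
have iQ n := bdint _ (mQ n) (Qb n); have iq := bdint _ mq qb.
pose h n t := (Num.max (Q n t - q t) 0 * alpha t)%:E.
have mh n : measurable_fun D (h n).
  apply/measurable_EFinP/measurable_funM => //; apply: measurable_maxr => //.
  exact: measurable_funB.
have h0 n t : D t -> (0 <= h n t)%E.
  by move=> Dt; rewrite lee_fin mulr_ge0 ?alpha_ge0// le_max lexx orbT.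
have hg n t : D t -> (`|h n t| <= (M + M)%:E * (alpha t)%:E)%E.
  move=> Dt; rewrite gee0_abs ?h0// -EFinM lee_fin ler_wpM2r ?alpha_ge0//.
  rewrite ge_max; apply/andP; split; last first.
    by rewrite addr_ge0// (le_trans _ (qb _ Dt)).
  rewrite (le_trans (ler_norm _))// (le_trans (ler_normB _ _))// lerD//.
  - exact: Qb.
  - exact: qb.
have ig : leb.-integrable D (fun t => (M + M)%:E * (alpha t)%:E)%E by exact: integrableZl.
have hcvg : {ae leb, forall t, D t -> h ^~ t @ \oo --> 0%E}.
  have cN : countable [set t | D t /\ exists2 e, 0 < e &
      forall t', D t' -> t < t' -> q t + e < q t'].
    apply: countable_right_jumps => s t; rewrite !inE => Ds Dt.
    exact: quantile_nd.
  exists [set t | D t /\ exists2 e, 0 < e & forall t', D t' -> t < t' -> q t + e < q t'].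
  split; [exact: countable_measurable|exact: countable_lebesgue_measure0|].
  move=> t /= /not_implyP[Dt ncv]; split => //; apply: contra_notP ncv => njump.
  apply/fine_cvgP; split; first exact: nearW.
  apply/cvgrPdist_le => eps eps0 /=.
  (* Then eta alpha t <= eps, and the 1 covers alpha t = 0. *)
  pose eta := eps / (alpha t + 1).
  have at0 : 0 < alpha t + 1 by rewrite ltr_wpDl// alpha_ge0.
  have eta0 : 0 < eta by rewrite divr_gt0.
  (* The gap t' - t is spent as the error in the hypothesis on P_: from t' <= P (X <= q t') it
     leaves t <= P_ n (X <= q t + eta). Halving eta makes q t' < q t + eta strict. *)
  have [t' [Dt' tt' qt']] : exists t', [/\ D t', t < t' & q t' <= q t + eta / 2].
    apply: contra_notP njump => /forallNP nt'.
    exists (eta / 2); first by rewrite divr_gt0.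
    move=> t' Dt' tt'; rewrite ltNge; apply/negP => qq.
    by apply: (nt' t'); split.
  have ss : q t' < q t + eta.
    by apply: (le_lt_trans qt'); rewrite ltrD2l ltr_pdivrMr// ltr_pMr// ltr1n.
  have tt0 : 0 < t' - t by rewrite subr_gt0.
  have := PP _ _ _ ss tt0; apply: filterS => n Pn.
  have QE : Q n t <= q t + eta.
    rewrite quantile_le ?DE//.
    rewrite -(@leeD2rE _ (t' - t)%:E)// -EFinD addrC subrK (le_trans _ Pn)//.
    by rewrite -quantile_le ?DE.
  rewrite sub0r normrN ger0_norm; last by have := h0 n t Dt; rewrite lee_fin.
  have -> : eps = eta * (alpha t + 1) by rewrite divfK// gt_eqF.
  rewrite ler_pM ?alpha_ge0 ?le_max ?lexx ?orbT ?lerDl//.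
  by rewrite ge_max (ltW eta0) andbT lerBlDl.
have [_ _ /=] := @dominated_convergence _ _ _ leb D mD h (cst 0%E) _ mh
  (measurable_cst _) hcvg ig (aeW leb (fun t n Dt => hg n t Dt)).
rewrite integral0 => /fine_cvgP[fh /cvgrPdist_le /(_ e e0)].
move: fh; apply: filterS2 => n fin; rewrite sub0r normrN /= => he.
have ih : leb.-integrable D (h n).
  apply: (@le_integrable _ _ _ leb D mD _ _ (mh n) _ ig) => t Dt.
  by rewrite (le_trans (hg n t Dt))// lee_abs.
have : (spectral_risk alpha (pushforward (P_ n) X) <=
    spectral_risk alpha (pushforward P X) + \int[leb]_(t in D) h n t)%E.
  rewrite /spectral_risk -/D -integralD//.
  apply: (@le_integral _ _ _ leb D mD _ _ (iQ n) (@integrableD _ _ _ leb D mD _ _ iq ih)).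
  move=> t /[!inE] Dt; rewrite -EFinD lee_fin -mulrDl ler_wpM2r ?alpha_ge0//.
  by rewrite -lerBlDl le_max lexx.
move=> /le_trans; apply; rewrite leeD2l//.
by rewrite -(fineK fin) lee_fin (le_trans (ler_norm _)).
Qed.

End usc.

(** * Borel sigma-algebras of the spaces *)

Section borel_maps.
Context (T : ptopologicalType).

Lemma open_borel (U : set T) : open U -> measurable (U : set (borel T)).
Proof. by move=> oU; exact: sub_sigma_algebra. Qed.

Lemma measurable_fun_borelP d (W : measurableType d) (f : W -> borel T) :
  (forall U, open U -> measurable (f @^-1` U)) -> measurable_fun setT f.
Proof.
move=> mf; apply: (@measurability _ _ W (borel T) setT f (@open T)) => //.
by move=> _ [U oU <-]; rewrite setTI; exact: mf.
Qed.

End borel_maps.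

Lemma continuous_borel (T T' : ptopologicalType) (f : T -> T') : continuous f ->
  measurable_fun setT (f : borel T -> borel T').
Proof.
move=> /continuousP cf; apply: measurable_fun_borelP => U oU.
by apply: open_borel; exact: cf.
Qed.

Lemma continuous_borelR (T : ptopologicalType) (R : realType) (f : T -> R) :
  continuous f -> measurable_fun setT (f : borel T -> R).
Proof.
move=> /continuousP cf; apply: (measurability (@RGenOpens.G R)).
  exact: RGenOpens.measurableE.
move=> _ [_ [x [y ->]] <-]; rewrite setTI; apply: open_borel.
by apply: cf; exact: interval_open.
Qed.

Section subset_space_topology.
Context (R : realType) (n : nat) (A : set 'rV[R]_n) (A0 : A !=set0).
Local Notation S := (subset_space A0).

Definition subset_coord (i : 'I_n) (x : S) : R := val x ord0 i.

Lemma continuous_subset_coord i : continuous (subset_coord i).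
Proof.
move=> x; apply: (@continuous_comp S 'rV[R]_n R
    (set_val : S -> 'rV[R]_n) (fun v => v ord0 i)).
  exact: initial_continuous.
exact: coord_continuous.
Qed.

Lemma nbhs_subset_space (x : S) (U : set S) : nbhs x U ->
  exists2 e, 0 < e & forall y,
    (forall i, `|subset_coord i x - subset_coord i y| < e) -> U y.
Proof.
rewrite nbhsE => -[_ [[V oV <-] Vx] VU].
have : nbhs (set_val x) V by exact: open_nbhs_nbhs.
move=> /nbhs_ballP[e /= e0 eV]; exists e => // y xy.
apply: VU; apply: eV; split => // i j; rewrite (ord1 i); exact: xy.
Qed.

Lemma subset_coord_inj (x y : S) :
  (forall i, subset_coord i x = subset_coord i y) -> x = y.
Proof. by move=> xy; apply: val_inj; apply/rowP. Qed.

Lemma measurable_subset_coord i :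
  measurable_fun setT (subset_coord i : borel S -> R).
Proof. by apply: continuous_borelR; exact: continuous_subset_coord. Qed.

(** Lets couplings be conditioned on the atoms of an empirical measure. *)
Lemma measurable_set1_subset_space (a : S) : measurable ([set a] : set (borel S)).
Proof.
have -> : [set a] = \bigcap_(i in [set: 'I_n])
    ((subset_coord i : borel S -> R) @^-1` [set subset_coord i a]).
  apply/seteqP; split => [x -> i//|x xa].
  by apply: subset_coord_inj => i; exact: xa.
apply: fin_bigcap_measurable => [|i _]; first exact: finite_finset.
rewrite -[X in measurable X]setTI.
exact: measurable_subset_coord.
Qed.

Lemma l2distE (x y : S) :
  l2dist x y = Num.sqrt (\sum_i (subset_coord i x - subset_coord i y) ^+ 2).
Proof. by rewrite /l2dist /l2norm; congr Num.sqrt; apply: eq_bigr => i _; rewrite !mxE. Qed.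

Lemma measurable_l2dist d (W : measurableType d) (f g : W -> borel S) :
  measurable_fun setT f -> measurable_fun setT g ->
  measurable_fun setT (fun w => @l2dist R n A A0 (f w) (g w)).
Proof.
move=> mf mg; under eq_fun do rewrite l2distE.
apply: (measurableT_comp (@continuous_measurable_fun _ _ (@sqrt_continuous R))).
apply: measurable_sum => i; apply: measurable_funX; apply: measurable_funB.
- exact: measurableT_comp (measurable_subset_coord i) mf.
- exact: measurableT_comp (measurable_subset_coord i) mg.
Qed.

End subset_space_topology.

Section prod_space_topology.
Context (R : realType) (D : nat) (d : 'I_D -> nat)
  (X : forall j, set 'rV[R]_(d j)) (X0 : forall j, X j !=set0).
Local Notation T := (prod_space X0).

Lemma continuous_prod_coord j : continuous (prod_coord j : T -> subset_space (X0 j)).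
Proof. exact: (@proj_continuous _ (fun j => subset_space (X0 j) : topologicalType) j). Qed.

Lemma measurable_prod_coord j : measurable_fun setT
  (prod_coord j : borel T -> borel (subset_space (X0 j))).
Proof. by apply: continuous_borel; exact: continuous_prod_coord. Qed.

(** The boxes around x form a filter. As the product topology is the supremum of the initial
    topologies of the coordinates, its convergence to x is checked one coordinate at a time. *)
Lemma nbhs_prod_space (x : T) (U : set T) : nbhs x U ->
  exists2 e, 0 < e & forall y : T, (forall j i,
    `|subset_coord i (prod_coord j x) - subset_coord i (prod_coord j y)| < e) -> U y.
Proof.
pose B e : set T := [set y : T | forall j i,
  `|subset_coord i (prod_coord j x) - subset_coord i (prod_coord j y)| < e].
pose F : set_system T := filter_from [set e : R | 0 < e] B.
have FF : Filter F.
  apply: filter_from_filter; first by exists 1 => /=.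
  move=> e1 e2 /= e10 e20; exists (Num.min e1 e2); first by rewrite /= lt_min e10.
  by move=> y /= By; split => j i; have := By j i; rewrite lt_min => /andP[].
suff /(_ U) FU : F --> x by move=> /FU[e /= e0 BU]; exists e => // y; exact: BU.
apply/(@cvg_sup T 'I_D (fun j => Topological.class (initial_topology
    (fun f : (forall j, subset_space (X0 j)) => f j))) F x) => j V.
rewrite nbhsE => -[_ [[W oW <-] Wx] WV].
have : nbhs (prod_coord j x) W by exact: open_nbhs_nbhs.
move=> /nbhs_subset_space[e e0 eW]; exists e => // y By.
by apply: WV; apply: eW => i; exact: By.
Qed.

(* An open set of the product is a countable union of boxes with rational centres, so the
   Borel sets of the product are generated by the coordinates. *)
Lemma measurable_fun_prod_space d' (W : measurableType d') (f : W -> borel T) :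
  (forall j, measurable_fun setT
     (fun w => prod_coord j (f w) : borel (subset_space (X0 j)))) ->
  measurable_fun setT f.
Proof.
move=> mf; apply: measurable_fun_borelP => U oU.
(* The dimension depends on j, so a centre is coded by lists of rationals read with [nth 0]; this
   keeps the index type countable. *)
pose I : countType := ({ffun 'I_D -> seq rat} * nat)%type.
pose B (c : I) : set T := [set y : T | forall (j : 'I_D) (i : 'I_(d j)),
  `|ratr (nth 0 (c.1 j) i) - subset_coord i (prod_coord j y)| < c.2.+1%:R^-1].
have mB c : measurable (f @^-1` B c).
  have -> : f @^-1` B c = \bigcap_(j in [set: 'I_D]) \bigcap_(i in [set: 'I_(d j)])
     ((fun w => `|ratr (nth 0 (c.1 j) i) - subset_coord i (prod_coord j (f w))|)
      @^-1` `]-oo, c.2.+1%:R^-1[).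
    apply/seteqP; split => w.
      by move=> Bw j _ i _ /=; rewrite in_itv/=; exact: Bw.
    by move=> wB j i; have := wB j Logic.I i Logic.I; rewrite /= in_itv.
  apply: fin_bigcap_measurable => [|j _]; first exact: finite_finset.
  apply: fin_bigcap_measurable => [|i _]; first exact: finite_finset.
  rewrite -[X in measurable X]setTI.
  have mji : measurable_fun setT
      (fun w => `|ratr (nth 0 (c.1 j) i) - subset_coord i (prod_coord j (f w))|).
    apply: measurableT_comp => //; apply: measurable_funB => //.
    exact: measurableT_comp (measurable_subset_coord i) (mf j).
  by apply: mji => //; exact: measurable_itv.
have -> : f @^-1` U = \bigcup_(n in [set n | exists2 c, unpickle n = Some c & B c `<=` U])
    (if unpickle n is Some c then f @^-1` B c else set0).
  apply/seteqP; split => [w Uw|w [n [c nc BU]]]; last by rewrite nc; exact: BU.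
  have : nbhs (f w) U by exact: open_nbhs_nbhs.
  move=> /nbhs_prod_space[e e0 eU].
  (* A box of radius below e / 2 whose centre is close to f w stays within e of f w, hence inside
     U. *)
  have [k ke] : exists k, k.+1%:R^-1 < e / 2.
    exists (Num.truncn (e / 2)^-1); rewrite invf_plt ?posrE ?divr_gt0//.
    exact: truncnS_gt.
  have rex j (i : 'I_(d j)) : exists r : rat,
      `|ratr r - subset_coord i (prod_coord j (f w))| < k.+1%:R^-1.
    set a := subset_coord _ _.
    have [r] : exists r : rat, ratr r \in `]a, (a + k.+1%:R^-1)[.
      by apply: rat_in_itvoo; rewrite ltrDl invr_gt0.
    rewrite in_itv/= => /andP[ar ra]; exists r.
    by rewrite gtr0_norm ?subr_gt0// ltrBlDl.
  pose c : I := ([ffun j => [seq projT1 (cid (rex j i)) | i <- enum 'I_(d j)]], k).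
  have cE j (i : 'I_(d j)) : nth 0 (c.1 j) i = projT1 (cid (rex j i)).
    rewrite /c/= ffunE (nth_map i) ?size_enum_ord//.
    by congr (projT1 (cid (rex j _))); apply: val_inj; rewrite /= nth_enum_ord.
  exists (pickle c); last first.
    by rewrite pickleK => j i; rewrite cE; exact: projT2 (cid (rex j i)).
  exists c; first by rewrite pickleK.
  move=> y By; apply: eU => j i.
  have h1 := projT2 (cid (rex j i)); have := By j i; rewrite cE => h2.
  set s := ratr _ in h1 h2.
  rewrite (_ : _ - _ = (s - subset_coord i (prod_coord j y))
      - (s - subset_coord i (prod_coord j (f w)))); last by ring.
  rewrite (le_lt_trans (ler_normB _ _))//.
  by rewrite [ltRHS](splitr e) ltrD// (lt_trans _ ke).
apply: bigcup_measurable => n [c nc _]; rewrite nc; exact: mB.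
Qed.

End prod_space_topology.
Arguments measurable_subset_coord {R n A A0} i.
Arguments continuous_subset_coord {R n A A0} i.
Arguments measurable_prod_coord {R D d X X0} j.
Arguments continuous_prod_coord {R D d X X0} j.

(** * Gluing couplings along an empirical measure *)

Section probability_constructions.
Context (R : realType).
Local Open Scope ereal_scope.

Definition image_probability d d' (T : measurableType d) (T' : measurableType d')
    (P : probability T R) (f : T -> T') (mf : measurable_fun setT f) :
    probability T' R :=
  distribution P (mfun_Sub (mem_set mf) : {mfun T >-> T'}).

Lemma image_probabilityE d d' (T : measurableType d) (T' : measurableType d')
    (P : probability T R) (f : T -> T') (mf : measurable_fun setT f) A :
  image_probability P mf A = P (f @^-1` A).
Proof. by []. Qed.

Lemma ge0_integral_image_probability d d' (T : measurableType d)
    (T' : measurableType d') (P : probability T R) (f : T -> T')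
    (mf : measurable_fun setT f) (g : T' -> \bar R) :
  measurable_fun setT g -> (forall y, 0 <= g y) ->
  \int[image_probability P mf]_y g y = \int[P]_x g (f x).
Proof. by move=> mg g0; rewrite ge0_integral_distribution. Qed.

Lemma exists_average d (T : measurableType d) n (m : 'I_n.+1 -> probability T R) :
  exists M : probability T R,
    (forall A, M A = n.+1%:R^-1%:E * \sum_(i < n.+1) m i A) /\
    (forall f, measurable_fun setT f -> (forall x, 0 <= f x) ->
      \int[M]_x f x = n.+1%:R^-1%:E * \sum_(i < n.+1) \int[m i]_x f x).
Proof.
have n0 : (0 <= n.+1%:R^-1 :> R)%R by [].
pose mu : {measure set T -> \bar R} :=
  mscale (NngNum n0) (msum (fun k => m (inord k)) n.+1).
have muE A : mu A = n.+1%:R^-1%:E * \sum_(i < n.+1) m i A.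
  rewrite /mu /= /mscale /msum/=; congr (_ * _).
  by apply: eq_bigr => i _; rewrite inord_val.
have mu1 : mu setT = 1.
  rewrite muE (eq_bigr (fun=> 1)) => [|i _]; last by rewrite probability_setT.
  rewrite sumEFin sumr_const card_ord -EFinM -[(1 *+ _)%R]/(n.+1%:R)%R.
  by rewrite mulVf.
(* The mass of [mu] is already 1; normalizing changes no value and supplies the structure of a
   probability. *)
have ME A : mnormalize mu (m ord0) A = mu A.
  rewrite /mnormalize/=; have -> : mscale (NngNum n0) (msum (fun k => m (inord k)) n.+1) setT = 1.
    exact: mu1.
  by rewrite onee_eq0/= invr1 mule1.
exists (mnormalize mu (m ord0)); split; first by move=> A; rewrite -muE; exact: ME.
move=> f mf f0; rewrite (eq_measure_integral mu); last by move=> A _ _; exact: ME.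
rewrite ge0_integral_mscale//= ge0_integral_measure_sum//.
by congr (_ * _); apply: eq_bigr => i _; rewrite inord_val.
Qed.

Lemma exists_conditional d (T : measurableType d) (P : probability T R) (E : set T) :
  measurable E -> P E != 0 ->
  exists Q : probability T R, forall f, measurable_fun setT f ->
    (forall x, 0 <= f x) -> \int[P]_(x in E) f x = P E * \int[Q]_x f x.
Proof.
move=> mE PE0.
have PEfin : P E = (fine (P E))%:E by rewrite fineK// fin_num_measure.
have fPE : (0 < fine (P E))%R.
  by rewrite lt_neqAle fine_ge0// andbT eq_sym fine_eq0// fin_num_measure.
have k0 : (0 <= (fine (P E))^-1)%R by rewrite invr_ge0 ltW.
pose mu : {measure set T -> \bar R} := mscale (NngNum k0) (mrestr P mE).
have muT : mu setT = 1.
  by rewrite /mu/= /mscale/= /mrestr setTI PEfin -EFinM mulVf// gt_eqF.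
have QE A : mnormalize mu P A = mu A.
  rewrite /mnormalize/=; have -> : mscale (NngNum k0) (mrestr P mE) setT = 1 by exact: muT.
  by rewrite onee_eq0/= invr1 mule1.
exists (mnormalize mu P) => f mf f0.
rewrite [X in _ = _ * X](eq_measure_integral mu); last by move=> A _ _; exact: QE.
rewrite ge0_integral_mscale//= {1}PEfin muleA -EFinM divff ?gt_eqF// mul1e.
rewrite [RHS](@ge0_negligible_integral _ _ _ _ _ (~` E))//; last first.
- by rewrite /= /mrestr setICl measure0.
- exact: measurableC.
rewrite setTD setCK; apply: eq_measure_integral => A mA AE.
by rewrite /= /mrestr setIidl.
Qed.

(** A finitely supported second marginal reduces disintegration to conditioning on its atoms. The
    family is indexed by i rather than by atoms, so that disintegrations for different coordinates
    of the same points can be matched index by index. *)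
Lemma disintegrate_empirical d1 d2 (S : measurableType d1) (T : measurableType d2)
    n (Y : 'I_n.+1 -> T) (pi : probability (S * T)%type R) :
  (forall a : T, measurable [set a]) ->
  (forall A, measurable A -> pi (snd @^-1` A) = empirical R Y A) ->
  exists nu : 'I_n.+1 -> probability S R, forall g, measurable_fun setT g ->
    (forall z, 0 <= g z) ->
    \int[pi]_z g z = n.+1%:R^-1%:E * \sum_(i < n.+1) \int[nu i]_x g (x, Y i).
Proof.
move=> m1 piY.
pose E i : set (S * T) := snd @^-1` [set Y i].
have mE i : measurable (E i).
  by rewrite -[X in measurable X]setTI; exact: measurable_snd.
(* The [Y i] may coincide: [c i] is the multiplicity of the atom [Y i]. *)
pose c i : nat := (\sum_(k < n.+1) `[< Y k = Y i >])%N.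
have c0 i : (0 < c i)%N by rewrite /c (bigD1 i)//= asboolT.
have c_neq0 i : (c i)%:R != 0%R :> R by rewrite pnatr_eq0 -lt0n c0.
have piE i : pi (E i) = ((c i)%:R / n.+1%:R)%:E.
  rewrite /E piY// /empirical.
  rewrite (eq_bigr (fun k => (`[< Y k = Y i >] : nat)%:R%:E)); last first.
    move=> k _; rewrite diracE; congr ((nat_of_bool _)%:R%:E).
  by rewrite sumEFin -natr_sum -EFinM mulrC.
have cond i : exists nu : probability (S * T)%type R, forall f, measurable_fun setT f ->
    (forall x, 0 <= f x) ->
    \int[pi]_(x in E i) f x = ((c i)%:R / n.+1%:R)%:E * \int[nu]_x f x.
  rewrite -piE; apply: exists_conditional => //.
  by rewrite piE eqe mulf_neq0 ?invr_eq0 ?c_neq0.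
have [nu nuE] := choice cond.
exists (fun i => image_probability (nu i) measurable_fst) => g mg g0.
pose U := \bigcup_(i in [set: 'I_n.+1]) E i.
have mU : measurable U by apply: fin_bigcup_measurable => //; exact: finite_finset.
(* The second marginal charges only the points Y i, so integrals against pi may be restricted to
   U. *)
have piU : pi (~` U) = 0.
  have -> : ~` U = snd @^-1` (~` range Y).
    rewrite preimage_setC; congr (~` _); apply/seteqP; split=> z.
      by move=> [i _ zi]; exists i.
    by move=> [i _ zi]; exists i.
  rewrite piY; last first.
    apply: measurableC.
    rewrite (_ : range Y = \bigcup_(i in [set: 'I_n.+1]) [set Y i]).
      by apply: fin_bigcup_measurable => //; exact: finite_finset.
    by apply/seteqP; split=> y [i _ yi]; exists i.
  rewrite /empirical big1 ?mule0// => i _; rewrite diracE memNset//=.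
  by apply; exists i.
rewrite (@ge0_negligible_integral _ _ _ _ _ (~` U))//; last exact: measurableC.
rewrite setTD setCK.
(* A partition of unity on U: if z lies over Y k, exactly c k of the sets E i contain it, and all of
   these have c i = c k. *)
transitivity (\int[pi]_(z in U) \sum_(i < n.+1) ((c i)%:R^-1%:E * (g \_ (E i)) z)).
  apply: eq_integral => z /[!inE] -[k _ Ek].
  rewrite (eq_bigr (fun i => ((c k)%:R^-1 *+ `[< Y i = Y k >])%:E * g z)); last first.
    move=> i _; rewrite /patch; case: ifPn.
      rewrite inE => Ei; have YE : Y i = Y k by rewrite -Ek -Ei.
      by rewrite asboolT//= mulr1n /c YE.
    rewrite notin_setE => Ei; rewrite asboolF//.
      by rewrite mulr0n mul0e mule0.
    by move=> YE; apply: Ei; rewrite /E/= YE.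
  rewrite -ge0_sume_distrl; last by move=> i _; rewrite lee_fin mulrn_wge0.
  rewrite sumEFin.
  have -> : (\sum_(i < n.+1) (c k)%:R^-1 *+ `[< Y i = Y k >] = 1 :> R)%R.
    by rewrite sumrMnr -[LHS]mulr_natl divff// c_neq0.
  by rewrite mul1e.
rewrite ge0_integral_sum//; first last.
- move=> i z _; rewrite mule_ge0 ?lee_fin// /patch; case: ifP => //.
- move=> i; apply: measurable_funeM.
  apply: measurable_funTS; apply: (iffLR (measurable_restrictT _ (mE i))).
  exact: measurable_funTS.
rewrite ge0_sume_distrr; last first.
  by move=> i _; apply: integral_ge0 => x _; exact: g0.
apply: eq_bigr => i _.
rewrite ge0_integralZl//; first last.
- by move=> z _; rewrite /patch; case: ifP.
- apply: measurable_funTS; apply: (iffLR (measurable_restrictT _ (mE i))).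
  exact: measurable_funTS.
rewrite -integral_mkcondr setIidr; last by move=> z; exists i.
have mgi : measurable_fun setT (fun z : S * T => g (z.1, Y i)).
  apply: measurableT_comp => //; apply: measurable_fun_pair => //.
rewrite ge0_integral_image_probability//; last first.
  by apply: measurableT_comp => //; exact: pair2_measurable.
rewrite (_ : \int[pi]_(z in E i) g z = \int[pi]_(z in E i) g (z.1, Y i)); last first.
  by apply: eq_integral => -[x y] /[!inE]; rewrite /E/= => ->.
by rewrite nuE// muleA -EFinM mulrA mulVf ?mul1r// c_neq0.
Qed.

End probability_constructions.

(** Each term is compared with the largest one. The constant is crude but the argument works for
    every positive exponent; both p and beta are needed. *)
Lemma sqrt_sum_sqr_powR (R : realType) (n : nat) (a : 'I_n -> R) (p : R) :
  0 < p -> (forall i, 0 <= a i) ->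
  Num.sqrt (\sum_i a i ^+ 2) `^ p <= n%:R `^ p * \sum_i a i `^ p.
Proof.
case: n a => [|n] a p0 a0.
  by rewrite !big_ord0 sqrtr0 mulr0 powR0// gt_eqF.
have [k kmax] : exists k, forall i, a i <= a k.
  have [k _ kP] := @arg_maxP _ R _ ord0 xpredT a isT.
  by exists k => i; exact: kP.
have : Num.sqrt (\sum_i a i ^+ 2) <= n.+1%:R * a k.
  rewrite -[leRHS]ger0_norm ?mulr_ge0// -sqrtr_sqr ler_wsqrtr//.
  rewrite (@le_trans _ _ (\sum_(i < n.+1) a k ^+ 2))//.
    by apply: ler_sum => i _; rewrite ler_pXn2r ?nnegrE.
  rewrite sumr_const card_ord -[leLHS]mulr_natl exprMn ler_wpM2r ?sqr_ge0//.
  by rewrite expr2 ler_peMr ?ler1n.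
move=> /(@ge0_ler_powR _ p (ltW p0)) => h.
rewrite (le_trans (h _ _))// ?nnegrE ?sqrtr_ge0 ?mulr_ge0//.
rewrite powRM// ler_wpM2l ?powR_ge0// (bigD1 k)//= lerDl.
by apply: sumr_ge0 => i _; exact: powR_ge0.
Qed.

Section gluing.
Context (R : realType) (D : nat) (d : 'I_D -> nat)
  (X : forall j, set 'rV[R]_(d j)) (X0 : forall j, X j !=set0).
Local Notation T := (prod_space X0).
Local Notation S j := (subset_space (X0 j)).

Lemma measurable_prod_l2dist d' (W : measurableType d') (f g : W -> borel T) :
  measurable_fun setT f -> measurable_fun setT g ->
  measurable_fun setT (fun w => @prod_l2dist R D d X X0 (f w) (g w)).
Proof.
move=> mf mg.
apply: (measurableT_comp (@continuous_measurable_fun _ _ (@sqrt_continuous R))).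
apply: measurable_sum => j; apply: measurable_funX; apply: measurable_l2dist.
- exact: measurableT_comp (measurable_prod_coord j) mf.
- exact: measurableT_comp (measurable_prod_coord j) mg.
Qed.

Lemma prod_l2dist_powR (p : R) (x y : T) : 0 < p ->
  prod_l2dist x y `^ p <=
  D%:R `^ p * \sum_(j < D) l2dist (prod_coord j x) (prod_coord j y) `^ p.
Proof.
by move=> p0; apply: sqrt_sum_sqr_powR => // j; exact: sqrtr_ge0.
Qed.

Lemma measurable_replace j : measurable_fun setT
  ((fun z => dfwith z.1 j z.2) : borel T * borel (S j) -> borel T).
Proof.
apply: measurable_fun_prod_space => i; have [ji|ji] := eqVneq j i.
  case: _ / ji; rewrite (_ : (fun w => _) = snd); first exact: measurable_snd.
  by apply/funext => w; rewrite /prod_coord dfwithin.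
rewrite (_ : (fun w => _) = (prod_coord i : borel T -> borel (S i)) \o fst).
  exact: measurableT_comp (measurable_prod_coord i) measurable_fst.
by apply/funext => w; rewrite /prod_coord dfwithout.
Qed.

(* Any starting measure will do: its coordinates are replaced one after the other by
   independent ones, which avoids finite products of measures. *)
Lemma exists_joint (nu : forall j, probability (borel (S j)) R) :
  exists m : probability (borel T) R, forall j A, measurable A ->
    marginal m j A = nu j A.
Proof.
suff [m mP] : exists m : probability (borel T) R, forall j, j \in enum 'I_D ->
    forall A, measurable A -> marginal m j A = nu j A.
  by exists m => j; apply: mP; rewrite mem_enum.
elim: (enum 'I_D) => [|k s [m mP]].
  by exists (dirac (point : borel T)).
exists (image_probability (m \x nu k)%E (@measurable_replace k)) => j js A mA.
rewrite /marginal /pushforward image_probabilityE.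
have [jk|jk] := eqVneq k j.
  case: _ / jk A mA {js} => A mA.
  rewrite (_ : _ @^-1` _ = setT `*` A); last first.
    by apply/seteqP; split => -[x y] /=; rewrite /prod_coord dfwithin//; case.
  transitivity (m setT * nu k A)%E; first exact: product_measure1E.
  by rewrite probability_setT mul1e.
have {}js : j \in s by move: js; rewrite inE eq_sym (negbTE jk).
rewrite (_ : _ @^-1` _ = (prod_coord j @^-1` A) `*` setT); last first.
  by apply/seteqP; split => -[x y] /=; rewrite /prod_coord dfwithout//; case.
have mjA : measurable ((prod_coord j : borel T -> borel (S j)) @^-1` A).
  by rewrite -[X in measurable X]setTI; exact: measurable_prod_coord.
transitivity (m (prod_coord j @^-1` A) * nu k setT)%E.
  exact: product_measure1E.
by rewrite probability_setT mule1 -mP.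
Qed.

(** Over each Y i, the conditional laws nu j i of the first coordinates are joined into a law m i on
    the product, and Pi is the average of the laws of (x, Y i) with x drawn from m i. Which joint
    law is taken does not affect the bound, because both the marginals of gamma and the bounding
    cost are sums over i of expressions in the nu j i separately. *)
Lemma glue_couplings (p : R) (rho : forall j, probability (borel (S j)) R)
    (n : nat) (Y : 'I_n.+1 -> borel T)
    (pi : forall j, probability (borel (S j) * borel (S j))%type R) :
  0 < p ->
  (forall j, couplings (rho j) (marginal (empirical R Y) j) (pi j)) ->
  exists gamma : probability (borel T) R, plans rho gamma /\
  exists2 Pi : probability (borel T * borel T)%type R,
    couplings gamma (empirical R Y) Pi &
    (\int[Pi]_z (@prod_l2dist R D d X X0 z.1 z.2 `^ p)%:E <=
     (D%:R `^ p)%:E * \sum_(j < D)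
       \int[pi j]_z (@l2dist R _ _ (X0 j) z.1 z.2 `^ p)%:E)%E.
Proof.
move=> p0 cpi.
pose Q j (nu : 'I_n.+1 -> probability (borel (S j)) R) :=
    forall g, measurable_fun setT g -> (forall z, (0 <= g z)%E) ->
    (\int[pi j]_z g z = n.+1%:R^-1%:E *
      \sum_(i < n.+1) \int[nu i]_x g (x, (prod_coord j : borel T -> borel (S j)) (Y i)))%E.
have dis j : exists nu, Q j nu.
  apply: (disintegrate_empirical
    (Y := fun i => (prod_coord j : borel T -> borel (S j)) (Y i))).
    exact: measurable_set1_subset_space.
  by move=> A /(cpi j)[_ ].
pose nu j := projT1 (cid (dis j)).
have nuE j : Q j (nu j) := projT2 (cid (dis j)).
have jm i := exists_joint (fun j => nu j i).
pose m i := projT1 (cid (jm i)).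
have mE i : forall j A, measurable A -> marginal (m i) j A = nu j i A.
  exact: projT2 (cid (jm i)).
have mpair i : measurable_fun setT ((fun x => (x, Y i)) : borel T -> borel T * borel T).
  exact: pair2_measurable.
have [Pi [PiE PiI]] := exists_average (fun i => image_probability (m i) (mpair i)).
exists (image_probability Pi measurable_fst); split.
  move=> j A mA; rewrite /marginal /pushforward image_probabilityE PiE.
  (* Integrating the indicator of A in the first variable against the disintegration of pi j shows
     that rho j A is the average of the nu j i A. *)
  have mA1 : measurable_fun setT
      ((fun z => (\1_A z.1)%:E) : borel (S j) * borel (S j) -> \bar R).
    apply/measurable_EFinP.
    have mA1 : measurable_fun setT (\1_A : borel (S j) -> R) by exact: measurable_indic.
    exact: (measurableT_comp mA1 measurable_fst).
  have := nuE j _ mA1 (fun z => ltac:(by rewrite lee_fin)).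
  have -> : (\int[pi j]_z (\1_A z.1)%:E)%E = rho j A.
    have [<- _] := cpi j A mA; rewrite /pushforward -[in RHS](setIT (fst @^-1` A)).
    rewrite -integral_indic//.
    by rewrite -[X in measurable X]setTI; exact: measurable_fst.
  move=> ->; congr (_ * _)%E; apply: eq_bigr => i _.
  transitivity (nu j i A); first by rewrite -mE.
  by rewrite /= integral_indic// setIT.
exists Pi.
  move=> A mA; split => //.
  rewrite /pushforward PiE /empirical; congr (_ * _)%E; apply: eq_bigr => i _.
  rewrite image_probabilityE diracE.
  have [YA|YA] := boolP (Y i \in A).
    rewrite (_ : _ @^-1` _ = setT) ?probability_setT//.
    by apply/seteqP; split => // x _ /=; rewrite inE in YA.
  rewrite (_ : _ @^-1` _ = set0) ?measure0//.
  by apply/seteqP; split => // x /=; rewrite notin_setE in YA.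
have md : measurable_fun setT
    ((fun z => (@prod_l2dist R D d X X0 z.1 z.2 `^ p)%:E) : borel T * borel T -> \bar R).
  apply/measurable_EFinP; apply: (measurableT_comp (measurable_powR p)).
  by apply: measurable_prod_l2dist; [exact: measurable_fst|exact: measurable_snd].
have mdj j : measurable_fun setT
    ((fun z => (@l2dist R _ _ (X0 j) z.1 z.2 `^ p)%:E) : borel (S j) * borel (S j) -> \bar R).
  apply/measurable_EFinP; apply: (measurableT_comp (measurable_powR p)).
  by apply: measurable_l2dist; [exact: measurable_fst|exact: measurable_snd].
have p0' (x : R) : (0 <= (x `^ p)%:E)%E by rewrite lee_fin powR_ge0.
rewrite PiI//.
under eq_bigr do rewrite ge0_integral_image_probability//=.
have -> : (\sum_(j < D) \int[pi j]_z (@l2dist R _ _ (X0 j) z.1 z.2 `^ p)%:E =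
  n.+1%:R^-1%:E * \sum_(i < n.+1) \sum_(j < D)
   \int[nu j i]_x (@l2dist R _ _ (X0 j) x (prod_coord j (Y i)) `^ p)%:E)%E.
  rewrite exchange_big/= ge0_sume_distrr; last first.
    by move=> j _; apply: sume_ge0 => i _; exact: integral_ge0.
  by apply: eq_bigr => j _; rewrite nuE.
rewrite muleCA lee_wpmul2l ?lee_fin// ge0_sume_distrr; last first.
  by move=> i _; apply: sume_ge0 => j _; exact: integral_ge0.
apply: lee_sum => i _.
have mdij j : measurable_fun setT
    ((fun x => (@l2dist R _ _ (X0 j) x (prod_coord j (Y i)) `^ p)%:E) : borel (S j) -> \bar R).
  apply/measurable_EFinP; apply: (measurableT_comp (measurable_powR p)).
  by apply: measurable_l2dist.
rewrite (eq_bigr (fun j => \int[m i]_x (@l2dist R _ _ (X0 j) (prod_coord j x)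
    (prod_coord j (Y i)) `^ p)%:E))%E; last first.
  move=> j _; rewrite -(@ge0_integral_image_probability _ _ _ _ _ (m i) _
    (@measurable_prod_coord R D d X X0 j)
    (fun x => (@l2dist R _ _ (X0 j) x (prod_coord j (Y i)) `^ p)%:E))//.
  by apply: eq_measure_integral => A mA _; exact/esym/mE.
have mdx j : measurable_fun setT ((fun x => (@l2dist R _ _ (X0 j) (prod_coord j x)
    (prod_coord j (Y i)) `^ p)%:E) : borel T -> \bar R).
  exact: measurableT_comp (mdij j) (measurable_prod_coord j).
rewrite -ge0_integral_sum//.
rewrite -ge0_integralZl//; [|exact: emeasurable_sum|].
- apply: ge0_le_integral => //.
  + exact: measurableT_comp md (mpair i).
  + by apply: measurable_funeM; exact: emeasurable_sum.
  + by move=> x _; rewrite sumEFin -EFinM lee_fin; exact: prod_l2dist_powR.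
- by move=> x _; apply: sume_ge0.
Qed.

End gluing.

(** * Risk and transport cost *)

Lemma sum_powR (R : realType) (n : nat) (a : 'I_n -> R) (p : R) :
  0 < p -> (forall i, 0 <= a i) ->
  (\sum_i a i) `^ p <= n%:R `^ p * \sum_i a i `^ p.
Proof.
case: n a => [|n] a p0 a0.
  by rewrite !big_ord0 mulr0 powR0// gt_eqF.
have [k kmax] : exists k, forall i, a i <= a k.
  have [k _ kP] := @arg_maxP _ R _ ord0 xpredT a isT.
  by exists k => i; exact: kP.
rewrite (@le_trans _ _ ((n.+1%:R * a k) `^ p))//.
  apply: ge0_ler_powR; rewrite ?nnegrE ?(ltW p0) ?mulr_ge0 ?sumr_ge0//.
  rewrite (le_trans (ler_sum _ (fun i _ => kmax i)))//.
  by rewrite sumr_const card_ord -[leLHS]mulr_natl.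
rewrite powRM// ler_wpM2l ?powR_ge0// (bigD1 k)//= lerDl.
by apply: sumr_ge0 => i _; exact: powR_ge0.
Qed.

Lemma powRD_le (R : realType) (x y p : R) : 0 < p -> 0 <= x -> 0 <= y ->
  (x + y) `^ p <= 2 `^ p * (x `^ p + y `^ p).
Proof.
move=> p0 x0 y0; have := @sum_powR R 2 (fun i => if i == ord0 then x else y) p p0.
by rewrite !big_ord_recl !big_ord0 /= !addr0; apply => i; case: ifP.
Qed.

Lemma powR_le_1D (R : realType) (x a b : R) : 0 <= x -> 0 <= a -> a <= b ->
  x `^ a <= 1 + x `^ b.
Proof.
move=> x0 a0 ab; have [x1|x1] := leP 1 x.
  by rewrite (@le_trans _ _ (x `^ b)) ?ler_powR// lerDr.
rewrite (@le_trans _ _ (1 `^ a))//; last by rewrite powR1 lerDl powR_ge0.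
by apply: ge0_ler_powR; rewrite ?nnegrE// ltW.
Qed.

Lemma continuous_bigsum (R : realType) (T : topologicalType) (I : Type)
    (s : seq I) (f : I -> T -> R) : (forall i, continuous (f i)) ->
  continuous (fun y => \sum_(i <- s) f i y).
Proof.
move=> cf; elim: s => [|i s IH].
  by under eq_fun do rewrite big_nil; exact: cst_continuous.
under eq_fun do rewrite big_cons; move=> y.
by apply: (@continuousD R R^o T (f i) (fun y => \sum_(j <- s) f j y));
  [exact: cf|exact: IH].
Qed.

Section hoelder.
Context (R : realType) (D : nat) (d : 'I_D -> nat)
  (X : forall j, set 'rV[R]_(d j)) (X0 : forall j, X j !=set0).
Local Notation T := (prod_space X0).
Local Notation S j := (subset_space (X0 j)).

Let continuous_sqrt (Z : topologicalType) (f : Z -> R) : continuous f ->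
  continuous (fun y => Num.sqrt (f y)).
Proof.
by move=> cf y; apply: (@continuous_comp Z R R f); [exact: cf|exact: sqrt_continuous].
Qed.

Let continuous_sqr (Z : topologicalType) (f : Z -> R) : continuous f ->
  continuous (fun y => f y ^+ 2).
Proof.
move=> cf y; under eq_fun do rewrite expr2.
by apply: continuousM; exact: cf.
Qed.

Lemma continuous_l2dist j (x : S j) : continuous (fun y : S j => l2dist x y).
Proof.
under eq_fun do rewrite l2distE; apply: continuous_sqrt.
apply: continuous_bigsum => i; apply: continuous_sqr => y.
by apply: (@continuousB R R^o (S j) (fun=> subset_coord i x) (subset_coord i));
  [exact: cst_continuous|exact: continuous_subset_coord].
Qed.

Lemma continuous_prod_l2dist (x : T) : continuous (fun y : T => prod_l2dist x y).
Proof.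
apply: continuous_sqrt; apply: continuous_bigsum => j; apply: continuous_sqr => y.
apply: (@continuous_comp T (S j) R (prod_coord j)
  (fun y : S j => l2dist (prod_coord j x) y)).
  exact: continuous_prod_coord.
exact: continuous_l2dist.
Qed.

Lemma prod_l2dist_ge0 (x y : T) : 0 <= prod_l2dist x y.
Proof. exact: sqrtr_ge0. Qed.

Lemma prod_l2dist_refl (x : T) : prod_l2dist x x = 0.
Proof.
rewrite /prod_l2dist big1 ?sqrtr0// => j _; rewrite l2distE big1 ?sqrtr0 ?expr0n//.
by move=> i _; rewrite subrr expr0n.
Qed.

Lemma hoelder_continuousW (beta C : R) (c : T -> R) : 0 < beta ->
  (forall x y, `|c x - c y| <= C * prod_l2dist x y `^ beta) -> continuous c.
Proof.
move=> beta0 cC; suff cvx (x : T) : c y @[y --> x] --> c x by exact: cvx.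
have FF : Filter (nbhs x) := nbhs_filter x.
apply: (iffRL (@cvgrPdist_lt R R^o T (nbhs x) FF c (c x))) => e e0.
pose C' := `|C| + 1; have C'0 : 0 < C' by rewrite ltr_wpDl.
pose del := (e / C') `^ beta^-1.
have del0 : 0 < del by rewrite powR_gt0// divr_gt0.
have : \forall y \near x, `|prod_l2dist x x - prod_l2dist x y| < del.
  have h : prod_l2dist x y @[y --> x] --> prod_l2dist x x.
    exact: continuous_prod_l2dist.
  by move/(@cvgrPdist_lt R R^o T (nbhs x) FF) : h; exact.
apply: (@filterS _ _ FF) => y; rewrite prod_l2dist_refl sub0r normrN.
rewrite ger0_norm ?prod_l2dist_ge0// => xy.
apply: (le_lt_trans (cC x y)).
rewrite (@le_lt_trans _ _ (C' * prod_l2dist x y `^ beta))//.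
  rewrite ler_wpM2r ?powR_ge0// /C' (le_trans (ler_norm _))// lerDl//.
rewrite mulrC -ltr_pdivlMr//.
have -> : e / C' = del `^ beta.
  by rewrite /del -powRrM mulVf ?gt_eqF// powRr1// divr_ge0 ?ltW.
by apply: gt0_ltr_powR; rewrite ?nnegrE ?prod_l2dist_ge0 ?(ltW del0).
Qed.

Lemma hoelder_pos_const (beta : R) (c : T -> R) :
  hoelder_continuous (@prod_l2dist R D d X X0) beta c ->
  exists2 C, 0 < C & forall x y, `|c x - c y| <= C * prod_l2dist x y `^ beta.
Proof.
case=> C cC; exists (`|C| + 1); first by rewrite ltr_wpDl.
move=> x y; rewrite (le_trans (cC x y))// ler_wpM2r ?powR_ge0//.
by rewrite (le_trans (ler_norm _))// lerDl.
Qed.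

(** From (a - b)^2 <= 2 a^2 + 2 b^2 in each coordinate; the generous factor 2 inside the power
    avoids Minkowski's inequality. *)
Lemma l2dist_powR_le j (p : R) (x y : S j) : 0 < p ->
  l2dist x y `^ p <= (2 `^ p * 2 `^ p) * (l2norm (val x) `^ p + l2norm (val y) `^ p).
Proof.
move=> p0; have n0 (z : 'rV[R]_(d j)) : 0 <= l2norm z by exact: sqrtr_ge0.
rewrite -mulrA (@le_trans _ _ ((2 * (l2norm (val x) + l2norm (val y))) `^ p))//; last first.
  rewrite powRM ?addr_ge0// ler_wpM2l ?powR_ge0//.
  exact: powRD_le.
apply: ge0_ler_powR; rewrite ?nnegrE ?(ltW p0) ?mulr_ge0 ?addr_ge0//.
  exact: sqrtr_ge0.
set rhs := 2 * (_ + _); have rhs0 : 0 <= rhs by rewrite mulr_ge0 ?addr_ge0.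
rewrite -(ger0_norm rhs0) -sqrtr_sqr ler_wsqrtr// /rhs.
rewrite (@le_trans _ _ (2 * (\sum_i val x ord0 i ^+ 2) + 2 * (\sum_i val y ord0 i ^+ 2)))//.
  rewrite !mulr_sumr -big_split/=; apply: ler_sum => i _; rewrite !mxE.
  set a := val x _ _; set b := val y _ _; have := sqr_ge0 (a + b).
  by rewrite !expr2; nra.
have sq (z : 'rV[R]_(d j)) : \sum_i z ord0 i ^+ 2 = l2norm z ^+ 2.
  by rewrite sqr_sqrtr// sumr_ge0// => i _; exact: sqr_ge0.
rewrite !sq; have := n0 (val x); have := n0 (val y).
by set a := l2norm (val x); set b := l2norm (val y); rewrite !expr2; nra.
Qed.

Lemma integrable_l2dist_powR j (p : R) (mu : probability (borel (S j)) R) (a : S j) :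
  0 < p -> finite_moment p mu ->
  (\int[mu]_x (@l2dist R _ _ (X0 j) x a `^ p)%:E < +oo)%E.
Proof.
move=> p0 mom; set K : R := 2 `^ p * 2 `^ p.
have K0 : 0 <= K by rewrite mulr_ge0 ?powR_ge0.
have mn : measurable_fun setT
    ((fun x => (l2norm (val (x : S j)) `^ p)%:E) : borel (S j) -> \bar R).
  apply/measurable_EFinP; apply: (measurableT_comp (measurable_powR p)).
  apply: (measurableT_comp (@continuous_measurable_fun _ _ (@sqrt_continuous R))).
  by apply: measurable_sum => i; apply: measurable_funX; exact: measurable_subset_coord.
apply: (@le_lt_trans _ _ (\int[mu]_x (K%:E * ((l2norm (val (x : S j)) `^ p)%:E +
    (l2norm (val a) `^ p)%:E)))%E).
  apply: ge0_le_integral => //.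
  - by move=> x _; rewrite lee_fin powR_ge0.
  - apply/measurable_EFinP; apply: (measurableT_comp (measurable_powR p)).
    exact: measurable_l2dist.
  - by apply: measurable_funeM; exact: emeasurable_funD.
  - by move=> x _; rewrite -EFinD -EFinM lee_fin; exact: l2dist_powR_le.
rewrite ge0_integralZl//; last first.
- by move=> x _; rewrite -EFinD lee_fin addr_ge0 ?powR_ge0.
- exact: emeasurable_funD.
rewrite ge0_integralD//; last 2 first.
- by move=> x _; rewrite lee_fin powR_ge0.
- by move=> x _; rewrite lee_fin powR_ge0.
rewrite integral_cst// [X in (_ + _ * X)%E](_ : _ = 1%E) ?mule1; last first.
  exact: probability_setT.
by rewrite lte_mul_pinfty ?lee_fin// lte_add_pinfty ?ltry.
Qed.

End hoelder.

(** Couplings and empirical representations identify measures on measurable sets only; half-lines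
    are all that the quantile sees. *)
Lemma eq_spectral_risk (R : realType) (alpha : R -> R) (mu nu : set R -> \bar R) :
  (forall x, mu `]-oo, x]%classic = nu `]-oo, x]%classic) ->
  spectral_risk alpha mu = spectral_risk alpha nu.
Proof.
move=> munu; rewrite /spectral_risk; apply: eq_integral => t _.
rewrite /quantile; congr (inf _ * _)%:E.
by apply/seteqP; split => x /=; rewrite munu.
Qed.

Section couplings_theory.
Context (T : ptopologicalType) (R : realType).

Lemma coupling_integral1 (mu nu : {measure set (borel T) -> \bar R})
    (Pi : probability (borel T * borel T)%type R) (f : borel T -> \bar R) :
  couplings mu nu Pi -> measurable_fun setT f -> (forall x, (0 <= f x)%E) ->
  (\int[Pi]_z f z.1 = \int[mu]_x f x)%E.
Proof.
move=> cP mf f0; rewrite -(ge0_integral_image_probability Pi measurable_fst mf f0).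
by apply: eq_measure_integral => A mA _; have [<- _] := cP A mA.
Qed.

Lemma coupling_integral2 (mu nu : {measure set (borel T) -> \bar R})
    (Pi : probability (borel T * borel T)%type R) (f : borel T -> \bar R) :
  couplings mu nu Pi -> measurable_fun setT f -> (forall x, (0 <= f x)%E) ->
  (\int[Pi]_z f z.2 = \int[nu]_x f x)%E.
Proof.
move=> cP mf f0; rewrite -(ge0_integral_image_probability Pi measurable_snd mf f0).
by apply: eq_measure_integral => A mA _; have [_ <-] := cP A mA.
Qed.

End couplings_theory.

Lemma ge0_integral_empirical d (T : measurableType d) (R : realType) n
    (Y : 'I_n.+1 -> T) (f : T -> \bar R) :
  measurable_fun setT f -> (forall x, (0 <= f x)%E) ->
  (\int[empirical R Y]_x f x = n.+1%:R^-1%:E * \sum_(i < n.+1) f (Y i))%E.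
Proof.
move=> mf f0; have [M [ME MI]] := exists_average (fun i => dirac (Y i) : probability T R).
rewrite (eq_measure_integral M) ; last by move=> A mA _; exact/esym/ME.
by rewrite MI//; congr (_ * _)%E; apply: eq_bigr => i _; rewrite integral_dirac// diracT mul1e.
Qed.

Section hoelder_risk.
Context (R : realType) (D : nat) (d : 'I_D -> nat)
  (X : forall j, set 'rV[R]_(d j)) (X0 : forall j, X j !=set0).
Local Notation T := (prod_space X0).
Local Notation S j := (subset_space (X0 j)).
Context (p q r beta : R) (p_gt0 : 0 < p) (q_gt1 : 1 < q) (r_gt1 : 1 < r)
  (rq : r^-1 + q^-1 = 1) (beta_gt0 : 0 < beta) (beta_r : beta * r <= p)
  (alpha : R -> R)
  (alpha_spectral : spectral_function alpha) (alpha_Lq : in_Lq q alpha).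

Local Notation dist := (@prod_l2dist R D d X X0).

Let r_gt0 : 0 < r. Proof. exact: lt_trans r_gt1. Qed.

Let measurable_distp d' (W : measurableType d') (f g : W -> borel T) :
  measurable_fun setT f -> measurable_fun setT g ->
  measurable_fun setT (fun w => (dist (f w) (g w) `^ p)%:E).
Proof.
move=> mf mg; apply/measurable_EFinP; apply: (measurableT_comp (measurable_powR p)).
exact: measurable_prod_l2dist.
Qed.

(** |f x| is at most |f x0| + C dist^beta, whose r-th power is controlled by 1 + dist^p since beta r
    <= p. *)
Lemma hoelder_moment (mu : probability (borel T) R) (f : T -> R) (C : R) (x0 : T) :
  0 < C -> measurable_fun setT (f : borel T -> R) ->
  (forall x y, `|f x - f y| <= C * dist x y `^ beta) ->
  (\int[mu]_x (dist x x0 `^ p)%:E < +oo)%E ->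
  (\int[mu]_x (`|f x| `^ r)%:E < +oo)%E.
Proof.
move=> C0 mf fC mom.
pose A : R := 2 `^ r * (C `^ r + `|f x0| `^ r); pose B := 2 `^ r * C `^ r.
have A0 : 0 <= A by rewrite mulr_ge0 ?addr_ge0 ?powR_ge0.
have B0 : 0 <= B by rewrite mulr_ge0 ?powR_ge0.
have md : measurable_fun setT ((fun x => (dist x x0 `^ p)%:E) : borel T -> \bar R).
  exact: measurable_distp.
apply: (@le_lt_trans _ _ (\int[mu]_x (A%:E + B%:E * (dist x x0 `^ p)%:E))%E).
  apply: ge0_le_integral => //.
  - apply/measurable_EFinP; apply: (measurableT_comp (measurable_powR r)).
    exact: measurableT_comp.
  - by apply: emeasurable_funD => //; exact: measurable_funeM.
  - move=> x _; rewrite -EFinM -EFinD lee_fin.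
    apply: (@le_trans _ _ ((C * dist x x0 `^ beta + `|f x0|) `^ r)).
      apply: ge0_ler_powR; rewrite ?nnegrE ?(ltW r_gt0) ?addr_ge0 ?mulr_ge0 ?powR_ge0 ?(ltW C0)//.
      rewrite -[X in `|X|](subrK (f x0)) (le_trans (ler_normD _ _))// lerD2r.
      exact: fC.
    rewrite (le_trans (powRD_le _ _ _))// ?mulr_ge0 ?powR_ge0 ?(ltW C0)//.
    rewrite powRM ?powR_ge0 ?(ltW C0)// -powRrM.
    have := powR_le_1D (prod_l2dist_ge0 x x0) (mulr_ge0 (ltW beta_gt0) (ltW r_gt0)) beta_r.
    rewrite /A /B; set E := _ `^ (_ * _); set F := _ `^ p.
    have : 0 <= 2 `^ r * C `^ r by [].
    by set c1 := 2 `^ r; set c2 := C `^ r; set c3 := `|f x0| `^ r; nra.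
rewrite ge0_integralD//; last 2 first.
- by move=> x _; rewrite -EFinM lee_fin mulr_ge0 ?powR_ge0.
- exact: measurable_funeM.
rewrite ge0_integralZl//; last by move=> x _; rewrite lee_fin powR_ge0.
rewrite integral_cst// [X in (_ * X + _)%E](_ : _ = 1%E) ?mule1; last first.
  exact: probability_setT.
by rewrite lte_add_pinfty ?ltry// lte_mul_pinfty ?lee_fin.
Qed.

(** Both risks are read on the coupling space, where [spectral_risk_le] applies with k = C s^beta.
    The integrand f is arbitrary because the limit argument needs the bound for c and for its
    truncations, with one K. *)
Lemma hoelder_risk_le : exists2 K : R, 0 < K &
  forall (mu nu : probability (borel T) R) (Pi : probability (borel T * borel T)%type R)
    (f : T -> R) (C s : R), 0 < C -> 0 < s ->
  measurable_fun setT (f : borel T -> R) ->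
  (forall x y, `|f x - f y| <= C * dist x y `^ beta) ->
  couplings mu nu Pi ->
  (\int[Pi]_z (dist z.1 z.2 `^ p)%:E <= (s `^ p)%:E)%E ->
  (\int[mu]_x (`|f x| `^ r)%:E < +oo)%E ->
  (\int[nu]_x (`|f x| `^ r)%:E < +oo)%E ->
  (spectral_risk alpha (pushforward mu f) <=
     spectral_risk alpha (pushforward nu f) + (K * (C * s `^ beta))%:E)%E /\
  (spectral_risk alpha (pushforward nu f) <=
     spectral_risk alpha (pushforward mu f) + (K * (C * s `^ beta))%:E)%E.
Proof.
have [K K0 H] := spectral_risk_le r_gt1 q_gt1 rq alpha_spectral alpha_Lq.
exists K => // mu nu Pi f C s C0 s0 mf fC cP costP mom1 mom2.
have mf1 : measurable_fun setT ((f \o fst) : borel T * borel T -> R).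
  exact: (measurableT_comp mf measurable_fst).
have mf2 : measurable_fun setT ((f \o snd) : borel T * borel T -> R).
  exact: (measurableT_comp mf measurable_snd).
have mfr : measurable_fun setT ((fun x => (`|f x| `^ r)%:E) : borel T -> \bar R).
  apply/measurable_EFinP; apply: (measurableT_comp (measurable_powR r)).
  exact: measurableT_comp.
have f0 (x : T) : (0 <= (`|f x| `^ r)%:E)%E by rewrite lee_fin powR_ge0.
have R1 : spectral_risk alpha (pushforward mu f) =
    spectral_risk alpha (pushforward Pi (f \o fst)).
  apply: eq_spectral_risk => x; rewrite /pushforward.
  have /cP[+ _] : measurable ((f : borel T -> R) @^-1` `]-oo, x]).
    by rewrite -[X in measurable X]setTI; exact: mf.
  by move=> <-.
have R2 : spectral_risk alpha (pushforward nu f) =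
    spectral_risk alpha (pushforward Pi (f \o snd)).
  apply: eq_spectral_risk => x; rewrite /pushforward.
  have /cP[_ +] : measurable ((f : borel T -> R) @^-1` `]-oo, x]).
    by rewrite -[X in measurable X]setTI; exact: mf.
  by move=> <-.
have I1 : (\int[Pi]_z (`|(f \o fst) z| `^ r)%:E < +oo)%E.
  by rewrite (coupling_integral1 cP mfr).
have I2 : (\int[Pi]_z (`|(f \o snd) z| `^ r)%:E < +oo)%E.
  by rewrite (coupling_integral2 cP mfr).
have k0 : 0 < C * s `^ beta by rewrite mulr_gt0 ?powR_gt0.
have sp0 : 0 < s `^ p by rewrite powR_gt0.
have mdp : measurable_fun setT
    ((fun z => (dist z.1 z.2 `^ p)%:E) : borel T * borel T -> \bar R).
  by apply: measurable_distp; [exact: measurable_fst|exact: measurable_snd].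
(* (dist / s)^(beta r) <= 1 + (dist / s)^p, since beta r <= p *)
have key : (\int[Pi]_z ((`|(f \o fst) z - (f \o snd) z| / (C * s `^ beta)) `^ r)%:E
    <= 2%:E)%E.
  apply: (@le_trans _ _ (\int[Pi]_z (1 + (s `^ p)^-1%:E * (dist z.1 z.2 `^ p)%:E))%E).
    apply: ge0_le_integral => //.
    - by move=> z _; rewrite lee_fin powR_ge0.
    - apply/measurable_EFinP; apply: (measurableT_comp (measurable_powR r)).
      apply: measurable_funM => //; apply: measurableT_comp => //.
      exact: measurable_funB.
    - by apply: emeasurable_funD => //; exact: measurable_funeM.
    - move=> z _; rewrite -EFinM -EFinD lee_fin.
      pose t := dist z.1 z.2 / s.
      have t0 : 0 <= t by rewrite divr_ge0 ?prod_l2dist_ge0 ?(ltW s0).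
      have dt : dist z.1 z.2 = t * s by rewrite /t divfK// gt_eqF.
      rewrite dt powRM ?(ltW s0)// [_^-1 * _]mulrC mulfK ?gt_eqF//.
      apply: (@le_trans _ _ ((t `^ beta) `^ r)); last first.
        by rewrite -powRrM powR_le_1D// mulr_ge0 ?ltW.
      apply: ge0_ler_powR; rewrite ?nnegrE ?(ltW r_gt0) ?powR_ge0 ?divr_ge0 ?(ltW k0)//.
      rewrite ler_pdivrMr// (le_trans (fC _ _))// dt powRM ?(ltW s0)//.
      by rewrite mulrCA.
  rewrite ge0_integralD//; last 2 first.
  - by move=> z _; rewrite -EFinM lee_fin mulr_ge0 ?invr_ge0 ?powR_ge0.
  - exact: measurable_funeM.
  rewrite ge0_integralZl//; first last.
  - by rewrite lee_fin invr_ge0 powR_ge0.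
  - by move=> x _; rewrite lee_fin powR_ge0.
  rewrite integral_cst// [X in (_ * X + _)%E](_ : _ = 1%E) ?mule1; last first.
    exact: probability_setT.
  have -> : (2%:E = 1 + 1 :> \bar R)%E by rewrite -EFinD.
  rewrite leeD2l// (@le_trans _ _ ((s `^ p)^-1%:E * (s `^ p)%:E)%E)//.
    by rewrite lee_wpmul2l// lee_fin invr_ge0 powR_ge0.
  by rewrite -EFinM mulVf// gt_eqF.
rewrite R1 R2; split; first exact: (H _ _ Pi _ _ _ mf1 mf2 k0 I1 I2 key).
apply: (H _ _ Pi _ _ _ mf2 mf1 k0 I2 I1); apply: le_trans key.
by under eq_integral do rewrite distrC.
Qed.

(** The p-th power of the distance is dominated by a sum over coordinates, so its integral depends
    only on the marginals. *)
Lemma plans_moment (rho : forall j, probability (borel (S j)) R)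
    (gamma : probability (borel T) R) (x0 : T) :
  (forall j, finite_moment p (rho j)) -> plans rho gamma ->
  (\int[gamma]_x (dist x x0 `^ p)%:E < +oo)%E.
Proof.
move=> mom pg.
have ml j : measurable_fun setT ((fun x => (@l2dist R _ _ (X0 j) x (prod_coord j x0) `^ p)%:E)
    : borel (S j) -> \bar R).
  apply/measurable_EFinP; apply: (measurableT_comp (measurable_powR p)).
  exact: measurable_l2dist.
have mlj j : measurable_fun setT ((fun x => (@l2dist R _ _ (X0 j)
    (prod_coord j x) (prod_coord j x0) `^ p)%:E) : borel T -> \bar R).
  exact: (measurableT_comp (ml j) (measurable_prod_coord j)).
have l0 j (x y : S j) : (0 <= (l2dist x y `^ p)%:E)%E by rewrite lee_fin powR_ge0.
apply: (@le_lt_trans _ _ (\int[gamma]_x ((D%:R `^ p)%:E * \sum_(j < D)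
    (@l2dist R _ _ (X0 j) (prod_coord j x) (prod_coord j x0) `^ p)%:E))%E).
  apply: ge0_le_integral => //.
  - by move=> x _; rewrite lee_fin powR_ge0.
  - exact: measurable_distp.
  - by apply: measurable_funeM; exact: emeasurable_sum.
  - by move=> x _; rewrite sumEFin -EFinM lee_fin; exact: prod_l2dist_powR.
rewrite ge0_integralZl//; last 2 first.
- exact: emeasurable_sum.
- by move=> x _; exact: sume_ge0.
rewrite ge0_integral_sum//.
rewrite lte_mul_pinfty ?lee_fin ?powR_ge0// lte_sum_pinfty// => j _.
rewrite -(ge0_integral_image_probability gamma (measurable_prod_coord j) (ml j))//.
rewrite (eq_measure_integral (rho j)); last by move=> A mA _; exact: pg.
exact: integrable_l2dist_powR.
Qed.

Lemma empirical_moment n (Y : 'I_n.+1 -> borel T) (x0 : T) :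
  (\int[empirical R Y]_x (dist x x0 `^ p)%:E < +oo)%E.
Proof.
rewrite ge0_integral_empirical//.
- by rewrite sumEFin -EFinM ltry.
- exact: measurable_distp.
- by move=> x; rewrite lee_fin powR_ge0.
Qed.

End hoelder_risk.

(** * Weak limits and tails *)

Section lipschitz_uniqueness.
Context (R : realType) (n : nat) (A : set 'rV[R]_n) (A0 : A !=set0).
Local Notation S := (subset_space A0).

(* Comparable to [l2dist], but with an immediate triangle inequality. *)
Let l1 (x y : S) : R := \sum_i `|subset_coord i x - subset_coord i y|.

Let l1_ge0 x y : 0 <= l1 x y. Proof. exact: sumr_ge0. Qed.

Let l1_triangle x y z : l1 x z <= l1 x y + l1 y z.
Proof.
by rewrite /l1 -big_split/=; apply: ler_sum => i _; exact: ler_distD.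
Qed.

Let l1_le_l2 x y : l1 x y <= n%:R * l2dist x y.
Proof.
rewrite mulr_natl /l1 -[X in _ *+ X]card_ord -sumr_const; apply: ler_sum => i _.
rewrite l2distE -sqrtr_sqr ler_wsqrtr// (bigD1 i)//= lerDl.
by apply: sumr_ge0 => k _; exact: sqr_ge0.
Qed.

(** Distance to the complement of U. For U the whole space this is an infimum over the empty set,
    whence the nonemptiness assumption in the facts below. *)
Let psi (U : set S) (x : S) : R := inf [set l1 x y | y in ~` U].

Let has_inf_psi U x : (~` U) !=set0 -> has_inf [set l1 x y | y in ~` U].
Proof.
move=> [y Uy]; split; first by exists (l1 x y), y.
by exists 0 => _ [z _ <-].
Qed.

Let psi_ge0 U x : (~` U) !=set0 -> 0 <= psi U x.
Proof.
by move=> [y Uy]; apply: lb_le_inf; [exists (l1 x y), y|move=> _ [z _ <-]].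
Qed.

Let psi_lip U x y : (~` U) !=set0 -> psi U x <= psi U y + l1 x y.
Proof.
move=> U0; rewrite -lerBlDr; apply: lb_le_inf.
  by case: U0 => z Uz; exists (l1 y z), z.
move=> _ [z Uz <-]; rewrite lerBlDr addrC.
apply: le_trans (l1_triangle x y z); apply: ge_inf; last by exists z.
by case: (has_inf_psi x U0).
Qed.

Let psi_out U x : (~` U) x -> psi U x = 0.
Proof.
move=> Ux; apply/eqP; rewrite eq_le psi_ge0 ?andbT; last by exists x.
apply: ge_inf; first by case: (has_inf_psi x (ex_intro _ x Ux)).
by exists x => //; rewrite /l1 big1// => i _; rewrite subrr normr0.
Qed.

Let psi_in U x : open U -> (~` U) !=set0 -> U x -> 0 < psi U x.
Proof.
move=> oU [z0 Uz0] Ux; have : nbhs x U by exact: open_nbhs_nbhs.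
move=> /nbhs_subset_space[e e0 eU]; apply: (lt_le_trans e0).
apply: lb_le_inf; first by exists (l1 x z0), z0.
move=> _ [z Uz <-]; rewrite leNgt; apply/negP => xz; apply: Uz.
apply: eU => i; apply: le_lt_trans xz; rewrite /l1 (bigD1 i)//= lerDl.
exact: sumr_ge0.
Qed.

Lemma lipschitz_continuous (f : S -> R) (L : R) :
  (forall x y, `|f x - f y| <= L * l2dist x y) -> continuous f.
Proof.
move=> fL; suff cvx (x : S) : f y @[y --> x] --> f x by exact: cvx.
have FF : Filter (nbhs x) := nbhs_filter x.
apply: (iffRL (@cvgrPdist_lt R R^o S (nbhs x) FF f (f x))) => e e0.
have L0 : 0 < `|L| + 1 by rewrite ltr_wpDl.
have h : l2dist x y @[y --> x] --> l2dist x x.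
  (* [continuous_l2dist] is stated for a family of subsets; here it is used for the family with the
     single member A. *)
  exact: (@continuous_l2dist R 1 _ (fun=> A) (fun=> A0) ord0).
have : \forall y \near x, `|l2dist x x - l2dist x y| < e / (`|L| + 1).
  by move/(@cvgrPdist_lt R R^o S (nbhs x) FF) : h; apply; rewrite divr_gt0.
apply: (@filterS _ _ FF) => y.
have -> : l2dist x x = 0.
  by rewrite l2distE big1 ?sqrtr0// => i _; rewrite subrr expr0n.
rewrite sub0r normrN ger0_norm ?sqrtr_ge0// => xy.
rewrite (le_lt_trans (fL _ _))// (@le_lt_trans _ _ ((`|L| + 1) * l2dist x y))//.
  rewrite ler_wpM2r ?sqrtr_ge0//.
  by rewrite (le_trans (ler_norm _))// lerDl.
by rewrite mulrC -ltr_pdivlMr.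
Qed.

(** Lipschitz test functions are those whose integrals a small transport cost controls. They reach
    indicators of open sets, which are stable under intersection and generate the Borel sets. *)
Lemma lipschitz_probability_unique (mu nu : probability (borel S) R) :
  (forall (f : S -> R) L, 0 <= L -> (forall x, 0 <= f x <= 1) ->
    (forall x y, `|f x - f y| <= L * l2dist x y) ->
    (\int[mu]_x (f x)%:E = \int[nu]_x (f x)%:E)%E) ->
  forall B, measurable B -> mu B = nu B.
Proof.
move=> munu B mB.
apply: (@measure_unique _ R (borel S) (@open S) (fun=> setT)) => //.
- exact: openI.
- by move=> _; exact: openT.
- by rewrite bigcup_const.
- move=> U oU; have [U0|] := pselect ((~` U) !=set0); last first.
    move=> /set0P/negP; rewrite negbK => /eqP U0.
    rewrite -[U]setCK U0 setC0; transitivity (1%E : \bar R).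
      exact: probability_setT.
    exact/esym/probability_setT.
  (* Lipschitz functions increasing to the indicator of U *)
  pose f (k : nat) (x : S) := Num.min 1 (k%:R * psi U x).
  have f01 k x : 0 <= f k x <= 1.
    by rewrite /f le_min ler01 mulr_ge0 ?psi_ge0//= ge_min lexx.
  have fl k x y : f k x <= f k y + k%:R * n%:R * l2dist x y.
    have le1 : k%:R * psi U x <= k%:R * psi U y + k%:R * n%:R * l2dist x y.
      rewrite -mulrA -mulrDr ler_wpM2l// (le_trans (psi_lip x y U0))// lerD2l.
      exact: l1_le_l2.
    have g0 : 0 <= k%:R * n%:R * l2dist x y by rewrite !mulr_ge0 ?sqrtr_ge0.
    by rewrite /f; case: (leP 1 (k%:R * psi U y)) => h; rewrite ge_min;
      apply/orP; [left; rewrite lerDl|right].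
  have l2C (x y : S) : l2dist x y = l2dist y x.
    by rewrite !l2distE; congr Num.sqrt; apply: eq_bigr => i _; rewrite -sqrrN opprB.
  have fL k x y : `|f k x - f k y| <= k%:R * n%:R * l2dist x y.
    rewrite ler_norml lerBlDl fl andbT lerNl opprB lerBlDl.
    by rewrite l2C fl.
  have cf k : continuous (f k) := lipschitz_continuous (fL k).
  have lim (m : probability (borel S) R) :
      (\int[m]_x (f k x)%:E @[k --> \oo] --> m U)%E.
    have mU : measurable (U : set (borel S)) by exact: open_borel.
    have := @dominated_convergence _ (borel S) R m setT measurableT
      (fun k x => (f k x)%:E) (fun x => (\1_U x)%:E) (cst 1%E).
    rewrite integral_indic// setIT => h.
    have [] // := h.
    + by move=> k; apply/measurable_EFinP; exact: continuous_borelR.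
    + by apply/measurable_EFinP; exact: measurable_indic.
    + apply: aeW => x _; apply: cvg_near_cst.
      have [Ux|Ux] := pselect (U x); last first.
        apply: nearW => k; rewrite /f psi_out// mulr0 indicE memNset//.
        by rewrite min_r.
      have p0 := psi_in oU U0 Ux.
      have := nbhs_infty_ger (psi U x)^-1; apply: filterS => k hk.
      rewrite /f indicE mem_set// min_l//.
      by rewrite -ler_pdivrMr// div1r.
    + by apply: finite_measure_integrable_cst.
    + apply: aeW => x k _; rewrite lee_fin ger0_norm.
        by have /andP[] := f01 k x.
      by have /andP[] := f01 k x.
  have limmu := lim mu; have limnu := lim nu.
  rewrite (_ : (fun k => _) = (fun k => \int[nu]_x (f k x)%:E)%E) in limmu.
    exact: (cvg_unique _ limmu limnu).
  by apply/funext => k; apply: (munu _ (k%:R * n%:R)); rewrite ?mulr_ge0.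
- by move=> _; rewrite [X in (X < _)%E](_ : _ = 1%E) ?ltry//; exact: probability_setT.
Qed.

End lipschitz_uniqueness.

(** A continuous ramp of f, equal to 1 below s and to 0 above s', lies between the two indicators.
    The conclusion has the form that [spectral_risk_usc] asks for. *)
Lemma weak_cvg_cdf (T : ptopologicalType) (R : realType)
    (mu : nat -> probability (borel T) R) (nu : probability (borel T) R)
    (f : T -> R) (s s' e : R) : continuous f -> weak_cvg mu nu -> s < s' -> 0 < e ->
  \forall n \near \oo,
    (nu (f @^-1` `]-oo, s]) <= mu n (f @^-1` `]-oo, s']) + e%:E)%E.
Proof.
move=> cf wc ss' e0.
have ss0 : 0 < s' - s by rewrite subr_gt0.
pose h x : R := Num.max 0 (Num.min 1 ((s' - f x) / (s' - s))).
have h01 x : 0 <= h x <= 1.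
  by rewrite /h le_max lexx/= ge_max ler01/= ge_min lexx.
have ch : continuous h.
  move=> x; apply: (@continuous_max R T (fun=> 0)); first exact: cst_continuous.
  apply: (@continuous_min R T (fun=> 1)); first exact: cst_continuous.
  apply: (@continuousM R T (fun x => s' - f x) (fun=> (s' - s)^-1)); last exact: cst_continuous.
  by apply: (@continuousB R R^o T (fun=> s') f); [exact: cst_continuous|exact: cf].
have mf : measurable_fun setT (f : borel T -> R) by exact: continuous_borelR.
have mh : measurable_fun setT (h : borel T -> R) by exact: continuous_borelR.
have mpre a : measurable ((f : borel T -> R) @^-1` `]-oo, a]).
  by rewrite -[X in measurable X]setTI; exact: mf.
have lo (m : probability (borel T) R) :
    (m (f @^-1` `]-oo, s]%classic) <= \int[m]_x (h x)%:E)%E.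
  rewrite -[X in m X](setIT (f @^-1` `]-oo, s]%classic)) -integral_indic//.
  apply: ge0_le_integral => //.
  - by apply/measurable_EFinP; exact: measurable_indic.
  - exact/measurable_EFinP.
  - move=> x _; rewrite lee_fin indicE; case: (boolP (x \in _)) => [|_]; last first.
      by case/andP: (h01 x).
    rewrite inE /= in_itv/= => fs; rewrite /h le_max; apply/orP; right.
    by rewrite le_min lexx/= ler_pdivlMr// mul1r lerD2l lerN2.
have hi (m : probability (borel T) R) :
    (\int[m]_x (h x)%:E <= m (f @^-1` `]-oo, s']%classic))%E.
  rewrite -[X in m X](setIT (f @^-1` `]-oo, s']%classic)) -integral_indic//.
  apply: ge0_le_integral => //.
  - by move=> x _; rewrite lee_fin; case/andP: (h01 x).
  - exact/measurable_EFinP.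
  - by apply/measurable_EFinP; exact: measurable_indic.
  - move=> x _; rewrite lee_fin indicE; case: (boolP (x \in _)) => [_|].
      by case/andP: (h01 x).
    rewrite notin_setE /= in_itv/= => /negP; rewrite -ltNge => fs.
    rewrite /h max_l// ge_min; apply/orP; right.
    by rewrite pmulr_lle0 ?invr_gt0// subr_le0 ltW.
have hb : exists M, forall x, `|h x| <= M.
  by exists 1 => x; case/andP: (h01 x) => h0 h1; rewrite ger0_norm.
have fin : (\int[nu]_x (h x)%:E)%E \is a fin_num.
  rewrite ge0_fin_numE.
    exact: le_lt_trans (hi nu) (le_lt_trans (probability_le1 nu (mpre s')) (ltry _)).
  by apply: integral_ge0 => x _; rewrite lee_fin; case/andP: (h01 x).
have := wc h ch hb; rewrite -(fineK fin) => /fine_cvgP[nf /cvgrPdist_le /(_ e e0)].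
move: nf; apply: filterS2 => n nf; rewrite ler_norml => /andP[_ ne].
apply: (le_trans (lo nu)); apply: (@le_trans _ _ (\int[mu n]_x (h x)%:E + e%:E)%E).
  by rewrite -(fineK fin) -(fineK nf) -EFinD lee_fin -lerBlDl.
by rewrite leeD2r.
Qed.

Section limit_plans.
Context (R : realType) (D : nat) (d : 'I_D -> nat)
  (X : forall j, set 'rV[R]_(d j)) (X0 : forall j, X j !=set0).
Local Notation T := (prod_space X0).
Local Notation S j := (subset_space (X0 j)).
Local Notation dist := (@prod_l2dist R D d X X0).

Lemma l2dist_le_prod_l2dist j (x y : T) :
  l2dist (prod_coord j x) (prod_coord j y) <= dist x y.
Proof.
rewrite -[leLHS]ger0_norm ?sqrtr_ge0// -sqrtr_sqr ler_wsqrtr//.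
rewrite (bigD1 j)//= lerDl.
by apply: sumr_ge0 => k _; exact: sqr_ge0.
Qed.

(** The inequality t <= 1 + t^p for t = dist / s stands in for Jensen's, at the price of the factor
    2. *)
Lemma coupling_dist_le (p s : R) (Pi : probability (borel T * borel T)%type R) :
  1 <= p -> 0 < s ->
  (\int[Pi]_z (dist z.1 z.2 `^ p)%:E <= (s `^ p)%:E)%E ->
  (\int[Pi]_z (dist z.1 z.2)%:E <= (2 * s)%:E)%E.
Proof.
move=> p1 s0 costP.
have sp0 : 0 < s `^ p by rewrite powR_gt0.
have md : measurable_fun setT ((fun z => dist z.1 z.2) : borel T * borel T -> R).
  by apply: measurable_prod_l2dist; [exact: measurable_fst|exact: measurable_snd].
have mdp : measurable_fun setT
    ((fun z => (dist z.1 z.2 `^ p)%:E) : borel T * borel T -> \bar R).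
  by apply/measurable_EFinP; apply: (measurableT_comp (measurable_powR p)).
apply: (@le_trans _ _ (\int[Pi]_z (s%:E + (s / s `^ p)%:E * (dist z.1 z.2 `^ p)%:E))%E).
  apply: ge0_le_integral => //.
  - by move=> z _; rewrite lee_fin prod_l2dist_ge0.
  - exact/measurable_EFinP.
  - by apply: emeasurable_funD => //; exact: measurable_funeM.
  - move=> z _; rewrite -EFinM -EFinD lee_fin.
    pose t := dist z.1 z.2 / s.
    have t0 : 0 <= t by rewrite divr_ge0 ?prod_l2dist_ge0 ?(ltW s0).
    have dt : dist z.1 z.2 = t * s by rewrite /t divfK// gt_eqF.
    rewrite dt powRM ?(ltW s0)// (_ : s / _ * _ = s * t `^ p); last first.
      by rewrite mulrAC mulrA mulfK// gt_eqF.
    have := @powR_le_1D R t 1 p t0 ler01 p1; rewrite powRr1// => h.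
    by rewrite mulrC -[X in X + _]mulr1 -mulrDr ler_pM2l.
rewrite ge0_integralD//; last 3 first.
- by move=> z _; rewrite lee_fin ltW.
- by move=> z _; rewrite -EFinM lee_fin mulr_ge0 ?divr_ge0 ?powR_ge0 ?ltW.
- exact: measurable_funeM.
rewrite ge0_integralZl//; last 2 first.
- by move=> x _; rewrite lee_fin powR_ge0.
- by rewrite lee_fin divr_ge0 ?powR_ge0 ?ltW.
rewrite integral_cst// [X in (_ * X + _)%E](_ : _ = 1%E) ?mule1; last first.
  exact: probability_setT.
have -> : ((2 * s)%:E = s%:E + s%:E :> \bar R)%E by rewrite -EFinD mulr2n mulrDl !mul1r.
rewrite leeD2l// (@le_trans _ _ ((s / s `^ p)%:E * (s `^ p)%:E)%E)//.
  by rewrite lee_wpmul2l// lee_fin divr_ge0 ?powR_ge0 ?ltW.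
by rewrite -EFinM divfK// gt_eqF.
Qed.

(** For an L-Lipschitz f of the j-th coordinate, the integrals against gam n and del n differ by at
    most 2 L s n. The former is constantly the integral against rho j and the latter converges to
    that against the limit, so the j-th marginal of the limit is rho j. *)
Lemma limit_plans (p : R) (rho : forall j, probability (borel (S j)) R)
    (gam del : nat -> probability (borel T) R) (lim : probability (borel T) R)
    (Pi : nat -> probability (borel T * borel T)%type R) (s : nat -> R) :
  1 <= p -> (forall n, plans rho (gam n)) ->
  (forall n, couplings (gam n) (del n) (Pi n)) -> (forall n, 0 < s n) ->
  (forall n, (\int[Pi n]_z (dist z.1 z.2 `^ p)%:E <= (s n `^ p)%:E)%E) ->
  s n @[n --> \oo] --> 0 -> weak_cvg del lim -> plans rho lim.
Proof.
move=> p1 gp cP s0 costP slim wc j A mA.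
suff : image_probability lim (measurable_prod_coord j) A = rho j A by [].
move: A mA; apply: lipschitz_probability_unique => f L L0 f01 fL.
have f0 x : (0 <= (f x)%:E)%E by rewrite lee_fin; case/andP: (f01 x).
have cf : continuous f by exact: lipschitz_continuous fL.
have mf : measurable_fun setT ((EFin \o f) : borel (S j) -> \bar R).
  by apply/measurable_EFinP; exact: continuous_borelR.
have cfj : continuous (fun x : T => f (prod_coord j x)).
  move=> x; apply: (@continuous_comp T (S j) R (prod_coord j) f).
    exact: continuous_prod_coord.
  exact: cf.
have mfj : measurable_fun setT ((fun x : T => (f (prod_coord j x))%:E) : borel T -> \bar R).
  by apply/measurable_EFinP; exact: continuous_borelR.
rewrite (ge0_integral_image_probability lim (measurable_prod_coord j) mf f0)/=.
have rhoE n : (\int[gam n]_x (f (prod_coord j x))%:E = \int[rho j]_x (f x)%:E)%E.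
  rewrite -(ge0_integral_image_probability (gam n) (measurable_prod_coord j) mf f0).
  by apply: eq_measure_integral => A mA _; exact: gp.
have md : measurable_fun setT ((fun z => (dist z.1 z.2)%:E) : borel T * borel T -> \bar R).
  apply/measurable_EFinP.
  by apply: measurable_prod_l2dist; [exact: measurable_fst|exact: measurable_snd].
have cmp n (g1 g2 : borel T * borel T -> \bar R) :
    measurable_fun setT g1 -> measurable_fun setT g2 ->
    (forall z, (0 <= g1 z)%E) -> (forall z, (0 <= g2 z)%E) ->
    (forall z, (g1 z <= g2 z + L%:E * (dist z.1 z.2)%:E)%E) ->
    (\int[Pi n]_z g1 z <= \int[Pi n]_z g2 z + (L * (2 * s n))%:E)%E.
  move=> mg1 mg2 g10 g20 g12.
  apply: (@le_trans _ _ (\int[Pi n]_z (g2 z + L%:E * (dist z.1 z.2)%:E))%E).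
    apply: ge0_le_integral => //.
    by apply: emeasurable_funD => //; exact: measurable_funeM.
  rewrite ge0_integralD//; last 2 first.
  - by move=> z _; rewrite mule_ge0 ?lee_fin ?prod_l2dist_ge0.
  - exact: measurable_funeM.
  rewrite leeD2l// ge0_integralZl//; last by move=> z _; rewrite lee_fin prod_l2dist_ge0.
  by rewrite EFinM lee_wpmul2l ?lee_fin//; exact: (coupling_dist_le p1 (s0 n) (costP n)).
have mf1 : measurable_fun setT
    ((fun z => (f (prod_coord j z.1))%:E) : borel T * borel T -> \bar R).
  exact: (measurableT_comp mfj measurable_fst).
have mf2 : measurable_fun setT
    ((fun z => (f (prod_coord j z.2))%:E) : borel T * borel T -> \bar R).
  exact: (measurableT_comp mfj measurable_snd).
have fLd (x y : T) : f (prod_coord j x) <= f (prod_coord j y) + L * dist x y.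
  have := fL (prod_coord j x) (prod_coord j y); rewrite ler_norml => /andP[_].
  rewrite lerBlDl => /le_trans; apply; rewrite lerD2l ler_wpM2l//.
  exact: l2dist_le_prod_l2dist.
have distC (x y : T) : dist x y = dist y x.
  rewrite /prod_l2dist; congr Num.sqrt; apply: eq_bigr => i _; congr (_ ^+ 2).
  by rewrite !l2distE; congr Num.sqrt; apply: eq_bigr => k _; rewrite -sqrrN opprB.
have le1 n : (\int[rho j]_x (f x)%:E <=
    \int[del n]_x (f (prod_coord j x))%:E + (L * (2 * s n))%:E)%E.
  rewrite -(rhoE n) -(coupling_integral1 (cP n) mfj)// -(coupling_integral2 (cP n) mfj)//.
  by apply: cmp => // z; rewrite -EFinM -EFinD lee_fin.
have le2 n : (\int[del n]_x (f (prod_coord j x))%:E <=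
    \int[rho j]_x (f x)%:E + (L * (2 * s n))%:E)%E.
  rewrite -(rhoE n) -(coupling_integral1 (cP n) mfj)// -(coupling_integral2 (cP n) mfj)//.
  by apply: cmp => // z; rewrite -EFinM -EFinD lee_fin distC.
have hb : exists M, forall x : T, `|f (prod_coord j x)| <= M.
  by exists 1 => x; case/andP: (f01 (prod_coord j x)) => ? ?; rewrite ger0_norm.
have wcf := wc _ cfj hb.
have small e : 0 < e -> \forall n \near \oo, L * (2 * s n) <= e.
  move=> e0; have L1 : 0 < 2 * L + 1 by rewrite ltr_wpDl// mulr_ge0.
  have d0 : 0 < e / (2 * L + 1) by exact: divr_gt0.
  have : \forall n \near \oo, s n <= e / (2 * L + 1) by apply: (cvgr_le _ slim).
  apply: filterS => n sn.
  rewrite mulrA [L * 2]mulrC (@le_trans _ _ ((2 * L + 1) * s n))//.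
    by rewrite ler_wpM2r ?(ltW (s0 n))// lerDl.
  by rewrite mulrC -ler_pdivlMr.
apply/eqP; rewrite eq_le; apply/andP; split; apply/lee_addgt0Pr => e e0.
- apply: cvge_le wcf; have := small e e0; apply: filterS => n sn.
  by apply: (le_trans (le2 n)); rewrite leeD2l// lee_fin.
- rewrite -leeBlDr//; apply: cvge_ge wcf; have := small e e0; apply: filterS => n sn.
  by rewrite leeBlDr//; apply: (le_trans (le1 n)); rewrite leeD2l// lee_fin.
Qed.

End limit_plans.

(** * Truncation and uniform tails *)

Section clamp.
Context (R : realType).
Implicit Types M x y : R.

Definition clamp M x : R := Num.max (- M) (Num.min M x).

Lemma clamp_bounded M x : 0 <= M -> `|clamp M x| <= M.
Proof.
move=> M0; rewrite ler_norml /clamp le_max lexx/= ge_max ge_min lexx/= andbT.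
by rewrite (le_trans _ M0)// oppr_le0.
Qed.

(** Since truncation is 1-Lipschitz, the truncations of c keep its Hölder constant. *)
Lemma clamp_dist M x y : `|clamp M x - clamp M y| <= `|x - y|.
Proof.
wlog xy : x y / x <= y => [h|].
  by have [/h//|/ltW/h] := leP x y; rewrite distrC (distrC x).
rewrite [leRHS]distrC [leLHS]distrC [leRHS]ger0_norm ?subr_ge0//.
rewrite /clamp; case: (leP M x) => Mx; case: (leP M y) => My;
  do 2?[case: (leP (- M) _) => ?]; rewrite ler_norml; apply/andP; split; lra.
Qed.

Lemma clamp_tail M x : `|x - clamp M x| <= Num.max (`|x| - M) 0.
Proof.
rewrite /clamp; case: (leP M x) => Mx; case: (leP (- M) _) => MM;
  case: (leP 0 x) => x0; rewrite ?(ger0_norm x0) ?(ltr0_norm x0) le_max;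
  rewrite ?ler_norml; lra.
Qed.

Lemma continuous_clamp M (T : topologicalType) (f : T -> R) :
  continuous f -> continuous (fun t => clamp M (f t)).
Proof.
move=> cf x; apply: (@continuous_max R T (fun=> - M)); first exact: cst_continuous.
by apply: (@continuous_min R T (fun=> M)); [exact: cst_continuous|exact: cf].
Qed.

End clamp.

Section tails.
Context (R : realType) (D : nat) (d : 'I_D -> nat)
  (X : forall j, set 'rV[R]_(d j)) (X0 : forall j, X j !=set0).
Local Notation T := (prod_space X0).
Local Notation S j := (subset_space (X0 j)).
Local Notation dist := (@prod_l2dist R D d X X0).

(** Giving each summand the share m of the threshold leaves functions of one coordinate each. *)
Let sum_excess (n : nat) (a : 'I_n -> R) (A m : R) :
  Num.max (A + \sum_i a i - (A + n%:R * m)) 0 <= \sum_i Num.max (a i - m) 0.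
Proof.
rewrite ge_max sumr_ge0 ?andbT; last by move=> i _; rewrite le_max lexx orbT.
rewrite opprD addrACA subrr add0r mulr_natl -[X in _ *+ X]card_ord -sumr_const -sumrB.
by apply: ler_sum => i _; rewrite le_max lexx.
Qed.

(* The tail is dominated by a sum of functions of single coordinates, whose integrals depend
   only on the marginals. *)
Lemma plans_tail (p r beta C : R) (rho : forall j, probability (borel (S j)) R)
    (c : T -> R) (e : R) :
  0 < p -> 0 < r -> 0 < beta -> beta * r <= p -> 0 < C ->
  (forall x y, `|c x - c y| <= C * dist x y `^ beta) ->
  (forall j, finite_moment p (rho j)) -> 0 < e ->
  exists2 M, 0 <= M & forall gamma, plans rho gamma ->
    (\int[gamma]_x (`|c x - clamp M (c x)| `^ r)%:E <= e%:E)%E.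
Proof.
move=> p0 r0 b0 br C0 cC mom e0.
pose x0 : T := point; pose A := `|c x0|; pose B := C * D%:R `^ beta.
have B0 : 0 <= B by rewrite mulr_ge0 ?powR_ge0 ?ltW.
pose a j (y : S j) := B * l2dist y (prod_coord j x0) `^ beta.
pose g j (m : nat) (y : S j) : R := Num.max (a j y - m%:R) 0 `^ r.
have g0 j m y : 0 <= g j m y by exact: powR_ge0.
have ma j : measurable_fun setT (a j : borel (S j) -> R).
  apply: measurable_funM => //; apply: (measurableT_comp (measurable_powR beta)).
  exact: measurable_l2dist.
have mg j m : measurable_fun setT ((fun y => (g j m y)%:E) : borel (S j) -> \bar R).
  apply/measurable_EFinP; apply: (measurableT_comp (measurable_powR r)).
  by apply: measurable_maxr => //; exact: measurable_funB.
pose G j (y : S j) : \bar R := ((B `^ r)%:E * (1 + (l2dist y (prod_coord j x0) `^ p)%:E))%E.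
have ml j : measurable_fun setT
    ((fun y => (@l2dist R _ _ (X0 j) y (prod_coord j x0) `^ p)%:E) : borel (S j) -> \bar R).
  apply/measurable_EFinP; apply: (measurableT_comp (measurable_powR p)).
  exact: measurable_l2dist.
have gG j m y : g j m y <= B `^ r * (1 + l2dist y (prod_coord j x0) `^ p).
  have l0 : 0 <= l2dist y (prod_coord j x0) by exact: sqrtr_ge0.
  have a0 : 0 <= a j y by rewrite mulr_ge0 ?B0 ?powR_ge0.
  apply: (@le_trans _ _ (a j y `^ r)).
    apply: ge0_ler_powR; rewrite ?nnegrE ?(ltW r0)//.
      by rewrite le_max lexx orbT.
    by rewrite ge_max a0 andbT lerBlDr lerDl.
  rewrite powRM ?powR_ge0// -powRrM ler_wpM2l ?powR_ge0// powR_le_1D//.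
  by rewrite mulr_ge0 ?ltW.
have iG j : (rho j).-integrable setT (G j : borel (S j) -> \bar R).
  apply: integrableZl => //; apply: integrableD => //.
    by apply: finite_measure_integrable_cst.
  apply/integrableP; split; first exact: ml.
  under eq_integral do rewrite gee0_abs ?lee_fin ?powR_ge0//.
  exact: integrable_l2dist_powR.
have glim j : (\int[rho j]_y (g j m y)%:E @[m --> \oo] --> 0)%E.
  have := @dominated_convergence _ (borel (S j)) R (rho j) setT measurableT
      (fun m y => (g j m y)%:E) (cst 0%E) (G j).
  rewrite integral0 => h; have [] // := h.
  - apply: aeW => y _; apply: cvg_near_cst.
    have := nbhs_infty_ger (a j y); apply: filterS => m am.
    by rewrite /g max_r ?subr_le0// powR0// gt_eqF.
  - by apply: aeW => y m _; rewrite gee0_abs ?lee_fin.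
(* There are D coordinates, each contributing at most Dr e'; the 1 keeps the denominator positive
   when D = 0. *)
pose Dr : R := D%:R `^ r; pose e' := e / (Dr * D%:R + 1).
have Dr0 : 0 <= Dr by rewrite powR_ge0.
have K0 : 0 < Dr * D%:R + 1 by rewrite ltr_wpDl// mulr_ge0.
have e'0 : 0 < e' by rewrite divr_gt0.
have gnear j : \forall m \near \oo, (\int[rho j]_y (g j m y)%:E <= e'%:E)%E.
  have /fine_cvgP[nf /cvgrPdist_le/(_ e' e'0)] := glim j.
  move: nf; apply: filterS2 => m fin; rewrite sub0r normrN => fe.
  by rewrite -(fineK fin) lee_fin (le_trans (ler_norm _)).
have /filter_ex[m gm] : \forall m \near \oo, forall j,
    (\int[rho j]_y (g j m y)%:E <= e'%:E)%E.
  exact: filter_forall gnear.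
(* |c x| is at most A plus the sum of the a j, and each a j receives the threshold m. *)
exists (A + D%:R * m%:R); first by rewrite addr_ge0 ?mulr_ge0 ?normr_ge0.
move=> gamma gp.
have cc : continuous c by exact: (hoelder_continuousW b0 cC).
have mc : measurable_fun setT (c : borel T -> R) by exact: continuous_borelR.
have mcl M : measurable_fun setT ((fun x => clamp M (c x)) : borel T -> R).
  by apply: continuous_borelR; exact: continuous_clamp.
have mgj j : measurable_fun setT ((fun x : T => (g j m (prod_coord j x))%:E) : borel T -> \bar R).
  exact: (measurableT_comp (mg j m) (measurable_prod_coord j)).
apply: (@le_trans _ _ (\int[gamma]_x (Dr%:E * \sum_(j < D) (g j m (prod_coord j x))%:E))%E).
  apply: ge0_le_integral => //.
  - apply/measurable_EFinP; apply: (measurableT_comp (measurable_powR r)).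
    by apply: measurableT_comp => //; exact: measurable_funB.
  - by apply: measurable_funeM; exact: emeasurable_sum.
  - move=> x _; rewrite sumEFin -EFinM lee_fin.
    apply: le_trans (sum_powR r0 _); last by move=> j; rewrite le_max lexx orbT.
    apply: ge0_ler_powR; rewrite ?nnegrE ?(ltW r0)//.
      by apply: sumr_ge0 => j _; rewrite le_max lexx orbT.
    apply: (le_trans (clamp_tail _ _)); apply: le_trans (sum_excess _ A _).
    rewrite ge_max; apply/andP; split; last by rewrite le_max lexx orbT.
    rewrite le_max; apply/orP; left; rewrite lerB//.
    rewrite -[X in `|X|](subrK (c x0)) (le_trans (ler_normD _ _))// addrC lerD2l.
    rewrite (le_trans (cC _ _))// /a -mulr_sumr /B -mulrA ler_wpM2l ?(ltW C0)//.
    exact: prod_l2dist_powR.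
rewrite ge0_integralZl//; last 2 first.
- exact: emeasurable_sum.
- by move=> x _; apply: sume_ge0 => j _; rewrite lee_fin.
rewrite ge0_integral_sum//; last by move=> j x _; rewrite lee_fin.
apply: (@le_trans _ _ (Dr%:E * \sum_(j < D) e'%:E)%E).
  rewrite lee_wpmul2l ?lee_fin//; apply: lee_sum => j _.
  apply: le_trans (gm j).
  rewrite -(ge0_integral_image_probability gamma (measurable_prod_coord j) (mg j m))//.
    by rewrite (eq_measure_integral (rho j))// => V mV _; exact: gp.
  by move=> y; rewrite lee_fin.
rewrite sumEFin sumr_const card_ord -EFinM lee_fin -[e' *+ D]mulr_natr mulrCA.
have -> : e = e' * (Dr * D%:R + 1) by rewrite divfK// gt_eqF.
by rewrite ler_wpM2l ?(ltW e'0)// lerDl.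
Qed.

End tails.

(** * Upper and lower bounds *)

(** Beyond the point x0 where A = eta x0^(1 - th) the linear term dominates; up to x0 the left side
    is at most its value at x0, which is K. *)
Lemma powR_sublinear (R : realType) (th A eta : R) :
  0 < th -> th < 1 -> 0 <= A -> 0 < eta ->
  exists2 K, 0 <= K & forall x, 0 <= x -> A * x `^ th <= eta * x + K.
Proof.
move=> th0 th1 A0 eta0; pose x0 := (A / eta) `^ (1 - th)^-1.
have dth : 0 < 1 - th by rewrite subr_gt0.
have x00 : 0 <= x0 by exact: powR_ge0.
exists (A * x0 `^ th); first by rewrite mulr_ge0 ?powR_ge0.
move=> x xge0; have [xx0|x0x] := leP x x0.
  rewrite (@le_trans _ _ (A * x0 `^ th))//; last by rewrite lerDr mulr_ge0// ltW.
  by rewrite ler_wpM2l//; apply: ge0_ler_powR; rewrite ?nnegrE ?(ltW th0).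
have xgt0 : 0 < x by exact: le_lt_trans x0x.
rewrite (@le_trans _ _ (eta * x)) ?lerDl ?mulr_ge0 ?powR_ge0//.
have A_le : A <= eta * x `^ (1 - th).
  rewrite mulrC -ler_pdivrMr//.
  have -> : A / eta = x0 `^ (1 - th).
    by rewrite /x0 -powRrM mulVf ?gt_eqF// powRr1// divr_ge0// ltW.
  by apply: ge0_ler_powR; rewrite ?nnegrE ?(ltW x0x)// ltW.
rewrite (@le_trans _ _ (eta * x `^ (1 - th) * x `^ th))//.
  by rewrite ler_wpM2r ?powR_ge0.
rewrite -mulrA -powRD ?(gt_eqF xgt0) ?implybT//.
by rewrite subrK powRr1// ltW.
Qed.

(** * Wasserstein distance and nearly optimal couplings *)

Section wasserstein_theory.
Context (T : ptopologicalType) (R : realType) (dist : T -> T -> R) (p : R).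
Local Open Scope ereal_scope.

(** The p-th power of [wasserstein]: the penalty and all estimates are expressed in it, so that
    roots appear only in the final rate. *)
Definition transport_cost (mu nu : set (borel T) -> \bar R) : \bar R :=
  ereal_inf [set \int[pi]_z ((dist z.1 z.2) `^ p)%:E | pi in couplings mu nu].

Lemma transport_cost_ge0 mu nu : 0 <= transport_cost mu nu.
Proof.
apply: le_ereal_inf_tmp => _ [pi _ <-]; apply: integral_ge0 => z _.
by rewrite lee_fin powR_ge0.
Qed.

Lemma wasserstein_powR mu nu : (0 < p)%R ->
  wasserstein dist p mu nu `^ p = transport_cost mu nu.
Proof.
move=> p0; rewrite /wasserstein -/(transport_cost mu nu).
have := transport_cost_ge0 mu nu; case: (transport_cost mu nu) => [x| |]//.
- by rewrite lee_fin => x0; rewrite !poweR_EFin -powRrM mulVf ?gt_eqF// powRr1.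
- by move=> _; rewrite !poweRyr// ?invr_eq0 gt_eqF.
Qed.

Lemma wasserstein_le mu nu s : (0 < p)%R -> (0 <= s)%R ->
  transport_cost mu nu <= (s `^ p)%:E -> wasserstein dist p mu nu <= s%:E.
Proof.
move=> p0 s0; rewrite /wasserstein -/(transport_cost mu nu).
have := transport_cost_ge0 mu nu; case: (transport_cost mu nu) => [x| |]//.
rewrite !lee_fin => x0 xs.
have -> : (s = (s `^ p) `^ p^-1)%R by rewrite -powRrM mulfV ?gt_eqF// powRr1.
by apply: ge0_ler_powR; rewrite ?nnegrE ?powR_ge0 ?invr_ge0// ltW.
Qed.

Lemma eq_transport_cost mu nu nu' :
  (forall A, measurable A -> nu A = nu' A) ->
  transport_cost mu nu = transport_cost mu nu'.
Proof.
move=> nn; rewrite /transport_cost; congr (ereal_inf (_ @` _)).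
apply/seteqP; split => pi cpi A mA; have [h1 h2] := cpi A mA.
- by rewrite -nn.
- by rewrite nn.
Qed.

Lemma transport_cost_lt_coupling mu nu t : transport_cost mu nu < t ->
  exists2 pi, couplings mu nu pi & \int[pi]_z ((dist z.1 z.2) `^ p)%:E < t.
Proof. by move=> /ereal_inf_lt[_ [pi cpi <-]] lt; exists pi. Qed.

(** Two infima are involved, over point configurations and over couplings; the strict u < s yields a
    configuration and a coupling without assuming either to be attained. *)
Lemma quantization_error_coupling n nu (u s : R) : (0 < p)%R -> (u < s)%R ->
  quantization_error dist p n nu <= u%:E ->
  exists Y : 'I_n -> borel T, exists2 pi, couplings nu (empirical R Y) pi &
    \int[pi]_z ((dist z.1 z.2) `^ p)%:E <= (s `^ p)%:E.
Proof.
move=> p0 us /le_lt_trans /(_ (_ : u%:E < s%:E)); rewrite lte_fin => /(_ us).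
move=> /ereal_inf_lt[_ [Y _ <-]] Ws; exists Y.
have : transport_cost nu (empirical R Y) < (s `^ p)%:E.
  have W0 : 0 <= wasserstein dist p nu (empirical R Y) by exact: poweR_ge0.
  rewrite -wasserstein_powR//; move: Ws W0; case: (wasserstein _ _ _ _) => [w| |]//.
  rewrite !lte_fin lee_fin => ws w0.
  by apply: gt0_ltr_powR; rewrite ?nnegrE// (le_trans w0)// ltW.
by move=> /transport_cost_lt_coupling[pi cpi /ltW]; exists pi.
Qed.

End wasserstein_theory.

Lemma minval_minimizer (T : Type) (R : realType) (F : T -> \bar R) (x : T) :
  minimizer F x -> minval F = F x.
Proof.
move=> Fx; apply/eqP; rewrite eq_le; apply/andP; split.
  by apply: ereal_inf_lbound; exists x.
by apply: le_ereal_inf_tmp => _ [y _ <-]; exact: Fx.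
Qed.

Section marginal_couplings.
Context (R : realType) (D : nat) (d : 'I_D -> nat)
  (X : forall j, set 'rV[R]_(d j)) (X0 : forall j, X j !=set0).
Local Notation T := (prod_space X0).
Local Notation S j := (subset_space (X0 j)).

(** Projecting both ends of Pi to coordinate j gives an admissible coupling, and the projection does
    not increase distances. *)
Lemma transport_cost_marginal (p : R) (j : 'I_D) (mu nu : set (borel T) -> \bar R)
    (Pi : probability (borel T * borel T)%type R) : 0 < p ->
  couplings mu nu Pi ->
  (transport_cost (@l2dist R _ _ (X0 j)) p (marginal mu j) (marginal nu j) <=
   \int[Pi]_z (@prod_l2dist R D d X X0 z.1 z.2 `^ p)%:E)%E.
Proof.
move=> p0 cP.
pose phi (z : borel T * borel T) : borel (S j) * borel (S j) :=
  (prod_coord j z.1, prod_coord j z.2).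
have mphi : measurable_fun setT phi.
  apply: measurable_fun_pair.
  - exact: (measurableT_comp (measurable_prod_coord j) measurable_fst).
  - exact: (measurableT_comp (measurable_prod_coord j) measurable_snd).
have ml : measurable_fun setT
    ((fun z => (@l2dist R _ _ (X0 j) z.1 z.2 `^ p)%:E) : borel (S j) * borel (S j) -> \bar R).
  apply/measurable_EFinP; apply: (measurableT_comp (measurable_powR p)).
  by apply: measurable_l2dist; [exact: measurable_fst|exact: measurable_snd].
apply: (@le_trans _ _ (\int[image_probability Pi mphi]_z
    (@l2dist R _ _ (X0 j) z.1 z.2 `^ p)%:E)%E).
  apply: ereal_inf_lbound; exists (image_probability Pi mphi) => // A mA.
  have mjA : measurable ((prod_coord j : borel T -> borel (S j)) @^-1` A).
    by rewrite -[X in measurable X]setTI; exact: measurable_prod_coord.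
  by have [h1 h2] := cP _ mjA; split; [exact: h1|exact: h2].
have ge0 z : (0 <= (@l2dist R _ _ (X0 j) z.1 z.2 `^ p)%:E)%E by rewrite lee_fin powR_ge0.
rewrite (ge0_integral_image_probability Pi mphi ml ge0).
apply: ge0_le_integral => //.
- exact: (measurableT_comp ml mphi).
- apply/measurable_EFinP; apply: (measurableT_comp (measurable_powR p)).
  by apply: measurable_prod_l2dist; [exact: measurable_fst|exact: measurable_snd].
- move=> z _; rewrite lee_fin; apply: ge0_ler_powR; rewrite ?nnegrE ?(ltW p0) ?sqrtr_ge0//.
  exact: l2dist_le_prod_l2dist.
Qed.

End marginal_couplings.

(** * Comparison of the functionals and their minimizers *)

Section estimates.
Context (R : realType) (D : nat) (d : 'I_D -> nat)
  (X : forall j, set 'rV[R]_(d j)) (X0 : forall j, X j !=set0).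
Local Notation T := (prod_space X0).
Local Notation S j := (subset_space (X0 j)).
Local Notation dist := (@prod_l2dist R D d X X0).
Context (p q beta C : R) (p_ge1 : 1 <= p) (q_gt1 : 1 < q)
  (beta_gt0 : 0 < beta) (pq_beta : beta / p + 1 / q <= 1)
  (rho : forall j, probability (borel (S j)) R)
  (rho_moment : forall j, finite_moment p (rho j))
  (alpha : R -> R) (alpha_spectral : spectral_function alpha)
  (alpha_Lq : in_Lq q alpha)
  (c : T -> R) (C_gt0 : 0 < C)
  (cC : forall x y, `|c x - c y| <= C * dist x y `^ beta)
  (gamma_star : probability (borel T) R)
  (gamma_star_min : minimizer (Ffun rho alpha c) gamma_star).

Local Notation rk mu := (spectral_risk alpha (pushforward mu c)).
Local Notation cost_sum Y := (\sum_(j < D)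
  transport_cost (@l2dist R _ _ (X0 j)) p (rho j) (marginal (empirical R Y) j))%E.

Let r : R := q / (q - 1).

Let q_gt0 : 0 < q. Proof. exact: lt_trans q_gt1. Qed.
Let q1_gt0 : 0 < q - 1. Proof. by rewrite subr_gt0. Qed.
Let p_gt0 : 0 < p. Proof. exact: lt_le_trans p_ge1. Qed.
Let r_gt1 : 1 < r. Proof. by rewrite ltr_pdivlMr// mul1r ltrBlDr ltrDl. Qed.
Let r_gt0 : 0 < r. Proof. exact: lt_trans r_gt1. Qed.
Let rVE : r^-1 = 1 - q^-1.
Proof. by rewrite /r invf_div mulrBl mul1r divff// gt_eqF. Qed.
Let rq : r^-1 + q^-1 = 1. Proof. by rewrite rVE subrK. Qed.
Let beta_r : beta * r <= p.
Proof.
rewrite -ler_pdivlMr// mulrC -ler_pdivrMr// rVE lerBrDr -[q^-1]div1r.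
exact: pq_beta.
Qed.
Let th_gt0 : 0 < beta / p. Proof. by rewrite divr_gt0. Qed.
(** Strict since 1 / q > 0; [powR_sublinear] needs this strictness to absorb the gain in risk into
    the penalty. *)
Let th_lt1 : beta / p < 1.
Proof.
by apply: lt_le_trans pq_beta; rewrite ltrDl div1r invr_gt0.
Qed.

Let c_continuous : continuous c. Proof. exact: (hoelder_continuousW beta_gt0 cC). Qed.
Let mc : measurable_fun setT (c : borel T -> R). Proof. exact: continuous_borelR. Qed.

Lemma plans_nonempty : exists g : probability (borel T) R, plans rho g.
Proof. exact: exists_joint. Qed.

Let plans_cr g : plans rho g -> (\int[g]_x (`|c x| `^ r)%:E < +oo)%E.
Proof.
move=> pg; apply: (hoelder_moment (x0 := point) r_gt1 beta_gt0 beta_r C_gt0 mc cC).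
exact: plans_moment pg.
Qed.

Let empirical_cr n (Y : 'I_n.+1 -> borel T) :
  (\int[empirical R Y]_x (`|c x| `^ r)%:E < +oo)%E.
Proof.
apply: (hoelder_moment (x0 := point) r_gt1 beta_gt0 beta_r C_gt0 mc cC).
exact: empirical_moment.
Qed.

Lemma plans_risk_fin g : plans rho g -> rk g \is a fin_num.
Proof.
by move=> /plans_cr gr; exact: (spectral_risk_fin_num r_gt1 q_gt1 rq alpha_spectral alpha_Lq mc gr).
Qed.

Lemma empirical_risk_fin n (Y : 'I_n.+1 -> borel T) : rk (empirical R Y) \is a fin_num.
Proof.
exact: (spectral_risk_fin_num r_gt1 q_gt1 rq alpha_spectral alpha_Lq mc (empirical_cr Y)).
Qed.

(** [Ffun] is +oo off the plans, so a minimizer is a plan as soon as some plan has a finite value;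
    [exists_joint] provides a plan and its risk is finite. *)
Lemma minimizer_plans : plans rho gamma_star.
Proof.
have [g pg] := plans_nonempty; have := gamma_star_min g.
rewrite /Ffun (asboolT pg); case: asboolP => // _.
by rewrite leye_eq -(fineK (plans_risk_fin pg)).
Qed.

Lemma plans_risk_le g : plans rho g -> (rk g <= rk gamma_star)%E.
Proof.
move=> pg; have := gamma_star_min g.
by rewrite /Ffun (asboolT pg) (asboolT minimizer_plans) leeN2.
Qed.

Lemma minval_Ffun : minval (Ffun rho alpha c) = (- rk gamma_star)%E.
Proof.
by rewrite (minval_minimizer gamma_star_min) /Ffun (asboolT minimizer_plans).
Qed.

Lemma cost_sum_ge0 n (Y : 'I_n.+1 -> borel T) : (0 <= cost_sum Y)%E.
Proof. by apply: sume_ge0 => j _; exact: transport_cost_ge0. Qed.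

Lemma FNfun_empirical lambda n (Y : 'I_n.+1 -> borel T) :
  FNfun p rho alpha c lambda n.+1 (empirical R Y) =
  (- rk (empirical R Y) + lambda%:E * cost_sum Y)%E.
Proof.
rewrite /FNfun asboolT; last by exists Y.
by congr (_ + _ * _)%E; apply: eq_bigr => j _; rewrite wasserstein_powR.
Qed.

(** [uniform_points] fixes a measure on measurable sets only, so the risk and the marginals have to
    be transferred to [empirical R Y] itself. *)
Lemma FNfun_uniform lambda n (g : probability (borel T) R) :
  (FNfun p rho alpha c lambda n.+1 g < +oo)%E ->
  exists Y : 'I_n.+1 -> borel T,
    FNfun p rho alpha c lambda n.+1 g = FNfun p rho alpha c lambda n.+1 (empirical R Y).
Proof.
rewrite {1}/FNfun; case: asboolP => // -[Y gY] _; exists Y.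
rewrite FNfun_empirical /FNfun asboolT; last by exists Y.
congr (- _ + _ * _)%E.
  apply: eq_spectral_risk => x; rewrite /pushforward gY//.
  by rewrite -[X in measurable X]setTI; exact: mc.
apply: eq_bigr => j _; rewrite wasserstein_powR//; apply: eq_transport_cost => A mA.
rewrite /marginal /pushforward gY//.
by rewrite -[X in measurable X]setTI; exact: measurable_prod_coord.
Qed.

(** Each of the D couplings is optimal up to s^p, an infimum being possibly not attained. The last
    s^p keeps the bound positive even when D = 0. *)
Lemma near_plan n (Y : 'I_n.+1 -> borel T) (s V : R) : 0 < s ->
  (cost_sum Y <= V%:E)%E ->
  exists2 g, plans rho g & exists2 Pi, couplings g (empirical R Y) Pi &
    (\int[Pi]_z (dist z.1 z.2 `^ p)%:E <= (D%:R `^ p * (V + D%:R * s `^ p) + s `^ p)%:E)%E.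
Proof.
move=> s0 YV; have sp0 : 0 < s `^ p by exact: powR_gt0.
have tc_fin j : transport_cost (@l2dist R _ _ (X0 j)) p (rho j)
    (marginal (empirical R Y) j) \is a fin_num.
  rewrite ge0_fin_numE ?transport_cost_ge0//; apply: le_lt_trans (ltry V).
  apply: le_trans YV; rewrite (bigD1 j)//= leeDl// sume_ge0// => i _.
  exact: transport_cost_ge0.
have cpl j : exists pi, couplings (rho j) (marginal (empirical R Y) j) pi /\
    (\int[pi]_z (@l2dist R _ _ (X0 j) z.1 z.2 `^ p)%:E <=
     transport_cost (@l2dist R _ _ (X0 j)) p (rho j) (marginal (empirical R Y) j)
       + (s `^ p)%:E)%E.
  have : (transport_cost (@l2dist R _ _ (X0 j)) p (rho j) (marginal (empirical R Y) j) <
      transport_cost (@l2dist R _ _ (X0 j)) p (rho j) (marginal (empirical R Y) j)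
        + (s `^ p)%:E)%E by rewrite lteDl// lte_fin.
  by move=> /transport_cost_lt_coupling[pi cpi /ltW le]; exists pi.
pose pi j := projT1 (cid (cpl j)).
have [g [pg [Pi cPi PiV]]] := glue_couplings p_gt0 (fun j => (projT2 (cid (cpl j))).1).
exists g => //; exists Pi => //; apply: (le_trans PiV).
rewrite (@le_trans _ _ ((D%:R `^ p)%:E * (cost_sum Y + (D%:R * s `^ p)%:E))%E)//.
  rewrite lee_wpmul2l ?lee_fin ?powR_ge0//.
  have -> : ((D%:R * s `^ p)%:E = \sum_(j < D) (s `^ p)%:E :> \bar R)%E.
    by rewrite sumEFin sumr_const card_ord mulr_natl.
  rewrite -big_split/=; apply: lee_sum => j _; exact: (projT2 (cid (cpl j))).2.
rewrite [leRHS]EFinD [X in (_ <= X + _)%E]EFinM [X in (_ <= _ * X + _)%E]EFinD.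
rewrite (@le_trans _ _ ((D%:R `^ p)%:E * (V%:E + (D%:R * s `^ p)%:E))%E)//.
  by rewrite lee_wpmul2l ?lee_fin ?powR_ge0// leeD2r.
by rewrite leeDl// lee_fin ltW.
Qed.

(** The glued plan has risk at most that of gamma_star, and passing from it to the empirical measure
    costs a multiple of s^beta x^(beta/p), where x is affine in V / s^p. Sublinearity of x^(beta/p)
    trades this for half of the penalty plus a multiple of s^beta. *)
Lemma risk_empirical_le : exists2 K : R, 0 <= K &
  forall n (Y : 'I_n.+1 -> borel T) (s V : R), 0 < s -> 0 <= V ->
  (cost_sum Y <= V%:E)%E ->
  (rk (empirical R Y) <= rk gamma_star + (K * s `^ beta + s `^ (beta - p) * V / 2)%:E)%E.
Proof.
have [K K0 H] := hoelder_risk_le X0 q_gt1 r_gt1 rq beta_gt0 beta_r alpha_spectral alpha_Lq.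
pose Dp : R := D%:R `^ p; have Dp0 : 0 <= Dp by exact: powR_ge0.
(* Chosen so that eta Dp <= 1 / 2: the coefficient of V / s^p in eta x is then at most one half. *)
pose eta : R := (2 * (Dp + 1))^-1.
have eta0 : 0 < eta by rewrite invr_gt0 mulr_gt0// ltr_wpDl.
have KC0 : 0 <= K * C by rewrite mulr_ge0 ?ltW.
have [K3 K30 sub] := powR_sublinear th_gt0 th_lt1 KC0 eta0.
exists (eta * (Dp * D%:R + 1) + K3).
  by rewrite addr_ge0// mulr_ge0 ?(ltW eta0)// addr_ge0// mulr_ge0.
move=> n Y s V s0 V0 YV.
have [g pg [Pi cPi PiV]] := near_plan s0 YV.
have sp0 : 0 < s `^ p by exact: powR_gt0.
have sb0 : 0 < s `^ beta by exact: powR_gt0.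
(* The cost bound of [near_plan] divided by s^p, so that the effective distance is s x^(1/p). *)
pose x : R := Dp * (V / s `^ p + D%:R) + 1.
have x0 : 0 < x.
  by rewrite /x ltr_wpDl// mulr_ge0// addr_ge0// divr_ge0// ltW.
have tE : Dp * (V + D%:R * s `^ p) + s `^ p = (s * x `^ p^-1) `^ p.
  rewrite powRM ?powR_ge0 ?(ltW s0)// -powRrM mulVf ?gt_eqF// powRr1 ?(ltW x0)//.
  by rewrite /x; field; rewrite gt_eqF.
rewrite -/Dp tE in PiV.
have t0 : 0 < s * x `^ p^-1 by rewrite mulr_gt0// powR_gt0.
have [_ Hle] := H g (empirical R Y) Pi c C (s * x `^ p^-1) C_gt0 t0 mc cC cPi PiV
  (plans_cr pg) (empirical_cr Y).
apply: (le_trans Hle); apply: leeD; first exact: plans_risk_le.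
rewrite lee_fin powRM ?powR_ge0 ?(ltW s0)// -powRrM [p^-1 * _]mulrC.
have -> : K * (C * (s `^ beta * x `^ (beta / p))) = s `^ beta * (K * C * x `^ (beta / p)).
  by ring.
have := sub x (ltW x0) => /(ler_wpM2l (ltW sb0)) le1; apply: (le_trans le1).
have -> : s `^ (beta - p) = s `^ beta / s `^ p.
  by rewrite powRB// (gt_eqF s0) implybT.
have -> : (eta * (Dp * D%:R + 1) + K3) * s `^ beta + s `^ beta / s `^ p * V / 2 =
    s `^ beta * (eta * (Dp * D%:R + 1) + K3 + V / s `^ p / 2) by ring.
rewrite ler_wpM2l ?(ltW sb0)//.
have v0 : 0 <= V / s `^ p by rewrite divr_ge0 // ltW.
have eD : eta * Dp <= 1 / 2.
  rewrite /eta mulrC ler_pdivrMr ?mulr_gt0 ?ltr_wpDl//; lra.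
rewrite /x; set v := V / s `^ p in v0 *.
have := ler_wpM2r v0 eD; nra.
Qed.

(** Half of the penalty pays for the gain in risk; the other half is nonnegative and is dropped. *)
Lemma FNfun_ge : exists2 K : R, 0 <= K & forall n (s : R) (g : probability (borel T) R),
  0 < s ->
  (- rk gamma_star - (K * s `^ beta)%:E <= FNfun p rho alpha c (s `^ (- (p - beta))) n.+1 g)%E.
Proof.
have [K K0 H] := risk_empirical_le; exists K => // n s g s0.
have [lty|] := ltP (FNfun p rho alpha c (s `^ (- (p - beta))) n.+1 g) +oo%E; last first.
  by rewrite leye_eq => /eqP ->; rewrite leey.
have [Y ->] := FNfun_uniform lty.
rewrite FNfun_empirical opprB.
have lam0 : 0 < s `^ (beta - p) by exact: powR_gt0.
have fs := fineK (plans_risk_fin minimizer_plans).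
have fe := fineK (empirical_risk_fin Y).
have := cost_sum_ge0 Y; case E : (cost_sum Y) => [V| |]// V0.
  rewrite lee_fin in V0; have := H n Y s V s0 V0; rewrite E lexx => /(_ isT).
  rewrite -fs -fe -EFinD lee_fin => h.
  rewrite -EFinM -!EFinN -!EFinD lee_fin.
  have : 0 <= s `^ (beta - p) * V by rewrite mulr_ge0// ltW.
  by lra.
(* An infinite cost makes the functional +oo, as its weight is positive and the risk is finite. *)
by rewrite -fe gt0_muley ?lte_fin// addey// leey.
Qed.

(** A nearly optimal quantizer loses O(s^beta) in risk, and each of its D marginal costs is at most
    (2 s)^p, so the weight s^(beta - p) makes the penalty O(s^beta) too. *)
Lemma FNfun_le : exists2 K : R, 0 <= K & forall n (s : R), 0 < s ->
  (quantization_error dist p n.+1 gamma_star <= s%:E)%E ->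
  exists Y : 'I_n.+1 -> borel T,
  (FNfun p rho alpha c (s `^ (- (p - beta))) n.+1 (empirical R Y) <=
    - rk gamma_star + (K * s `^ beta)%:E)%E.
Proof.
have [K K0 H] := hoelder_risk_le X0 q_gt1 r_gt1 rq beta_gt0 beta_r alpha_spectral alpha_Lq.
exists (K * (C * 2 `^ beta) + D%:R * 2 `^ p).
  by rewrite addr_ge0// !mulr_ge0 ?powR_ge0 ?ltW.
move=> n s s0 qe.
(* Doubling s gives the strict inequality under which a quantizer and a coupling can be
   extracted. *)
have ss : s < 2 * s by rewrite ltr_pMl// ltr1n.
have s20 : 0 < 2 * s by rewrite mulr_gt0.
have [Y [Pi cPi PiV]] := quantization_error_coupling p_gt0 ss qe.
exists Y; rewrite FNfun_empirical opprB.
have [Hle _] := H gamma_star (empirical R Y) Pi c C (2 * s) C_gt0 s20 mc cC cPi PiV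
  (plans_cr minimizer_plans) (empirical_cr Y).
have cs : (cost_sum Y <= (D%:R * (2 * s) `^ p)%:E)%E.
  have -> : ((D%:R * (2 * s) `^ p)%:E = \sum_(j < D) ((2 * s) `^ p)%:E :> \bar R)%E.
    by rewrite sumEFin sumr_const card_ord mulr_natl.
  apply: lee_sum => j _; apply: le_trans PiV.
  apply: le_trans (transport_cost_marginal j p_gt0 cPi).
  rewrite le_eqVlt; apply/orP; left; apply/eqP.
  congr ereal_inf; apply/seteqP; split => _ [pi cpi <-]; exists pi => // A mA;
    have [h1 h2] := cpi A mA; split => //.
    by rewrite h1 minimizer_plans.
  by rewrite h1 minimizer_plans.
have fs := fineK (plans_risk_fin minimizer_plans).
have fe := fineK (empirical_risk_fin Y).
have lam0 : 0 < s `^ (beta - p) by exact: powR_gt0.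
rewrite (@le_trans _ _ (- rk (empirical R Y) +
   (s `^ (beta - p))%:E * (D%:R * (2 * s) `^ p)%:E)%E)//.
  by rewrite leeD2l// lee_wpmul2l// lee_fin ltW.
move: Hle; rewrite -fs -fe -EFinD lee_fin => h.
rewrite -EFinM -!EFinN -!EFinD lee_fin.
have -> : s `^ (beta - p) * (D%:R * (2 * s) `^ p) = D%:R * 2 `^ p * s `^ beta.
  rewrite powRM ?(ltW s0)// powRB ?(gt_eqF s0) ?implybT//.
  have : s `^ p != 0 by rewrite gt_eqF// powR_gt0.
  by move=> sp; field.
have : K * (C * (2 * s) `^ beta) = K * (C * 2 `^ beta) * s `^ beta.
  by rewrite powRM ?(ltW s0)//; ring.
by lra.
Qed.

(** Compare with the quantizer of [FNfun_le]: the whole penalty is at most K1 s^beta plus the gain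
    in risk, and the gain is at most K2 s^beta plus half of the penalty. Solving for the penalty
    gives the factor 2 (K1 + K2), and dividing by s^(beta - p) the power s^p. *)
Lemma minimizer_cost : exists2 K : R, 0 <= K &
  forall n (s : R) (Y : 'I_n.+1 -> borel T), 0 < s ->
  (quantization_error dist p n.+1 gamma_star <= s%:E)%E ->
  minimizer (FNfun p rho alpha c (s `^ (- (p - beta))) n.+1) (empirical R Y) ->
  (cost_sum Y <= (K * s `^ p)%:E)%E /\
  (rk gamma_star <= rk (empirical R Y) + (K * s `^ beta)%:E)%E.
Proof.
have [K1 K10 H1] := FNfun_le; have [K2 K20 H2] := risk_empirical_le.
exists (2 * (K1 + K2)); first by rewrite mulr_ge0// addr_ge0.
move=> n s Y s0 qe Ymin; have [Y' Y'le] := H1 n s s0 qe.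
have := le_trans (Ymin _) Y'le; rewrite FNfun_empirical opprB.
have fs := fineK (plans_risk_fin minimizer_plans).
have fe := fineK (empirical_risk_fin Y).
have lam0 : 0 < s `^ (beta - p) by exact: powR_gt0.
have sb0 : 0 < s `^ beta by exact: powR_gt0.
have := cost_sum_ge0 Y; case E : (cost_sum Y) => [V| |]// V0; last first.
  by rewrite -fe -fs gt0_muley ?lte_fin// addey// leye_eq.
rewrite lee_fin in V0; have := H2 n Y s V s0 V0; rewrite E lexx => /(_ isT).
rewrite -fs -fe -EFinD lee_fin => h.
rewrite -EFinM -!EFinN -!EFinD !lee_fin => h1.
have lV : 0 <= s `^ (beta - p) * V by rewrite mulr_ge0// ltW.
split.
  have : s `^ (beta - p) * V <= 2 * (K1 + K2) * s `^ beta by lra.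
  have -> : s `^ beta = s `^ (beta - p) * s `^ p.
    by rewrite -powRD ?subrK// (gt_eqF s0) implybT.
  by rewrite mulrCA ler_pM2l.
have : 0 <= K1 * s `^ beta by rewrite mulr_ge0// ltW.
have : 0 <= K2 * s `^ beta by rewrite mulr_ge0// ltW.
by lra.
Qed.

(** By [limit_plans] the limit is a plan, so it remains to show that its risk is at least that of
    gamma_star, up to any e. The comparison passes through the plans glued to the empirical
    measures, because the tail bound of [plans_tail] is uniform over plans. *)
Lemma limit_minimizer (u : nat -> R) (Y : forall n, 'I_n.+1 -> borel T)
    (phi : nat -> nat) (gamma : probability (borel T) R) :
  (forall n, 0 < u n) ->
  (forall n, (quantization_error dist p n.+1 gamma_star <= (u n)%:E)%E) ->
  (forall n, minimizer (FNfun p rho alpha c (u n `^ (- (p - beta))) n.+1)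
     (empirical R (Y n))) ->
  u n @[n --> \oo] --> 0 -> {homo phi : m n / (m < n)%N} ->
  weak_cvg ((fun n => empirical R (Y n) : probability (borel T) R) \o phi) gamma ->
  minimizer (Ffun rho alpha c) gamma.
Proof.
move=> u0 qe Ymin ulim phi_incr wc.
have [K K0 HK] := minimizer_cost.
(* With V = K (u n)^p and s = u n, the bound of [near_plan] is exactly B (u n)^p = (t n)^p. *)
pose B : R := D%:R `^ p * (K + D%:R) + 1.
have B0 : 0 < B by rewrite ltr_wpDl// mulr_ge0 ?powR_ge0// addr_ge0.
pose t n : R := B `^ p^-1 * u n.
have t0 n : 0 < t n by rewrite mulr_gt0 ?powR_gt0.
have near n : exists gP : probability (borel T) R * probability (borel T * borel T)%type R,
    [/\ plans rho gP.1, couplings gP.1 (empirical R (Y n)) gP.2 &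
    (\int[gP.2]_z (dist z.1 z.2 `^ p)%:E <= (t n `^ p)%:E)%E].
  have [cs _] := HK n (u n) (Y n) (u0 n) (qe n) (Ymin n).
  have [g pg [Pi cPi PiV]] := near_plan (u0 n) cs.
  exists (g, Pi); split => //; apply: (le_trans PiV).
  rewrite lee_fin /t powRM ?powR_ge0 ?(ltW (u0 n))// -powRrM mulVf ?gt_eqF//.
  rewrite powRr1 ?(ltW B0)// /B le_eqVlt; apply/orP; left; apply/eqP; ring.
have [gP gPP] := choice near.
have subseq (P : set nat) : (\forall n \near \oo, P n) -> \forall n \near \oo, P (phi n).
  have phi_ge n : (n <= phi n)%N.
    by elim: n => // n IH; apply: leq_ltn_trans IH _; exact: phi_incr.
  move=> [N _ NP]; exists N => // n /= Nn; apply: NP => /=.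
  exact: leq_trans Nn (phi_ge n).
have ulim' : u (phi n) @[n --> \oo] --> 0.
  move/cvgrPdist_le : ulim => ulim; apply/cvgrPdist_le => e e0.
  exact: (subseq [set n | `|0 - u n| <= e] (ulim e e0)).
have tlim : t (phi n) @[n --> \oo] --> 0.
  by rewrite -(mulr0 (B `^ p^-1)); apply: cvgMr.
have gamma_plan : plans rho gamma.
  apply: (@limit_plans R D d X X0 p rho (fun n => (gP (phi n)).1)
    (fun n => empirical R (Y (phi n))) gamma (fun n => (gP (phi n)).2)
    (fun n => t (phi n))) => // n; by have [] := gPP (phi n).
suff : (rk gamma_star <= rk gamma)%E.
  move=> le g; apply: le_trans (gamma_star_min g).
  by rewrite /Ffun (asboolT gamma_plan) (asboolT minimizer_plans) leeN2.
have chain (x y z : \bar R) (a b : R) : (x <= y + a%:E)%E -> (y <= z + b%:E)%E ->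
    (x <= z + (b + a)%:E)%E.
  by move=> xy yz; rewrite (le_trans xy)// EFinD addeA leeD2r.
apply/lee_addgt0Pr => e e0.
have [K1 K10 H1] := hoelder_risk_le X0 q_gt1 r_gt1 rq beta_gt0 beta_r alpha_spectral alpha_Lq.
have [K2 K20 H2] := spectral_risk_le r_gt1 q_gt1 rq alpha_spectral alpha_Lq.
(* Each replacement of c by its truncation under a plan then costs K2 k = e / 4. *)
pose k : R := e / (4 * K2).
have k0 : 0 < k by rewrite divr_gt0// mulr_gt0.
have kr0 : 0 < k `^ r by exact: powR_gt0.
have [M M0 HM] := plans_tail p_gt0 r_gt0 beta_gt0 beta_r C_gt0 cC rho_moment kr0.
pose f x := clamp M (c x).
have fC x y : `|f x - f y| <= C * dist x y `^ beta.
  exact: le_trans (clamp_dist _ _ _) (cC x y).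
have cf : continuous f by exact: continuous_clamp.
have mf : measurable_fun setT (f : borel T -> R) by exact: continuous_borelR.
have plans_fr g : plans rho g -> (\int[g]_x (`|f x| `^ r)%:E < +oo)%E.
  move=> pg; apply: (hoelder_moment (x0 := point) r_gt1 beta_gt0 beta_r C_gt0 mf fC).
  exact: plans_moment pg.
have emp_fr n : (\int[empirical R (Y n)]_x (`|f x| `^ r)%:E < +oo)%E.
  apply: (hoelder_moment (x0 := point) r_gt1 beta_gt0 beta_r C_gt0 mf fC).
  exact: empirical_moment.
have tail g : plans rho g ->
    (\int[g]_x ((`|c x - f x| / k) `^ r)%:E <= 2%:E)%E.
  move=> pg; apply: (@le_trans _ _ ((k `^ r)^-1%:E *
      \int[g]_x (`|c x - f x| `^ r)%:E)%E).
    rewrite -ge0_integralZl//; first last.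
    - by rewrite lee_fin invr_ge0 ltW.
    - apply/measurable_EFinP; apply: (measurableT_comp (measurable_powR r)).
      by apply: measurableT_comp => //; exact: measurable_funB.
    rewrite le_eqVlt; apply/orP; left; apply/eqP; apply: eq_integral => x _.
    rewrite -EFinM powRM ?invr_ge0 ?(ltW k0)// mulrC; congr (_ * _)%:E.
    by rewrite -powR_inv1 ?(ltW k0)// powRAC powR_inv1// powR_ge0.
  apply: (@le_trans _ _ ((k `^ r)^-1%:E * (k `^ r)%:E)%E).
    by rewrite lee_wpmul2l ?lee_fin ?invr_ge0 ?(ltW kr0)//; exact: HM.
  by rewrite -EFinM mulVf ?gt_eqF// lee_fin ler1n.
have tail_l g : plans rho g -> (rk g <= spectral_risk alpha (pushforward g f) + (K2 * k)%:E)%E.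
  by move=> pg; apply: (H2 _ _ g c f k mc mf k0 (plans_cr pg) (plans_fr _ pg)); exact: tail.
have tail_r g : plans rho g -> (spectral_risk alpha (pushforward g f) <= rk g + (K2 * k)%:E)%E.
  move=> pg; apply: (H2 _ _ g f c k mf mc k0 (plans_fr _ pg) (plans_cr pg)).
  by under eq_integral do rewrite distrC; exact: tail.
(* Collects the coefficients of u^beta in the chain below: K from minimality, and K1 C B^(beta/p)
   twice, once for c and once for its truncation. *)
pose a : R := K + 2 * K1 * C * (B `^ p^-1) `^ beta.
have a0 : 0 <= a by rewrite addr_ge0// !mulr_ge0 ?powR_ge0// ltW.
have a1 : 0 < a + 1 by rewrite ltr_wpDl.
have e4 : 0 < e / 4 by rewrite divr_gt0.
(* So that u <= del implies a u^beta <= e / 4. *)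
pose del := (e / 4 / (a + 1)) `^ beta^-1.
have del0 : 0 < del by rewrite powR_gt0// divr_gt0.
have usmall : \forall n \near \oo, u (phi n) <= del.
  by apply: (cvgr_le _ ulim').
have uscr := spectral_risk_usc alpha_spectral mf (fun x => clamp_bounded (c x) M0)
  (fun s s' e' => weak_cvg_cdf cf wc) e4.
have [n [un scn]] := filter_ex (filterI usmall uscr).
set N := phi n in un scn.
have [pgN cPN PiN] := gPP N.
have [_ h1] := HK N (u N) (Y N) (u0 N) (qe N) (Ymin N).
have [_ h2] := H1 _ (empirical R (Y N)) _ c C (t N) C_gt0 (t0 N) mc cC cPN PiN
  (plans_cr pgN) (empirical_cr (Y N)).
have [h4 _] := H1 _ (empirical R (Y N)) _ f C (t N) C_gt0 (t0 N) mf fC cPN PiN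
  (plans_fr _ pgN) (emp_fr N).
(* From gamma_star to the empirical measure by minimality, to its plan, from c to f under that plan,
   back to the empirical measure, to the limit by semicontinuity, and from f to c under the limit.
   The two truncations, the semicontinuity and the terms in u^beta cost e / 4 each. *)
have := chain _ _ _ _ _ h1 (chain _ _ _ _ _ h2 (chain _ _ _ _ _ (tail_l _ pgN)
  (chain _ _ _ _ _ h4 (chain _ _ _ _ _ scn (tail_r _ gamma_plan))))).
move=> /le_trans; apply; rewrite leeD2l// lee_fin.
have kE : K2 * k = e / 4 by rewrite /k; field; rewrite gt_eqF.
have uN : u N `^ beta <= e / 4 / (a + 1).
  have -> : e / 4 / (a + 1) = del `^ beta.
    by rewrite /del -powRrM mulVf ?gt_eqF// powRr1// divr_ge0// ltW.
  by apply: ge0_ler_powR; rewrite ?nnegrE ?(ltW beta_gt0) ?(ltW (u0 N)) ?(ltW del0).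
have tN : t N `^ beta = (B `^ p^-1) `^ beta * u N `^ beta.
  by rewrite /t powRM ?powR_ge0// ltW.
have aN : a * u N `^ beta <= e / 4.
  rewrite (@le_trans _ _ ((a + 1) * u N `^ beta))//.
    by rewrite ler_wpM2r ?powR_ge0// lerDl.
  by rewrite mulrC -ler_pdivlMr.
rewrite kE tN; move: aN; rewrite /a.
by set b := _ `^ beta; set v := u N `^ beta; lra.
Qed.

End estimates.

(* The number of points is [N.+1], so that it ranges over positive integers. *)
Theorem theorem13 (R : realType) (D : nat) (d : 'I_D -> nat)
    (X : forall j, set 'rV[R]_(d j)) (X0 : forall j, X j !=set0)
    (Xconvex : forall j, convex_set (X j : set (convex_lmodType 'rV[R]_(d j))))
    (p q beta : R) (p_ge1 : 1 <= p) (q_gt1 : 1 < q)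
    (beta_gt0 : 0 < beta) (beta_le1 : beta <= 1)
    (pq_beta : beta / p + 1 / q <= 1)
    (rho : forall j, probability (borel (subset_space (X0 j))) R)
    (rho_moment : forall j, finite_moment p (rho j))
    (alpha : R -> R) (alpha_spectral : spectral_function alpha)
    (alpha_Lq : in_Lq q alpha)
    (c : prod_space X0 -> R) (c_hoelder : hoelder_continuous (@prod_l2dist R D d X X0) beta c)
    (gamma_star : probability (borel (prod_space X0)) R)
    (gamma_star_min : minimizer (Ffun rho alpha c) gamma_star)
    (u : nat -> R) (u_gt0 : forall N, 0 < u N.+1)
    (u_bound : forall N,
      (quantization_error (@prod_l2dist R D d X X0) p N.+1 gamma_star
         <= (u N.+1)%:E)%E) :
  let F := Ffun rho alpha c in
  let FN N := FNfun p rho alpha c (u N `^ (- (p - beta))) N in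
  bigO_seq (fun N => (minval (FN N.+1) - minval F)%E)
           (fun N => u N.+1 `^ beta)
  /\
  forall Y : (forall N, 'I_N.+1 -> borel (prod_space X0)),
    (forall N, minimizer (FN N.+1) (empirical R (Y N))) ->
    (u N @[N --> \oo] --> (0 : R) ->
       forall gamma : probability (borel (prod_space X0)) R,
         weak_limit_point (fun N => empirical R (Y N)) gamma ->
         minimizer F gamma)
    /\
    forall j, bigO_seq
      (fun N => wasserstein (@l2dist R _ _ (X0 j)) p (rho j)
                  (marginal (empirical R (Y N)) j))
      (fun N => u N.+1).
Proof.
have p_gt0 : 0 < p by exact: lt_le_trans p_ge1.
have [C C0 cC] := hoelder_pos_const c_hoelder.
move=> F FN; split.
  have [K1 K10 H1] := FNfun_le p_ge1 q_gt1 beta_gt0 pq_beta rho_moment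
    alpha_spectral alpha_Lq C0 cC gamma_star_min.
  have [K2 K20 H2] := FNfun_ge p_ge1 q_gt1 beta_gt0 pq_beta rho_moment
    alpha_spectral alpha_Lq C0 cC gamma_star_min.
  have fin := plans_risk_fin p_ge1 q_gt1 beta_gt0 pq_beta rho_moment
    alpha_spectral alpha_Lq C0 cC (minimizer_plans p_ge1 q_gt1 beta_gt0 pq_beta
    rho_moment alpha_spectral alpha_Lq C0 cC gamma_star_min).
  have FE : minval F = _ := minval_Ffun p_ge1 q_gt1 beta_gt0 pq_beta rho_moment
    alpha_spectral alpha_Lq C0 cC gamma_star_min.
  exists (K1 + K2); apply: nearW => N; rewrite FE.
  have [Y Yle] := H1 N (u N.+1) (u_gt0 N) (u_bound N).
  have le1 := le_trans (ereal_inf_lbound (imageT (FN N.+1) (empirical R Y))) Yle.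
  have le2 : (- spectral_risk alpha (pushforward gamma_star c) -
      (K2 * u N.+1 `^ beta)%:E <= minval (FN N.+1))%E.
    by apply: le_ereal_inf_tmp => _ [g _ <-]; exact: H2.
  rewrite (ger0_norm (powR_ge0 _ _)); move: le1 le2; rewrite -/(minval _) -(fineK fin).
  set v := u N.+1 `^ beta; have v0 : 0 <= v by exact: powR_ge0.
  (* The two bounds are finite, which rules out both infinite values of the infimum. *)
  case: (minval (FN N.+1)) => [m| |]//; rewrite -!EFinN -!EFinD !lee_fin => h1 h2.
  have k1 : 0 <= K1 * v by rewrite mulr_ge0.
  have k2 : 0 <= K2 * v by rewrite mulr_ge0.
  by rewrite ler_norml; apply/andP; split; lra.
move=> Y Ymin; split.
  move=> ulim gamma [phi phi_incr wc].
  apply: (limit_minimizer p_ge1 q_gt1 beta_gt0 pq_beta rho_moment alpha_spectral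
    alpha_Lq C0 cC gamma_star_min u_gt0 u_bound Ymin _ phi_incr wc).
  by rewrite (cvg_shiftS u).
move=> j; have [K K0 H] := minimizer_cost p_ge1 q_gt1 beta_gt0 pq_beta rho_moment
  alpha_spectral alpha_Lq C0 cC gamma_star_min.
(* One marginal cost is at most their sum, hence at most K u^p = (K^(1/p) u)^p. *)
exists (K `^ p^-1); apply: nearW => N.
rewrite gee0_abs ?poweR_ge0// (gtr0_norm (u_gt0 N)).
have [cs _] := H N (u N.+1) (Y N) (u_gt0 N) (u_bound N) (Ymin N).
apply: wasserstein_le => //; first by rewrite mulr_ge0 ?powR_ge0// ltW.
rewrite powRM ?powR_ge0 ?(ltW (u_gt0 N))// -powRrM mulVf ?gt_eqF// powRr1//.
apply: le_trans cs; rewrite (bigD1 j)//= leeDl// sume_ge0// => i _.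
exact: transport_cost_ge0.
Qed.
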